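(* Let $\Gamma\subset\mathbb{C}$ be a Jordan curve such that $0\in\operatorname{int}\Gamma$, and let $\mu$ be a finite positive Borel measure with infinite support contained in $\Gamma$, with associated moment matrix $\mathbf{M}$. The following are equivalent: (1) $\gamma(\mathbf{M})=0$. (2) $P^{2}(\mu)=L^{2}(\mu)$.
   Context: For a Jordan curve $\Gamma\subset\mathbb{C}$, $\operatorname{int}\Gamma$ denotes the bounded connected component of $\mathbb{C}\setminus\Gamma$. The moment matrix of a compactly supported finite positive Borel measure $\mu$ on $\mathbb{C}$ is the infinite matrix $\mathbf{M}=(c_{i,j})_{i,j=0}^{\infty}$ with $c_{i,j}=\int z^{i}\overline{z}^{j}\,d\mu$. $P^{2}(\mu)$ is the closure of the polynomials $\mathbb{C}[z]$ in $L^{2}(\mu)$. $c_{00}$ is the space of complex sequences (written as row vectors) with only finitely many nonzero entries, and $v^{*}$ is the conjugate transpose of $v$. For $v=(v_1,v_2,\dots)\in c_{00}$, $(1,v)=(1,v_1,v_2,\dots)$, and $$\gamma(\mathbf{M})=\inf\{(1,v)\,\mathbf{M}\,(1,v)^{*} : v\in c_{00}\}.$$ *)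

(* Defs.v *)
From HB Require Import structures.
From mathcomp Require Import all_boot all_order all_algebra.
From mathcomp Require Import complex.
From mathcomp Require Import all_classical all_reals all_analysis.

Set Implicit Arguments.
Unset Strict Implicit.
Unset Printing Implicit Defensive.

Import Order.TTheory GRing.Theory Num.Theory.
Import numFieldNormedType.Exports.

Local Open Scope classical_set_scope.
Local Open Scope ring_scope.

(* [R[i]] itself carries no topology; packed as a numClosedFieldType it receives
   the one induced by the modulus, like any numeric field. *)
Definition Cplx (R : realType) : numClosedFieldType := R[i].

Definition borelC (R : realType) := g_sigma_algebraType (@open (Cplx R)).

Definition jordan_curve (R : realType) (G : set (Cplx R)) : Prop :=
  let circle := [set z : Cplx R | `|z| = 1] in
  exists g : Cplx R -> Cplx R,
    [/\ {within circle, continuous g}, set_inj circle g & G = g @` circle].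

(* The union of the bounded components of the complement; for a Jordan curve
   there is exactly one such component. *)
Definition jordan_int (R : realType) (G : set (Cplx R)) : set (Cplx R) :=
  [set z | ~ G z /\ bounded_set (connected_component (~` G) z)].

Section measure.
Context {R : realType}.
Variable mu : {finite_measure set (borelC R) -> \bar R}.

Definition measure_support : set (Cplx R) :=
  [set z | forall U : set (Cplx R), open U -> U z -> (0 < mu U)%E].

Definition Cintegral (f : Cplx R -> Cplx R) : Cplx R :=
  Complex (\int[mu]_(z in setT) complex.Re (f z))%R
          (\int[mu]_(z in setT) complex.Im (f z))%R.

Definition moment_matrix (i j : nat) : Cplx R :=
  Cintegral (fun z => z ^+ i * (z^* ) ^+ j).

Definition L2norm (f : Cplx R -> Cplx R) : \bar R :=
  Lnorm mu 2%:E (fun z => (complex.Re `|f z|)%:E).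

(* [L2] and [P2] are sets of functions, both stable under almost everywhere
   equality, rather than sets of equivalence classes. *)
Definition L2 : set (Cplx R -> Cplx R) :=
  [set f | measurable_fun setT (f : borelC R -> borelC R) /\ (L2norm f < +oo)%E].

Definition P2 : set (Cplx R -> Cplx R) :=
  [set f | L2 f /\ forall e : R, 0 < e ->
     exists p : {poly Cplx R}, (L2norm (fun z => f z - p.[z])%R < e%:E)%E].

End measure.

Section moment_matrices.
Context {R : realType}.

Definition c00 : set (nat -> Cplx R) :=
  [set v | finite_set [set n | v n != 0]].

Definition one_cons (v : nat -> Cplx R) (n : nat) : Cplx R :=
  if n is k.+1 then v k else 1.

(* [w M w^*]: the sums are over finite supports when [w] is in [c00]. *)
Definition hform (M : nat -> nat -> Cplx R) (w : nat -> Cplx R) : Cplx R :=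
  \sum_(i \in [set: nat]) \sum_(j \in [set: nat]) w i * M i j * (w j)^*.

(* [hform M w] is a real number when [M] is Hermitian; [complex.Re] only moves
   it to [R]. *)
Definition gamma (M : nat -> nat -> Cplx R) : \bar R :=
  ereal_inf [set (complex.Re (hform M (one_cons v)))%:E | v in c00].

End moment_matrices.

(* Main.v *)
Require Import Defs.
From mathcomp Require Import all_boot all_order all_algebra.
From mathcomp Require Import complex.
From mathcomp Require Import all_classical all_reals all_analysis measurable_realfun.
From mathcomp Require Import ring lra zify.
Import Order.TTheory GRing.Theory Num.Theory.
Import numFieldNormedType.Exports HBSimple HBNNSimple.
Set Implicit Arguments.
Unset Strict Implicit.
Unset Printing Implicit Defensive.
Local Open Scope classical_set_scope.
Local Open Scope ring_scope.
Local Notation Re := complex.Re.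
Local Notation Im := complex.Im.

(** Write sq f for the integral of |f|^2 against mu over the curve G. The form
    (1, v) M (1, v)^* is sq P for the polynomial P = 1 + v_1 z + v_2 z^2 + ...
    ([hform_moments]), so gamma(M) is the infimum of sq P over polynomials with
    P(0) = 1. Writing P = 1 - z Q and using that |z| is bounded above and away
    from 0 on G, gamma(M) = 0 says exactly that 1/z is a limit of polynomials in
    L^2(mu) ([gamma_apx_cinv]). This gives (2) -> (1) at once, and reduces (1)
    -> (2) to a density statement: once 1/z is in P^2(mu), every L^2 function
    is.

    Call a bounded function a multiplier if it maps the closure of the
    polynomials to itself. If 1/z is in the closure then 1/z is a multiplier,
    because p(z) / z = q(z) + c / z. Multipliers form an algebra, closed under
    uniform limits, so every uniform limit of polynomials in z and 1/z is one.
    The heart of the proof is the theorem of Walsh that on a Jordan curve around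
    0 the function conj z is such a uniform limit ([conj_ratapp]). Granting it,
    Re z and Im z are multipliers; the polynomials (1 - t^n)^(n 2^n), which tend
    to the indicator of t < 1/2 boundedly on [0, 1], make half-planes, hence
    rational boxes, hence Borel sets multipliers ([mult_sets_measurable]);
    simple functions approximate the rest ([apx_L2]).

    Walsh's theorem is proved without conformal mapping. Since conj z = |z|^2 /
    z, it is enough to approximate |z| ([modulus_ratapp]). For n points x
    equally spaced on the circle of radius rho, the mean of x / (z - x) is rho^n
    / (z^n - rho^n), which for large n is nearly 0 outside the circle and nearly
    -1 inside; summing over radii rho in small steps up to a bound L for |z| on
    G recovers |z| - L. The poles x are the obstacle, as they may lie on G. Each
    1 / (z - x) is therefore replaced by a function k that is a uniform limit of
    Laurent polynomials, is bounded by a multiple of 1/r on G, and at distance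
    3r or more from x is within a multiple of r / |z - x|^2 of 1 / (z - x)
    ([cauchy_kernel]). Averaged over the circle these errors are controlled by
    the Poisson kernel ([poisson_mean]): they are small off a thin annulus, and
    on the annulus they are outweighed by its thinness ([modulus_approx]).

    To build k near x, one takes w off G close to x ([curve_empty_interior]) and
    moves a point a away from w inside the component of w, continuing along the
    way a square root s of (z - a) / (z - w) on G; every step multiplies s by
    the square root of a function within 1/2 of 1, so s stays a limit of Laurent
    polynomials. When a has reached a distance of order r, the Koebe-type
    quotient 4 (s - 1) / (s + 1) is bounded and agrees with (w - a) / (z - w) to
    first order; dividing by w - a gives k. This uses that 1 / (z - a) is a
    limit of Laurent polynomials for all a off G ([ratapp_cauchy]), which holds
    since every a lies in an unbounded component or in the component of 0: a
    Jordan curve has at most one bounded complementary component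
    ([bounded_component_unique]). The latter is a winding number argument:
    continuous functions of the parameter extend to the plane, and no nonzero
    power of the direction (z - p) / |z - p| on a circle around p extends to a
    unimodular function on the disc. *)

(** * Moduli and continuity in the plane *)

(** The library modulus is complex-valued; estimates are made with its real part. *)
Definition nm (R : realType) (z : Cplx R) : R := complex.Re `|z|.

Definition ofR (R : realType) (x : R) : Cplx R := Complex x 0.

Section plane.
Context {R : realType}.
Notation C := (Cplx R).
Implicit Types (x y z w : C) (a b : R).

Lemma ReD x y : Re (x + y) = Re x + Re y. Proof. by case: x y => [? ?] [? ?]. Qed.
Lemma ImD x y : Im (x + y) = Im x + Im y. Proof. by case: x y => [? ?] [? ?]. Qed.
Lemma ReN x : Re (- x) = - Re x. Proof. by case: x. Qed.
Lemma ImN x : Im (- x) = - Im x. Proof. by case: x. Qed.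
Lemma ReB x y : Re (x - y) = Re x - Re y. Proof. by rewrite ReD ReN. Qed.
Lemma ImB x y : Im (x - y) = Im x - Im y. Proof. by rewrite ImD ImN. Qed.
Lemma RecM x y : Re (x * y) = Re x * Re y - Im x * Im y.
Proof. by case: x y => [? ?] [? ?]. Qed.
Lemma ImcM x y : Im (x * y) = Re x * Im y + Im x * Re y.
Proof. by case: x y => [? ?] [? ?]. Qed.
Lemma Re1 : Re (1 : C) = 1. Proof. by []. Qed.
Lemma CE x y : Re x = Re y -> Im x = Im y -> x = y.
Proof. by case: x y => [? ?] [? ?] /= -> ->. Qed.
Lemma Rec_conj x : Re x^* = Re x. Proof. by case: x. Qed.
Lemma Imc_conj x : Im x^* = - Im x. Proof. by case: x. Qed.

Lemma nmE z : nm z = Num.sqrt (Re z ^+ 2 + Im z ^+ 2).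
Proof. by rewrite /nm normc_def. Qed.

Lemma sqr_nm z : nm z ^+ 2 = Re z ^+ 2 + Im z ^+ 2.
Proof. by rewrite nmE sqr_sqrtr// addr_ge0 ?sqr_ge0. Qed.

Lemma normCE z : `|z| = ofR (nm z).
Proof. by rewrite /nm normc_def. Qed.

Lemma nm_ge0 z : 0 <= nm z. Proof. by rewrite nmE sqrtr_ge0. Qed.

Lemma nm_eq0 z : (nm z == 0) = (z == 0).
Proof. by rewrite -(normr_eq0 z) normCE; apply/eqP/eqP => [->//|[]]. Qed.

Lemma nm_gt0 z : (0 < nm z) = (z != 0).
Proof. by rewrite lt_neqAle nm_ge0 andbT eq_sym nm_eq0. Qed.

Lemma nm0 : nm (0 : C) = 0. Proof. by apply/eqP; rewrite nm_eq0. Qed.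
Lemma nm1 : nm (1 : C) = 1. Proof. by rewrite /nm normr1. Qed.
Lemma nmN z : nm (- z) = nm z. Proof. by rewrite /nm normrN. Qed.
Lemma nm_sub z w : nm (z - w) = nm (w - z).
Proof. by rewrite -nmN opprB. Qed.
Lemma nmM z w : nm (z * w) = nm z * nm w.
Proof. by rewrite /nm normrM !normCE RecM /= mulr0 subr0. Qed.
Lemma nmX z n : nm (z ^+ n) = nm z ^+ n.
Proof. by elim: n => [|n IH]; rewrite ?expr0 ?nm1// !exprS nmM IH. Qed.
Lemma nmV z : nm z^-1 = (nm z)^-1.
Proof.
have [->|z0] := eqVneq z 0; first by rewrite invr0 nm0 invr0.
apply: (mulfI (_ : nm z != 0)); first by rewrite nm_eq0.
by rewrite -nmM !divff ?nm1// nm_eq0.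
Qed.
Lemma nm_div z w : nm (z / w) = nm z / nm w.
Proof. by rewrite nmM nmV. Qed.
Lemma ler_nmD z w : nm (z + w) <= nm z + nm w.
Proof.
have := ler_normD (z : C) w; rewrite !normCE lecE /=.
by case/andP.
Qed.
Lemma ler_nmB z w : nm (z - w) <= nm z + nm w.
Proof. by rewrite -(nmN w) ler_nmD. Qed.
Lemma ler_nm_dist x y z : nm (x - z) <= nm (x - y) + nm (y - z).
Proof. by rewrite (le_trans _ (ler_nmD _ _))// addrA subrK. Qed.
Lemma lerB_nm z w : nm z - nm w <= nm (z - w).
Proof. by rewrite lerBlDr (le_trans _ (ler_nmD _ _))// subrK. Qed.
Lemma ler_nm_sum (I : Type) (r : seq I) (P : pred I) (F : I -> C) :
  nm (\sum_(i <- r | P i) F i) <= \sum_(i <- r | P i) nm (F i).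
Proof.
elim/big_rec2 : _ => [|i y x _ h]; first by rewrite nm0.
by rewrite (le_trans (ler_nmD _ _))// lerD2l.
Qed.
Lemma nm_conj z : nm z^* = nm z.
Proof. by rewrite !nmE Rec_conj Imc_conj sqrrN. Qed.
Lemma Re_le_nm z : `|Re z| <= nm z.
Proof.
rewrite -(@ler_pXn2r _ 2)// ?nnegrE ?nm_ge0// sqr_nm real_normK ?num_real//.
by rewrite lerDl sqr_ge0.
Qed.
Lemma Im_le_nm z : `|Im z| <= nm z.
Proof.
rewrite -(@ler_pXn2r _ 2)// ?nnegrE ?nm_ge0// sqr_nm real_normK ?num_real//.
by rewrite lerDr sqr_ge0.
Qed.
Lemma nm_le_ReIm z : nm z <= `|Re z| + `|Im z|.
Proof.
rewrite -(@ler_pXn2r _ 2)// ?nnegrE ?nm_ge0// ?addr_ge0// sqr_nm sqrrD.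
rewrite !real_normK ?num_real// -addrA [_ *+ 2 + _]addrC addrA lerDl.
by rewrite mulrn_wge0// mulr_ge0.
Qed.
Lemma nm_ofR a : nm (ofR a) = `|a|.
Proof. by rewrite nmE /= expr0n /= addr0 sqrtr_sqr. Qed.
Lemma nm_Complex a b : nm (Complex a b) = Num.sqrt (a ^+ 2 + b ^+ 2).
Proof. by rewrite nmE. Qed.

Lemma ofRD a b : ofR (a + b) = ofR a + ofR b.
Proof. by apply: CE; rewrite ?ReD ?ImD /= ?addr0. Qed.
Lemma ofRM a b : ofR (a * b) = ofR a * ofR b.
Proof. by apply: CE; rewrite ?RecM ?ImcM /= ?mulr0 ?mul0r ?subr0 ?addr0. Qed.
Lemma ofRN a : ofR (- a) = - ofR a.
Proof. by apply: CE; rewrite ?ReN ?ImN //= oppr0. Qed.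
Lemma ofR1 : ofR (1:R) = 1. Proof. by []. Qed.
Lemma ofR0 : ofR (0:R) = 0. Proof. by []. Qed.
Lemma ofR_nat n : ofR (n%:R : R) = n%:R.
Proof. by elim: n => // n IH; rewrite -addn1 !natrD ofRD IH. Qed.
Lemma nm_nat n : nm (n%:R : C) = n%:R.
Proof. by rewrite -ofR_nat nm_ofR ger0_norm. Qed.
Lemma mul_conj z : z * z^* = ofR (nm z ^+ 2).
Proof.
apply: CE; rewrite ?RecM ?ImcM Rec_conj Imc_conj ?sqr_nm /=; first by ring.
by rewrite mulrN mulrC addrC subrr.
Qed.
Lemma ReZ a z : Re (ofR a * z) = a * Re z.
Proof. by rewrite RecM /ofR /= mul0r subr0. Qed.
Lemma ImZ a z : Im (ofR a * z) = a * Im z.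
Proof. by rewrite ImcM /ofR /= mul0r addr0. Qed.
(** Expresses the inverse through operations whose measurability is known. *)
Lemma invCE z : z^-1 = ofR (nm z ^- 2) * z^*.
Proof.
have [->|z0] := eqVneq z 0.
  by rewrite invr0 nm0 expr0n /= invr0 ofR0 mul0r.
apply: (mulfI z0); rewrite divff// mulrCA mul_conj -ofRM mulVf//.
by rewrite expf_neq0// nm_eq0.
Qed.

Lemma ballCE z (e : R) w : ball (z : C) (ofR e) w <-> nm (w - z) < e.
Proof.
rewrite -ball_normE /= /ball_ /= normCE nm_sub ltcE /= eqxx /=.
by split.
Qed.

Lemma nbhsCP z (U : set C) :
  nbhs z U <-> exists2 e : R, 0 < e & forall w, nm (w - z) < e -> U w.
Proof.
rewrite -nbhs_ballE; split=> [[e /= e0 eU]|[e e0 eU]].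
  have ee : e = ofR (Re e).
    by move: e0; rewrite ltcE => /andP[/eqP i0 _]; apply: CE.
  exists (Re e); first by move: e0; rewrite ltcE => /andP[_].
  by move=> w we; apply: eU; rewrite /= ee; apply/ballCE.
exists (ofR e) => /=; first by rewrite ltcE /= eqxx.
by move=> w /ballCE; exact: eU.
Qed.

Lemma openCP (U : set C) : open U <->
  forall z, U z -> exists2 e : R, 0 < e & forall w, nm (w - z) < e -> U w.
Proof.
rewrite openE; split => [h z /h /nbhsCP//|h z /h Uz].
exact/nbhsCP.
Qed.

Lemma continuousCR (f : C -> R) z : {for z, continuous f} <->
  forall e, 0 < e -> exists2 d : R, 0 < d &
    forall w, nm (w - z) < d -> `|f w - f z| < e.
Proof.
split=> [/cvgrPdist_lt h e e0|h].
  have /nbhsCP[d d0 dh] := h e e0; exists d => // w /dh.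
  by rewrite /= distrC.
apply/(@cvgrPdist_lt _ _ _ (nbhs z)) => e e0; apply/nbhsCP.
by have [d d0 dh] := h e e0; exists d => // w /dh; rewrite /= distrC.
Qed.

Lemma continuousTC (T : topologicalType) (f : T -> C) (t : T) :
  {for t, continuous f} <->
  forall e, 0 < e -> \forall w \near t, nm (f w - f t) < e.
Proof.
split=> [h e e0|h].
  suff /h : nbhs (f t) [set y | nm (y - f t) < e] by [].
  by apply/nbhsCP; exists e.
move=> U /nbhsCP[e e0 eU]; have := h e e0; apply: filterS => w; exact: eU.
Qed.

Lemma continuousCC (f : C -> C) z : {for z, continuous f} <->
  forall e, 0 < e -> exists2 d : R, 0 < d &
    forall w, nm (w - z) < d -> nm (f w - f z) < e.
Proof.
split=> [/continuousTC h e e0|h].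
  by have /nbhsCP[d d0 dh] := h e e0; exists d.
apply/continuousTC => e e0; apply/nbhsCP.
by have [d d0 dh] := h e e0; exists d.
Qed.

Lemma continuous_Re : continuous (@Re R : C -> R).
Proof.
move=> z; apply/continuousCR => e e0; exists e => // w.
by rewrite -ReB; exact/le_lt_trans/Re_le_nm.
Qed.

Lemma continuous_Im : continuous (@Im R : C -> R).
Proof.
move=> z; apply/continuousCR => e e0; exists e => // w.
by rewrite -ImB; exact/le_lt_trans/Im_le_nm.
Qed.

Lemma continuous_nm : continuous (@nm R).
Proof.
move=> z; apply/continuousCR => e e0; exists e => // w we.
rewrite ltr_norml; apply/andP; split; last exact: le_lt_trans (lerB_nm _ _) we.
by rewrite ltrNl opprB (le_lt_trans (lerB_nm _ _))// nm_sub.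
Qed.

Lemma continuous_mkC (T : topologicalType) (f g : T -> R) t :
  {for t, continuous f} -> {for t, continuous g} ->
  {for t, continuous (fun x : T => Complex (f x) (g x) : C)}.
Proof.
move=> /cvgrPdist_lt cf /cvgrPdist_lt cg; apply/continuousTC => e e0.
have e20 : 0 < e / 2 by rewrite divr_gt0.
near=> w; apply: le_lt_trans (nm_le_ReIm _) _.
rewrite ReB ImB /= (splitr e) ltrD// distrC.
  by near: w; exact: cf.
by near: w; exact: cg.
Unshelve. all: by end_near. Qed.

Lemma continuous_ofR : continuous (@ofR R).
Proof.
move=> x; apply: continuous_mkC; [exact: cvg_id|exact: cvg_cst].
Qed.

Lemma continuous_cstT (T U : topologicalType) (c : U) (t : T) :
  {for t, continuous (fun _ : T => c)}.
Proof. exact: cvg_cst. Qed.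

Lemma continuous_idT (T : topologicalType) (t : T) :
  {for t, continuous (fun x : T => x)}.
Proof. exact: cvg_id. Qed.

Lemma continuous_pairT (T U V : topologicalType) (f : T -> U) (g : T -> V) (t : T) :
  {for t, continuous f} -> {for t, continuous g} ->
  {for t, continuous (fun x : T => (f x, g x))}.
Proof. by move=> cf cg; exact: cvg_pair. Qed.

Lemma continuous_MC (T : topologicalType) (f g : T -> C) (t : T) :
  {for t, continuous f} -> {for t, continuous g} ->
  {for t, continuous (fun x : T => f x * g x)}.
Proof. exact: (@continuousM C). Qed.

Lemma continuous_VC (T : topologicalType) (f : T -> C) (t : T) :
  f t != 0 -> {for t, continuous f} -> {for t, continuous (fun x : T => (f x)^-1)}.
Proof. exact: (@continuousV C). Qed.

Lemma continuous_DC (T : topologicalType) (f g : T -> C) (t : T) :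
  {for t, continuous f} -> {for t, continuous g} ->
  {for t, continuous (fun x : T => f x + g x)}.
Proof. exact: (@continuousD C C). Qed.

Lemma continuous_XC (T : topologicalType) (f : T -> C) (t : T) n :
  {for t, continuous f} -> {for t, continuous (fun x : T => f x ^+ n)}.
Proof.
move=> cf; elim: n => [|n IH]; first exact: cvg_cst.
rewrite [X in prop_for _ (inPhantom (continuous X))]
  (_ : _ = fun x : T => f x * f x ^+ n); first exact: continuous_MC.
by apply/funext => y; rewrite exprS.
Qed.

Lemma continuous_exprzC (T : topologicalType) (f : T -> C) (t : T) (m : int) :
  f t != 0 -> {for t, continuous f} ->
  {for t, continuous (fun x : T => f x ^ m)}.
Proof.
move=> f0 cf; case: m => n; first exact: continuous_XC.
by apply: continuous_VC; [rewrite expf_neq0|exact: continuous_XC].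
Qed.

End plane.

(** * Angles of unit complex numbers *)

Definition expi (R : realType) (t : R) : Cplx R := Complex (cos t) (sin t).

Section lift.
Context {R : realType}.
Notation C := (Cplx R).
Implicit Types (x y z w : C) (a b : R).

Lemma expiD a b : expi (a + b) = expi a * expi b.
Proof.
by apply: CE; rewrite ?RecM ?ImcM /= ?cosD ?sinD//; ring.
Qed.
Lemma expi0 : expi (0 : R) = 1.
Proof. by rewrite /expi cos0 sin0. Qed.
Lemma nm_expi a : nm (expi a) = 1.
Proof. by rewrite nm_Complex cos2Dsin2 sqrtr1. Qed.
Lemma expi_neq0 a : expi a != 0.
Proof. by rewrite -nm_eq0 nm_expi oner_eq0. Qed.
Lemma expiN a : expi (- a) = (expi a)^-1.
Proof.
apply: (mulfI (expi_neq0 a)); rewrite -expiD subrr expi0 divff//.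
exact: expi_neq0.
Qed.
Lemma expi_sum (I : Type) (r : seq I) (F : I -> R) :
  expi (\sum_(i <- r) F i) = \prod_(i <- r) expi (F i).
Proof. by elim/big_rec2 : _ => [|i y x _ <-]; rewrite ?expi0 ?expiD. Qed.
Lemma expiMn a n : expi (a *+ n) = expi a ^+ n.
Proof. by elim: n => [|n IH]; rewrite ?expi0// mulrS expiD exprS IH. Qed.
Lemma expiMz a (m : int) : expi (a *~ m) = expi a ^ m.
Proof.
case: m => n; first by rewrite -pmulrn expiMn -exprnP.
by rewrite NegzE mulrNz expiN -pmulrn expiMn -exprnN.
Qed.
Lemma expi2pi : expi (pi *+ 2 : R) = 1.
Proof. by rewrite /expi cos2pi sin2pi. Qed.

Lemma continuous_expi : continuous (@expi R).
Proof.
by move=> t; apply: continuous_mkC; [exact: continuous_cos|exact: continuous_sin].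
Qed.

Lemma expi_surj w : nm w = 1 -> exists2 t, 0 <= t <= pi *+ 2 & w = expi t.
Proof.
move=> w1; have h : Re w ^+ 2 + Im w ^+ 2 = 1 by rewrite -sqr_nm w1 expr1n.
have hr : -1 <= Re w <= 1.
  by rewrite -ler_norml -w1 Re_le_nm.
have c := acosK hr.
have s : sin (acos (Re w)) = `|Im w|.
  rewrite sin_acos//; rewrite -sqrtr_sqr; congr Num.sqrt; lra.
have p0 := pi_ge0 R; have a0 := acos_ge0 hr; have api := acos_lepi hr.
have [i0|i0] := leP 0 (Im w).
  exists (acos (Re w)); first by rewrite a0 mulr2n /=; lra.
  by apply: CE; rewrite /= ?c ?s ?ger0_norm.
exists (pi *+ 2 - acos (Re w)); first by rewrite mulr2n; apply/andP; split; lra.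
apply: CE; rewrite expiD expi2pi mul1r /= ?cosN ?sinN ?c//.
by rewrite s ltr0_norm// opprK.
Qed.

Lemma cos_eq1 a : 0 <= a < pi *+ 2 -> cos a = 1 -> a = 0.
Proof.
rewrite mulr2n => /andP[a0 a2] ca.
have p0 := pi_ge0 R.
have [ap|ap] := leP a pi.
  by apply: cos_inj; rewrite ?cos0 ?ca// in_itv /= ?lexx ?a0.
have : cos (pi *+ 2 - a) = 1 by rewrite addrC cosD2pi cosN.
move=> c2; suff : pi *+ 2 - a = 0 by rewrite mulr2n; lra.
by apply: cos_inj; rewrite ?cos0 ?c2// in_itv /= ?lexx ?mulr2n; lra.
Qed.

Lemma expi_eq1 a : expi a = 1 -> exists m : int, a = (pi *+ 2) *~ m.
Proof.
move=> ha; have p0 : 0 < pi *+ 2 :> R by rewrite mulrn_wgt0// pi_gt0.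
pose m := Num.floor (a / (pi *+ 2)); exists m.
have /andP[l u] := floor_itv (a / (pi *+ 2)).
have hb : expi (a - (pi *+ 2) *~ m) = 1.
  by rewrite expiD -mulrNz expiMz expi2pi exp1rz mulr1.
apply/eqP; rewrite -subr_eq0; apply/eqP; apply: cos_eq1; last by case: hb.
rewrite -mulrzr subr_ge0 ltrBlDr mulrC -ler_pdivlMr// l /=.
by move: u; rewrite ltr_pdivrMr// intrD mulrDl mul1r addrC.
Qed.

(** Otherwise the intermediate value theorem gives a point where d is an odd number of
    half turns. *)
Lemma expi_const (d : R -> R) : continuous d -> (forall t, expi (d t) = 1) ->
  forall s t, d s = d t.
Proof.
move=> cd d1; suff key : forall s t, s <= t -> d s = d t.
  by move=> s t; have [/key//|/ltW/key] := leP s t.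
move=> s t st; apply: contrapT => /eqP dst.
have [m dm] := expi_eq1 (d1 s); have [n dn] := expi_eq1 (d1 t).
have p0 : 0 < pi *+ 2 :> R by rewrite mulrn_wgt0// pi_gt0.
pose k := Num.min m n.
(* the value half a turn above the smaller of the two is attained *)
have [c _ dc] : exists2 c, c \in `[s, t] & d c = (pi *+ 2) *~ k + pi.
  apply: IVT => //; first exact: continuous_subspaceT.
  have mn : m != n by apply: contraNneq dst => mn; rewrite dm dn mn.
  have step (i j : int) : i < j -> (pi *+ 2) *~ i + pi <= (pi *+ 2 : R) *~ j.
    move=> ij; have : (i%:~R + 1 : R) <= j%:~R by rewrite -(intrD _ i 1) ler_int lezD1.
    rewrite -(ler_pM2l p0) mulrDr mulr1 !mulrzr => /(le_trans _); apply.
    by rewrite lerD2l mulr2n lerDl pi_ge0.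
  have ge (i : int) : (pi *+ 2) *~ i <= (pi *+ 2) *~ i + pi :> R.
    by rewrite lerDl pi_ge0.
  rewrite dm dn ge_min le_max /k.
  by case: (ltgtP m n) mn => // mn _; rewrite ge (step _ _ mn) ?orbT.
have := d1 c; rewrite dc expiD expiMz expi2pi exp1rz mul1r => -[].
by rewrite cospi => /eqP; rewrite eq_sym -addr_eq0 -mulr2n pnatr_eq0.
Qed.

(** The principal argument, on the right half-plane only. *)
Definition angle (u : C) : R := atan (Im u / Re u).

Lemma expi_angle u : nm u = 1 -> 0 < Re u -> expi (angle u) = u.
Proof.
move=> u1 r0.
have c : cos (angle u) = Re u.
  rewrite cos_atan expr_div_n -[1](@divff _ (Re u ^+ 2)) ?lt0r_neq0 ?exprn_gt0//.
  by rewrite -mulrDl -sqr_nm u1 expr1n mul1r -exprVn sqrtr_sqr ger0_norm ?invrK// invr_ge0 ltW.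
apply: CE => //=; have := atanK (Im u / Re u); rewrite /tan -/(angle u) c.
by move/(congr1 ( *%R^~ (Re u))); rewrite !divfK// gt_eqF.
Qed.

Lemma continuous_angle (T : topologicalType) (f : T -> C) (t : T) :
  0 < Re (f t) -> {for t, continuous f} ->
  {for t, continuous (fun x : T => angle (f x))}.
Proof.
move=> r0 cf; apply: (@continuous_comp _ _ _ (fun x : T => Im (f x) / Re (f x)) (@atan R) t).
  apply: continuousM.
    apply: (@continuous_comp _ _ _ f (@Im R : C -> R)) => //; exact: continuous_Im.
  apply: continuousV; first by rewrite gt_eqF.
  apply: (@continuous_comp _ _ _ f (@Re R : C -> R)) => //; exact: continuous_Re.
exact: continuous_atan.
Qed.

Lemma nm_sub1_Re u : nm (u - 1 : C) < 1 -> 0 < Re u.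
Proof.
move=> h; have := le_lt_trans (Re_le_nm (u - 1)) h; rewrite ReB Re1 ltr_norml.
by move=> /andP[+ _]; rewrite ltrBrDr addrC subrr.
Qed.

Definition square (L : R) : set C := [set z | `|Re z| <= L /\ `|Im z| <= L].

Lemma compact_square L : compact (square L).
Proof.
have -> : square L =
    (fun p : R * R => Complex p.1 p.2 : C) @` (`[-L, L] `*` `[-L, L]).
  apply/seteqP; split=> [z [h1 h2]|_ [[a b] /= [+ +] <-]].
    exists (Re z, Im z); last by apply: CE.
    by split; rewrite /= in_itv /= -ler_norml.
  by rewrite !in_itv /= -!ler_norml.
apply: continuous_compact; last by apply: compact_setX; exact: segment_compact.
apply: continuous_subspaceT => p; apply: continuous_mkC.
  exact: cvg_fst.
exact: cvg_snd.
Qed.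

(** Only x is confined to K: a point y close to K is allowed to lie outside. *)
Lemma compact_unif_continuous (K : set C) (F : C -> C) :
  compact K -> continuous F -> forall e, 0 < e ->
  exists2 d : R, 0 < d &
    forall x y, K x -> nm (y - x) < d -> nm (F y - F x) < e.
Proof.
move=> /compact_near_coveringP cK cF e e0.
have /(_ _) := cK R (0^'+) (fun d x => forall y, nm (y - x) < d -> nm (F y - F x) < e) _.
case=> [x Kx|].
  have e2 : 0 < e / 2 by rewrite divr_gt0.
  have /continuousCC /(_ _ e2) [d d0 dF] := cF x.
  have d2 : 0 < d / 2 by rewrite divr_gt0.
  near=> x' d'.
  have x'x : nm (x' - x) < d / 2.
    by near: x'; apply/nbhsCP; exists (d / 2).
  have d'd : d' <= d / 2 by near: d'; exact: nbhs_right_le.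
  move=> y yx' /=; apply: le_lt_trans (ler_nm_dist _ (F x) _) _.
  rewrite (splitr e) ltrD//.
    apply: dF; apply: le_lt_trans (ler_nm_dist _ x' _) _.
    by rewrite (splitr d) ltrD// (lt_le_trans yx').
  by rewrite nm_sub; apply: dF; rewrite (lt_trans x'x)// ltr_pdivrMr// ltr_pMr// ltr1n.
move=> d /= d0 dK; exists (d / 2).
  by rewrite divr_gt0.
move=> x y Kx; apply: (dK (d / 2)) => //=; rewrite ?divr_gt0//.
by rewrite sub0r normrN gtr0_norm ?divr_gt0// ltr_pdivrMr// ltr_pMr// ltr1n.
Unshelve. all: by end_near. Qed.

End lift.

(** * Continuous angles on a square *)

Section lift_square.
Context {R : realType}.
Notation C := (Cplx R).
Implicit Types (x y z w : C) (a b : R).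

Lemma continuous_sumR (T : topologicalType) (f : nat -> T -> R) n (t : T) :
  (forall i, {for t, continuous (f i)}) ->
  {for t, continuous (fun x : T => \sum_(i < n) f i x)}.
Proof.
move=> cf; elim: n => [|n IH].
  have -> : (fun x : T => \sum_(i < 0) f i x) = fun=> 0.
    by apply/funext => t'; rewrite big_ord0.
  exact: continuous_cstT.
have -> : (fun x : T => \sum_(i < n.+1) f i x) =
    (fun x : T => (\sum_(i < n) f i x) + f n x).
  by apply/funext => t'; rewrite big_ord_recr.
exact: (@continuousD _ R^o).
Qed.

Definition clamp (L a : R) : R := Num.max (- L) (Num.min L a).

Lemma clamp_norm L a : 0 <= L -> `|clamp L a| <= L.
Proof.
move=> L0; rewrite ler_norml /clamp le_max lexx /= ge_max ge_min lexx /= andbT.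
by rewrite lerNl; lra.
Qed.

Lemma clamp_id L a : `|a| <= L -> clamp L a = a.
Proof. by rewrite ler_norml /clamp => /andP[h1 h2]; rewrite min_r// max_r. Qed.

Lemma continuous_clamp L : continuous (clamp L).
Proof.
move=> a; apply: (@continuous_max R _ (fun=> - L) (fun a : R => Num.min L a)).
  exact: continuous_cstT.
by apply: (@continuous_min R _ (fun=> L) id); [exact: continuous_cstT|exact: cvg_id].
Qed.

Definition retract_square (L : R) z : C := Complex (clamp L (Re z)) (clamp L (Im z)).

Lemma retract_squareP L z : 0 <= L -> square L (retract_square L z).
Proof. by move=> L0; split; apply: clamp_norm. Qed.

Lemma retract_square_id L z : square L z -> retract_square L z = z.
Proof. by case=> h1 h2; apply: CE; rewrite /= clamp_id. Qed.

Lemma continuous_retract_square L : continuous (retract_square L).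
Proof.
move=> z; apply: (@continuous_mkC R _ (fun z : C => clamp L (Re z))
    (fun z : C => clamp L (Im z)) z).
  apply: (@continuous_comp _ _ _ (@Re R : C -> R) (clamp L)).
    exact: continuous_Re.
  exact: continuous_clamp.
apply: (@continuous_comp _ _ _ (@Im R : C -> R) (clamp L)).
  exact: continuous_Im.
exact: continuous_clamp.
Qed.

Lemma square_scale L z a : `|a| <= 1 -> square L z -> square L (ofR a * z).
Proof.
move=> a1 [h1 h2]; split; rewrite ?ReZ ?ImZ normrM.
  by apply: le_trans h1; rewrite ler_piMl.
by apply: le_trans h2; rewrite ler_piMl.
Qed.

(** Along the ray from 0 to z, cut into N equal pieces, uniform continuity makes
    successive quotients of values of F close to 1, so each has a continuous
    principal argument; the quotients telescope to F z / F 0.  Retracting the plane to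
    the square makes the sum of the arguments continuous everywhere. *)
Lemma lift_square (F : C -> C) L : 0 < L -> continuous F ->
  (forall z, nm (F z) = 1) ->
  exists2 b : C -> R, continuous b & forall z, square L z -> F z = expi (b z).
Proof.
move=> L0 cF F1.
have [d d0 dF] := compact_unif_continuous (@compact_square _ L) cF ltr01.
(* consecutive points of a ray cut into N pieces are closer than d *)
pose N := (Num.bound (2 * L / d)).+1.
have N0 : 0 < N%:R :> R by rewrite ltr0n.
have Nd : 2 * L / N%:R < d.
  rewrite ltr_pdivrMr// [d * _]mulrC -ltr_pdivrMr//.
  have h : 0 <= 2 * L / d by rewrite divr_ge0 ?mulr_ge0// ltW.
  by rewrite (lt_trans (archi_boundP h))// ltr_nat.
pose x (i : nat) z : C := ofR (i%:R / N%:R) * retract_square L z.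
pose u i z : C := F (x i.+1 z) / F (x i z).
have F0 z : F z != 0 by rewrite -nm_eq0 F1 oner_eq0.
have u1 i z : nm (u i z) = 1 by rewrite nm_div !F1 divr1.
have uR i z : (i < N)%N -> 0 < Re (u i z).
  move=> iN; apply: nm_sub1_Re.
  have -> : u i z - 1 = (F (x i.+1 z) - F (x i z)) / F (x i z).
    by rewrite mulrBl divff.
  rewrite nm_div F1 divr1; apply: dF.
    apply: square_scale; last by apply: retract_squareP; rewrite ltW.
    rewrite ger0_norm ?divr_ge0// ler_pdivrMr// mul1r ler_nat.
    by rewrite ltnW.
  rewrite /x -mulrBl -ofRN -ofRD nmM nm_ofR -mulrBl -natrB// subSnn mul1r.
  rewrite ger0_norm ?invr_ge0// mulrC ltr_pdivrMr//.
  have [h1 h2] := retract_squareP z (ltW L0).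
  apply: le_lt_trans (nm_le_ReIm _) _; apply: le_lt_trans (lerD h1 h2) _.
  by move: Nd; rewrite ltr_pdivrMr//; lra.
have [t0 _ ht0] := expi_surj (F1 0).
have cx i : continuous (fun z => F (x i z)).
  move=> z; apply: (@continuous_comp _ _ _ (x i) F); last exact: cF.
  apply: (@continuous_MC _ _ (fun=> ofR (i%:R / N%:R)) (retract_square L)).
    exact: continuous_cstT.
  exact: continuous_retract_square.
exists (fun z => t0 + \sum_(i < N) angle (if (i < N)%N then u i z else 1)).
  move=> z; apply: (@continuousD _ R^o); first exact: continuous_cstT.
  apply: (@continuous_sumR _ (fun i z => angle (if (i < N)%N then u i z else 1))).
  move=> i; case: ltnP => iN; last exact: continuous_cstT.
  apply: continuous_angle; first exact: uR.
  by apply: continuous_MC; [exact: cx|apply: continuous_VC => //; exact: cx].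
move=> z Lz; rewrite expiD expi_sum.
have -> : \prod_(i < N) expi (angle (if (i < N)%N then u i z else 1)) =
   \prod_(i < N) u i z.
  by apply: eq_bigr => i _; rewrite ltn_ord expi_angle ?uR.
rewrite -(big_mkord xpredT (u ^~ z)) /u telescope_prodf//.
  rewrite /x mul0r ofR0 mul0r divff ?gt_eqF// ofR1 mul1r retract_square_id// -ht0.
  by rewrite mulrCA divff ?mulr1.
Qed.
End lift_square.

(** * Parametrised Jordan curves *)

Section curve.
Context {R : realType}.
Notation C := (Cplx R).
Implicit Types (x y z w : C) (a b : R).

Definition direction p z : C := (z - p) / ofR (nm (z - p)).

(** F would have a continuous angle b on a square containing the disc; along the circle
    b differs from j times the polar angle by a constant, but b returns to its
    initial value after one turn. *)
Lemma winding_no_extension (F : C -> C) (p : C) L (j : int) : 0 < L -> continuous F ->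
  (forall z, nm (F z) = 1) ->
  (forall z, nm (z - p) = L -> F z = direction p z ^ j) -> j = 0.
Proof.
move=> L0 cF F1 Fp.
pose H z := F (z + p).
have cH : continuous H.
  move=> z; apply: (@continuous_comp _ _ _ (fun z : C => z + p) F); last exact: cF.
  by apply: continuous_DC; [exact: continuous_idT|exact: continuous_cstT].
have [b cb Hb] := lift_square L0 cH (fun z => F1 _).
have cir t : nm (ofR L * expi t) = L by rewrite nmM nm_expi mulr1 nm_ofR gtr0_norm.
have L00 : ofR L != 0 by rewrite -nm_eq0 nm_ofR gtr0_norm// gt_eqF.
have sq t : square L (ofR L * expi t).
  by split; rewrite -[X in _ <= X](cir t); [exact: Re_le_nm|exact: Im_le_nm].
have ht t : expi (b (ofR L * expi t) - t *~ j) = 1.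
  rewrite expiD -mulrNz expiMz -(Hb _ (sq t)) /H Fp /direction addrK cir//.
  by rewrite mulrAC divff// mul1r -expfzDr ?expi_neq0// subrr expr0z.
have ct : continuous (fun t => b (ofR L * expi t) - t *~ j).
  move=> t; apply: (@continuousB R R^o).
    apply: (@continuous_comp _ _ _ (fun t => ofR L * expi t) b); last exact: cb.
    apply: (@continuous_MC _ _ (fun=> ofR L)); first exact: continuous_cstT.
    exact: continuous_expi.
  under [fun t => t *~ j]eq_fun do rewrite -mulrzr.
  apply: (@continuousM R); first exact: continuous_idT.
  exact: continuous_cstT.
have := expi_const ct ht 0 (pi *+ 2).
rewrite expi0 expi2pi mul0rz subr0 => /eqP.
rewrite eq_sym subr_eq addrC -subr_eq subrr eq_sym mulrz_eq0 => /orP[/eqP//|].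
by rewrite mulrn_eq0 /= gt_eqF// pi_gt0.
Qed.

(** The map is defined on the whole line, which spares continuity within an interval;
    the last clause is injectivity modulo 1. *)
Definition jparam (G : set C) (gam : R -> C) := [/\ continuous gam,
  G = gam @` `[0, 1], (forall t, G (gam t)), gam 0 = gam 1 &
  forall s t, gam s = gam t -> expi (pi *+ 2 * s) = expi (pi *+ 2 * t)].

Lemma jordan_jparam G : jordan_curve G -> exists gam, jparam G gam.
Proof.
case=> g [cg ig ->]; exists (fun t => g (expi (pi *+ 2 * t))).
have cir t : `|expi t : C| = 1 by rewrite normCE nm_expi.
have p0 : 0 < pi *+ 2 :> R by rewrite mulrn_wgt0// pi_gt0.
split.
- move=> t.
  have h : {for t, continuous (fun t : R => expi (pi *+ 2 * t))}.
    apply: (@continuous_comp _ _ _ (fun t : R => pi *+ 2 * t) (@expi R)).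
      by apply: (@continuousM R); [exact: continuous_cstT|exact: continuous_idT].
    exact: continuous_expi.
  move=> U gU; have /subspace_continuousP/(_ _ (cir (pi *+ 2 * t))) := cg.
  move=> /(_ U gU) /= gU'; have hU := h _ gU'.
  apply: (@filterS _ (nbhs t) _ _ _ _ hU) => y /=.
  by apply; exact: cir.
- apply/seteqP; split=> [_ [z z1 <-]|_ [t t01 <-]]; last first.
    by exists (expi (pi *+ 2 * t)) => //=.
  have z1' : nm z = 1 by move: z1; rewrite /= normCE => -[].
  have [t /andP[t0 t1] ->] := expi_surj z1'; exists (t / (pi *+ 2)).
    rewrite /= in_itv /=; apply/andP; split; first by rewrite divr_ge0// ltW.
    by rewrite ler_pdivrMr// mul1r.
  by rewrite mulrC divfK// gt_eqF.
- by move=> t; exists (expi (pi *+ 2 * t)) => //=.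
- by rewrite mulr0 mulr1 expi0 expi2pi.
- by move=> s t /ig; apply; rewrite inE /=.
Qed.

Lemma expi_2pi_inj (s t : R) : 0 <= s <= 1 -> 0 <= t <= 1 ->
  expi (pi *+ 2 * s) = expi (pi *+ 2 * t) -> [\/ s = t, s = 0 /\ t = 1 | s = 1 /\ t = 0].
Proof.
move=> /andP[s0 s1] /andP[t0 t1] e.
have p0 : 0 < pi *+ 2 :> R by rewrite mulrn_wgt0// pi_gt0.
have : expi (pi *+ 2 * s - pi *+ 2 * t) = 1.
  by rewrite expiD expiN e divff// expi_neq0.
move=> /expi_eq1[m]; rewrite -mulrBr -mulrzr => /(mulfI (lt0r_neq0 p0)) hm.
have m1 : (m <= 1) by rewrite -(ler_int R) -hm; lra.
have m2 : (-1 <= m) by rewrite -(ler_int R) -hm; lra.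
(* s and t lie in [0, 1], so that only the end points can be identified *)
have : m = -1 \/ m = 0 \/ m = 1 by lia.
case=> [mE|[mE|mE]]; move: hm; rewrite mE /= => hm.
- by constructor 2; split; lra.
- by constructor 1; lra.
- by constructor 3; split; lra.
Qed.

End curve.

(** * Functions of the parameter extend to the plane *)

Section jordan.
Context {R : realType}.
Notation C := (Cplx R).
Implicit Types (x y z w : C) (a b : R).
Variables (G : set C) (gam : R -> C).
Hypothesis Ggam : jparam G gam.

Lemma compact_curve : compact G.
Proof.
case: Ggam => cg -> _ _ _; apply: continuous_compact; last exact: segment_compact.
exact: continuous_subspaceT.
Qed.

Lemma closed_curve : closed G.
Proof. by apply: compact_closed compact_curve; exact: norm_hausdorff. Qed.

Lemma curve_far z : ~ G z -> exists2 e : R, 0 < e & forall w, G w -> e <= nm (w - z).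
Proof.
move=> Gz; have /openCP/(_ z Gz)[e e0 h] := closed_openC closed_curve.
by exists e => // w Gw; rewrite leNgt; apply/negP => /h.
Qed.

Lemma curve_bounded : exists2 M : R, 0 < M & forall z, G z -> nm z <= M.
Proof.
have cn : {within G, continuous (@nm R)}.
  by apply: continuous_subspaceT; exact: continuous_nm.
have /compact_bounded[M [_ hM]] := continuous_compact cn compact_curve.
exists (`|M| + 1); first by rewrite ltr_wpDl.
have MM : M < `|M| + 1 by rewrite (le_lt_trans (ler_norm _))// ltrDl.
move=> z Gz; rewrite -[nm z]ger0_norm ?nm_ge0//; apply: (hM _ MM).
by exists z.
Qed.

(** The values descend to a function on G that is continuous because G is a quotient
    of the compact parameter interval; the Tietze theorem then extends it. *)
Lemma extend_parameter (c : R -> R) : continuous c -> c 0 = c 1 ->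
  exists2 B : C -> R, continuous B & forall t, 0 <= t <= 1 -> B (gam t) = c t.
Proof.
move=> cc c01; have [cg GE Gg g01 ginj] := Ggam.
have csame s t : 0 <= s <= 1 -> 0 <= t <= 1 -> gam s = gam t -> c s = c t.
  move=> s01 t01 /ginj/(expi_2pi_inj s01 t01)[->//|[-> ->]//|[-> ->]//].
(* tau picks a parameter of each point of the curve *)
have /choice[tau htau] : forall z, exists t, G z -> 0 <= t <= 1 /\ gam t = z.
  move=> z; have [Gz|nGz] := pselect (G z); last by exists 0.
  by move: (Gz); rewrite GE => -[t /=]; rewrite in_itv /= => ? ?; exists t.
pose b z := c (tau z).
have bgam t : 0 <= t <= 1 -> b (gam t) = c t.
  move=> t01; have Gt : G (gam t) by rewrite GE; exists t => //=; rewrite in_itv.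
  by have [? ?] := htau _ Gt; apply: csame.
have cb z0 e : G z0 -> 0 < e -> exists2 d : R, 0 < d &
    forall w, G w -> nm (w - z0) < d -> `|b w - b z0| < e.
  move=> Gz0 e0.
  have /compact_near_coveringP cK := @segment_compact R 0 1.
  (* compactness of the interval: close to a parameter t, either gam t = z0 and continuity
   of c applies, or gam stays away from z0 *)
  have /(_ _) := cK R (0^'+) (fun d t => 0 <= t <= 1 -> nm (gam t - z0) < d -> `|c t - b z0| < e) _.
  case=> [t|].
    rewrite /= in_itv /= => t01.
    have [tz|tz] := pselect (gam t = z0).
      have bt : b z0 = c t by rewrite -tz bgam.
      near=> t' d => _ _ /=; rewrite bt distrC.
      near: t'; have /cvgrPdist_lt := cc t.
      by apply.
    have n0 : 0 < nm (gam t - z0) / 2 by rewrite divr_gt0// nm_gt0 subr_eq0; apply/eqP.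
    near=> t' d.
    have d1 : d <= nm (gam t - z0) / 2 by near: d; exact: nbhs_right_le.
    have t1 : nm (gam t' - gam t) < nm (gam t - z0) / 2.
      near: t'; have /continuousTC := cg t; exact.
    move=> /= _ h; exfalso; have := ler_nm_dist (gam t) (gam t') z0.
    by rewrite leNgt => /negP; apply; rewrite (splitr (nm (gam t - z0))) ltrD// ?(lt_le_trans h)// nm_sub.
  move=> d /= d0 dK; exists (d / 2); first by rewrite divr_gt0.
  move=> w Gw wz; have [t01 tw] := htau _ Gw.
  apply: (dK (d / 2)); rewrite ?tw//= ?in_itv//= ?divr_gt0//.
  by rewrite sub0r normrN gtr0_norm ?divr_gt0// ltr_pdivrMr// ltr_pMr// ltr1n.
have [M M0 cM] : exists2 M : R, 0 < M & forall t, 0 <= t <= 1 -> `|c t| <= M.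
  have cn : {within `[0, 1], continuous c} by apply: continuous_subspaceT.
  have /compact_bounded[M [_ hM]] := continuous_compact cn (@segment_compact R 0 1).
  exists (`|M| + 1); first by rewrite ltr_wpDl.
  move=> t t01; apply: (hM (`|M| + 1) _ (c t)).
    by rewrite (le_lt_trans (ler_norm _))// ltrDl.
  by exists t => //=; rewrite in_itv.
pose toC (p : R * R) : C := Complex p.1 p.2.
have ctoC : continuous toC.
  by move=> p; apply: continuous_mkC; [exact: cvg_fst|exact: cvg_snd].
(* the extension theorem is applied on R * R, which has a real pseudometric *)
pose A : set (R * R) := toC @^-1` G.
have clA : closed A.
  by apply: closed_comp closed_curve => p _; exact: ctoC.
have cA : {within A, continuous (b \o toC : R * R -> R^o)}.
  apply/subspace_continuousP => p Ap.
  apply/(@cvgrPdist_lt _ R^o _ (within A (nbhs p))) => e e0.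
  have [d d0 hd] := cb _ _ Ap e0.
  have /continuousTC/(_ d d0) hq : {for p, continuous toC} by exact: ctoC.
  apply: (@filterS _ (nbhs p) _ _ _ _ hq) => q qd Aq; rewrite distrC.
  exact: hd.
have bA p : A p -> `|(b \o toC) p| <= M.
  by move=> Ap; have [t01 _] := htau _ Ap; exact: cM.
have [f [fE cf _]] := continuous_bounded_extension (@pseudometric_normal R (R * R)%type) clA M0 cA bA.
exists (fun z => f (Re z, Im z)).
  move=> z; apply: (@continuous_comp _ _ _ (fun z : C => (Re z, Im z)) f); last exact: cf.
  by apply: continuous_pairT; [exact: continuous_Re|exact: continuous_Im].
move=> t t01; have Gt : G (gam t) by rewrite GE; exists t => //=; rewrite in_itv.
have tE : toC (Re (gam t), Im (gam t)) = gam t by apply: CE.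
rewrite -fE ?inE /A /= ?tE//; exact: bgam.
Unshelve. all: by end_near. Qed.

End jordan.

(** * A Jordan curve has empty interior *)

Section interior.
Context {R : realType}.
Notation C := (Cplx R).
Implicit Types (x y z w : C) (a b : R).

(** If B increases from z towards two different points of a circle, the lower of the two
    values is also attained on the radius towards the other point, against injectivity. *)
Lemma no_two_ascents (B : C -> R) z d u v (rho : R) : continuous B ->
  (forall w w', nm (w - z) < d -> nm (w' - z) < d -> B w = B w' -> w = w') ->
  nm u = 1 -> nm v = 1 -> u <> v -> 0 < rho < d ->
  B z < B (z + ofR rho * u) -> B z < B (z + ofR rho * v) -> False.
Proof.
move=> cB injB.
suff key (u' v' : C) : nm u' = 1 -> nm v' = 1 -> u' <> v' -> 0 < rho < d ->
    B z < B (z + ofR rho * u') <= B (z + ofR rho * v') -> False.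
  move=> u1 v1 uv rd Bu Bv.
  have [h|/ltW h] := leP (B (z + ofR rho * u)) (B (z + ofR rho * v)).
    by apply: (key u v) => //; rewrite Bu.
  by apply: (key v u) => //; [move=> /esym|rewrite Bv].
move=> u1 v1 uv /andP[r0 rd] /andP[Bu Buv].
pose f (s : R) := B (z + ofR (s * rho) * v').
have cf : continuous f.
  move=> s; apply: (@continuous_comp R C R (fun s : R => z + ofR (s * rho) * v') B s); last exact: cB.
  apply: continuous_DC; first exact: continuous_cstT.
  apply: continuous_MC; last exact: continuous_cstT.
  apply: (@continuous_comp R R C (fun s : R => s * rho) (@ofR R) s); last exact: continuous_ofR.
  by apply: (@continuousM R); [exact: continuous_idT|exact: continuous_cstT].
have [s] : exists2 s, s \in `[0, 1] & f s = B (z + ofR rho * u').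
  apply: IVT => //; first exact: continuous_subspaceT.
  rewrite /f mul0r mul1r ofR0 mul0r addr0 ge_min le_max Buv orbT andbT.
  by rewrite ltW.
rewrite in_itv /= => /andP[s0 s1] /injB.
rewrite ![z + _]addrC !addrK !nmM !nm_ofR u1 v1 !mulr1 normrM !ger0_norm// ?(ltW r0)//.
move=> /(_ _ _)/addIr h.
have {}h : ofR (s * rho) * v' = ofR rho * u'.
  by apply: h => //; rewrite (le_lt_trans _ rd)// ler_piMl// ltW.
have := congr1 (@nm R) h.
rewrite !nmM !nm_ofR u1 v1 !mulr1 normrM !ger0_norm// ?(ltW r0)// => sr.
apply: uv; apply: (mulfI (_ : ofR rho != 0)).
  by rewrite -nm_eq0 nm_ofR normr_eq0 gt_eqF.
by rewrite -h sr.
Qed.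

Variables (G : set C) (gam : R -> C).
Hypothesis Ggam : jparam G gam.

(** Near z, suppose G contains a disc.  The sine of the parameter angle, measured from
    z, is a continuous injective real function on a smaller disc (injective since the
    cosine stays positive there); but at the ends of three radii it exceeds its value
    at z twice, or falls below it twice. *)
Lemma curve_empty_interior z r : 0 < r -> exists2 w, ~ G w & nm (w - z) < r.
Proof.
move=> r0; apply: contrapT => /forall2NP hG.
have {}hG w : nm (w - z) < r -> G w.
  by move=> wz; have [/contrapT|] := hG w.
have [cg GE Gg g01 ginj] := Ggam.
have zG : G z by apply: hG; rewrite subrr nm0.
move: (zG); rewrite GE => -[t0 /=]; rewrite in_itv /= => t001 gt0.
pose th (t : R) := pi *+ 2 * t - pi *+ 2 * t0.
have cth : continuous th.
  move=> t; apply: (@continuousB R R^o); last exact: continuous_cstT.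
  by apply: (@continuousM R); [exact: continuous_cstT|exact: continuous_idT].
have th01 : expi (th 0) = expi (th 1).
  by rewrite /th mulr0 mulr1 ![expi (_ - _)]expiD expi0 expi2pi.
have [B1 cB1 hB1] : exists2 B : C -> R, continuous B &
    forall t, 0 <= t <= 1 -> B (gam t) = cos (th t).
  apply: (extend_parameter Ggam); last by case: th01.
  move=> t; apply: (@continuous_comp _ _ _ th (@cos R)); [exact: cth|exact: continuous_cos].
have [B2 cB2 hB2] : exists2 B : C -> R, continuous B &
    forall t, 0 <= t <= 1 -> B (gam t) = sin (th t).
  apply: (extend_parameter Ggam); last by case: th01.
  move=> t; apply: (@continuous_comp _ _ _ th (@sin R)); [exact: cth|exact: continuous_sin].
have B1z : B1 z = 1 by rewrite -gt0 hB1// /th subrr cos0.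
have /continuousCR/(_ 1 ltr01)[d' d'0 hd'] := cB1 z.
(* on this disc the cosine B1 is positive and all points are on the curve *)
pose d := Num.min d' r.
have d0 : 0 < d by rewrite lt_min d'0.
have inj w w' : nm (w - z) < d -> nm (w' - z) < d -> B2 w = B2 w' -> w = w'.
  rewrite !lt_min => /andP[wd wr] /andP[wd' wr'].
  have pos x : nm (x - z) < d' -> 0 < B1 x.
    by move=> /hd'; rewrite B1z ltr_norml => /andP[+ _]; rewrite ltrBrDr addrC subrr.
  have p1 := pos _ wd; have p2 := pos _ wd'.
  have := hG _ wr; have := hG _ wr'.
  rewrite {1 2}GE => -[t + tw] [s + sw]; rewrite /= !in_itv /= => t01 s01.
  move: p1 p2; rewrite -tw -sw !hB1// !hB2// => p1 p2 sE.
  have cE : cos (th s) = cos (th t).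
    apply/eqP; rewrite -(@eqrXn2 _ 2)// ?ltW//.
    by rewrite !cos2sin2 sE.
  have : expi (th s) = expi (th t) by rewrite /expi cE sE.
  rewrite /th ![expi (_ - _)]expiD => /mulIf-/(_ (expi_neq0 _)) /(expi_2pi_inj s01 t01).
  by case=> [->|[-> ->]|[-> ->]].
pose rho := d / 2.
have rd : 0 < rho < d by rewrite /rho; apply/andP; split; lra.
have [rho0 rhod] := andP rd.
have ne u : nm u = 1 -> B2 (z + ofR rho * u) != B2 z.
  move=> u1; apply/eqP => /inj.
  rewrite addrAC subrr add0r nmM nm_ofR u1 mulr1 gtr0_norm// nm0 => /(_ rhod d0).
  move=> /eqP; rewrite -subr_eq0 addrAC subrr add0r mulf_eq0.
  by rewrite -!nm_eq0 u1 nm_ofR normr_eq0 (gt_eqF rho0) oner_eq0.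
have inj' w w' : nm (w - z) < d -> nm (w' - z) < d -> - B2 w = - B2 w' -> w = w'.
  by move=> h1 h2 /oppr_inj; exact: inj.
have cB2' : continuous (fun z => - B2 z).
  by move=> x; apply: (@continuousN _ R^o); exact: cB2.
pose ii : C := Complex 0 1.
have i1 : nm ii = 1 by rewrite nm_Complex expr0n add0r expr1n sqrtr1.
have n1 : nm (-1 : C) = 1 by rewrite nmN nm1.
have d1 : (1 : C) <> -1 by move/(congr1 (@complex.Re R)); rewrite ReN Re1; lra.
have d2 : (1 : C) <> ii by move/(congr1 (@complex.Re R)); rewrite Re1 /=; lra.
have d3 : (-1 : C) <> ii by move/(congr1 (@complex.Re R)); rewrite ReN Re1 /=; lra.
have P := no_two_ascents cB2 inj.
have N := no_two_ascents cB2' inj'.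
have := ne _ (@nm1 R); have := ne _ n1; have := ne _ i1.
rewrite !neq_lt => /orP[a1|a1] /orP[a2|a2] /orP[a3|a3].
all: first [by apply: (P 1 (-1) rho) => //; exact: nm1
  | by apply: (P 1 ii rho) => //; exact: nm1
  | by apply: (P (-1) ii rho) => //; exact: nm1
  | by apply: (N 1 (-1) rho); rewrite ?ltrN2 //; exact: nm1
  | by apply: (N 1 ii rho); rewrite ?ltrN2 //; exact: nm1
  | by apply: (N (-1) ii rho); rewrite ?ltrN2 //; exact: nm1].
Qed.

End interior.

(** * At most one complementary component is bounded *)

Section components.
Context {R : realType}.
Notation C := (Cplx R).
Implicit Types (x y z w : C) (a b : R).

Lemma bounded_setCP (A : set C) : bounded_set A <->
  exists M : R, forall z, A z -> nm z <= M.
Proof.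
split=> [[M [Mr hM]]|[M hM]].
  exists (Re M + 1) => z Az.
  have : M < ofR (Re M + 1).
    by rewrite ltcE /= ltrDl ltr01 andbT; move: Mr; case: {hM} M => u v /=; rewrite complex_real eq_sym.
  move=> /hM/(_ z Az); rewrite /= normCE lecE /=.
  by case/andP.
exists (ofR M); split.
  by rewrite complex_real.
move=> x Mx z Az; rewrite /= normCE (le_trans _ (ltW Mx))// lecE /= eqxx.
exact: hM.
Qed.

Variables (G : set C).
Hypothesis clG : closed G.
Local Notation comp := (connected_component (~` G)).

Lemma component_ball p w w' e : comp p w ->
  (forall x, nm (x - w) < e -> ~ G x) -> nm (w' - w) < e -> comp p w'.
Proof.
move=> pw hG ww'; apply: connected_component_trans pw _.
pose f (s : R) := w + ofR s * (w' - w).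
have cf : continuous f.
  move=> s; apply: (@continuous_DC R R (fun=> w) (fun s => ofR s * (w' - w)) s).
    exact: continuous_cstT.
  apply: (@continuous_MC R R (@ofR R) (fun=> w' - w) s); last exact: continuous_cstT.
  exact: continuous_ofR.
apply: (@connected_component_max _ _ (f @` `[0, 1])).
- exists 0; first by rewrite /= in_itv /= lexx ler01.
  by rewrite /f ofR0 mul0r addr0.
- move=> _ [s + <-]; rewrite /= in_itv /= => /andP[s0 s1].
  apply: hG; rewrite /f addrAC subrr add0r nmM nm_ofR ger0_norm//.
  by rewrite (le_lt_trans _ ww')// ler_piMl// nm_ge0.
- apply: connected_continuous_connected; last exact: continuous_subspaceT.
  exact: segment_connected.
- exists 1; first by rewrite /= in_itv /= lexx ler01.
  by rewrite /f ofR1 mul1r addrCA subrr addr0.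
Qed.

(** Membership in S only has to be locally constant off G. *)
Lemma component_clopen p (S : set C) : S p ->
  (forall x, ~ G x -> exists2 e : R, 0 < e &
     forall y, nm (y - x) < e -> (S x <-> S y)) -> comp p `<=` S.
Proof.
move=> Sp hS; have [Gp|Gp] := pselect ((~` G) p); last first.
  by rewrite connected_component_out.
have oG : open (~` G) by exact: closed_openC.
have := @component_connected C (~` G) p.
move=> /(_ (comp p `&` S)) H.
suff : comp p `&` S = comp p by move=> <- x [].
apply: H.
- by exists p; split => //; exact: connected_component_refl.
- exists (~` G `&` S).
    apply/openCP => z [Gz Sz]; have [e e0 he] := hS _ Gz.
    have /openCP/(_ _ Gz)[d d0 hd] := oG.
    exists (Num.min e d); first by rewrite lt_min e0.
    move=> w; rewrite lt_min => /andP[we wd]; split; first exact: hd.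
    by apply/(he w we).
  by apply/seteqP; split=> x [cx]; [move=> Sx|case=> Gx Sx]; split => //; split => //; exact: connected_component_sub cx.
- exists (~` (~` G `&` ~` S)).
    apply/open_closedC/openCP => z [Gz Sz]; have [e e0 he] := hS _ Gz.
    have /openCP/(_ _ Gz)[d d0 hd] := oG.
    exists (Num.min e d); first by rewrite lt_min e0.
    move=> w; rewrite lt_min => /andP[we wd]; split; first exact: hd.
    by move/(he w we).
  apply/seteqP; split=> x [cx].
    by move=> Sx; split => // -[].
  by move=> h; split => //; apply: contrapT => Sx; apply: h; split => //; exact: connected_component_sub cx.
Qed.

End components.

Section jct.
Context {R : realType}.
Notation C := (Cplx R).
Implicit Types (x y z w : C) (a b : R).
Variables (G : set C) (gam : R -> C).
Hypothesis Ggam : jparam G gam.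
Local Notation comp := (connected_component (~` G)).

Lemma nm_direction p z : z <> p -> nm (direction p z) = 1.
Proof.
move=> /eqP; rewrite -subr_eq0 => zp; rewrite nm_div nm_ofR ger0_norm ?nm_ge0//.
by rewrite divff// nm_eq0.
Qed.

Lemma direction_neq0 p z : z <> p -> direction p z != 0.
Proof. by move=> zp; rewrite -nm_eq0 nm_direction ?oner_eq0. Qed.

Lemma nm_exprz z (j : int) : nm z = 1 -> nm (z ^ j) = 1.
Proof.
by move=> z1; case: j => n; rewrite ?NegzE -?exprnP -?exprnN ?nmV nmX z1 expr1n ?invr1.
Qed.

Lemma continuous_direction p z : z <> p -> {for z, continuous (direction p)}.
Proof.
move=> zp.
have cs : {for z, continuous (fun z : C => z - p)}.
  by apply: continuous_DC; [exact: continuous_idT|exact: continuous_cstT].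
have cn : {for z, continuous (fun z : C => ofR (nm (z - p)))}.
  apply: (@continuous_comp C R C (fun z => nm (z - p)) (@ofR R) z); last exact: continuous_ofR.
  by apply: (@continuous_comp C C R (fun z => z - p) (@nm R) z cs); exact: continuous_nm.
have n0 : ofR (nm (z - p)) != 0.
  by rewrite -nm_eq0 nm_ofR normr_eq0 nm_eq0 subr_eq0; apply/eqP.
pose d (z : C) : C := ofR (nm (z - p)).
exact: (@continuous_MC R C (fun z => z - p) (fun z => (d z)^-1) z cs
  (@continuous_VC R C d z n0 cn)).
Qed.

(** The function z |-> direction p (gam (Re z)) is unimodular on the plane, so the lifting
    lemma for squares provides the angle. *)
Lemma winding p : ~ G p -> exists (a : R -> R) (m : int),
  [/\ continuous a, forall t, 0 <= t <= 1 -> direction p (gam t) = expi (a t) &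
      a 1 = a 0 + (pi *+ 2) *~ m].
Proof.
move=> Gp; have [cg GE Gg g01 _] := Ggam.
have gp t : gam t <> p by move=> tp; apply: Gp; rewrite -tp.
pose F z := direction p (gam (Re z)).
have cF : continuous F.
  move=> z; apply: (@continuous_comp C C C (fun z => gam (Re z)) (direction p)); last exact: continuous_direction.
  by apply: (@continuous_comp C R C (@Re R : C -> R) gam); [exact: continuous_Re|exact: cg].
have [b cb hb] := lift_square ltr01 cF (fun z => nm_direction (@gp _)).
have cofR : continuous (@ofR R) by exact: continuous_ofR.
have hE t : 0 <= t <= 1 -> direction p (gam t) = expi (b (ofR t)).
  move=> /andP[t0 t1]; rewrite -hb// /square /= ger0_norm// normr0.
  by split.
have : expi (b (ofR 1) - b (ofR 0)) = 1.
  by rewrite expiD expiN -!hE ?lexx ?ler01// g01 divff// direction_neq0.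
move=> /expi_eq1[m hm]; exists (b \o @ofR R), m; split => //.
- by move=> t; apply: continuous_comp; [exact: cofR|exact: cb].
- by rewrite /= -hm addrC subrK.
Qed.

(** When the windings cancel, j a1 + k a2 takes the same value at both ends, so it is
    the restriction of some B to the curve.  Then exp(iB) (direction q)^(-k) on the
    component of p, glued along G to (direction p)^j outside, is continuous: q is not
    in that component, and p is not outside it.  On a large circle it is
    (direction p)^j, which forces j = 0. *)
Lemma winding_relation p q (a1 a2 : R -> R) (m1 m2 j k : int) :
  ~ G p -> ~ G q -> ~ comp p q -> bounded_set (comp p) ->
  continuous a1 -> continuous a2 ->
  (forall t, 0 <= t <= 1 -> direction p (gam t) = expi (a1 t)) ->
  (forall t, 0 <= t <= 1 -> direction q (gam t) = expi (a2 t)) ->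
  a1 1 = a1 0 + (pi *+ 2) *~ m1 -> a2 1 = a2 0 + (pi *+ 2) *~ m2 ->
  m1 * j + m2 * k = 0 -> j = 0.
Proof.
move=> Gp Gq npq /bounded_setCP[M hM] ca1 ca2 h1 h2 e1 e2 jk.
have [cg GE Gg g01 _] := Ggam.
have clG := closed_curve Ggam.
have [B cB hB] : exists2 B : C -> R, continuous B &
    forall t, 0 <= t <= 1 -> B (gam t) = a1 t *~ j + a2 t *~ k.
  apply: (extend_parameter Ggam).
    move=> t; apply: (@continuousD R R^o).
      under [fun t => a1 t *~ j]eq_fun do rewrite -mulrzr.
      by apply: (@continuousM R); [exact: ca1|exact: continuous_cstT].
    under [fun t => a2 t *~ k]eq_fun do rewrite -mulrzr.
    by apply: (@continuousM R); [exact: ca2|exact: continuous_cstT].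
  rewrite e1 e2; move: (pi *+ 2 : R) => P.
  have jk2 : P *~ m1 *~ j + P *~ m2 *~ k = 0.
    by rewrite -!mulrzA -mulrzDr jk.
  by rewrite !mulrzDl addrACA jk2 addr0.
pose F1 z := expi (B z) * direction q z ^ (- k).
pose F2 z := direction p z ^ j.
pose F z := if `[<comp p z>] then F1 z else F2 z.
have F12 z : G z -> F1 z = F2 z.
  rewrite {1}GE => -[t]; rewrite /= in_itv /= => t01 <-.
  rewrite /F1 /F2 hB// h2// h1// expiD !expiMz -mulrA -expfzDr ?expi_neq0//.
  by rewrite subrr expr0z mulr1.
have cF1 z : z <> q -> {for z, continuous F1}.
  move=> zq; apply: (@continuous_MC R C (fun z => expi (B z)) (fun z => direction q z ^ (- k))).
    apply: (@continuous_comp C R C B (@expi R)); [exact: cB|exact: continuous_expi].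
  by apply: continuous_exprzC; [exact: direction_neq0|exact: continuous_direction].
have cF2 z : z <> p -> {for z, continuous F2}.
  by move=> zp; apply: continuous_exprzC; [exact: direction_neq0|exact: continuous_direction].
have pp : comp p p by exact: connected_component_refl.
have cF : continuous F.
  move=> z; apply/continuousCC => e e0.
  have [Gz|Gz] := pselect (G z).
    have zp : z <> p by move=> zp; apply: Gp; rewrite -zp.
    have zq : z <> q by move=> zq; apply: Gq; rewrite -zq.
    have /continuousCC/(_ e e0)[d1 d10 hd1] := cF1 _ zq.
    have /continuousCC/(_ e e0)[d2 d20 hd2] := cF2 _ zp.
    have Fz : F z = F1 z /\ F z = F2 z by rewrite /F; case: ifP; rewrite F12.
    exists (Num.min d1 d2); first by rewrite lt_min d10.
    move=> w; rewrite lt_min => /andP[w1 w2].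
    rewrite {1}/F; case: ifP => _; first by rewrite Fz.1; exact: hd1.
    by rewrite Fz.2; exact: hd2.
  have [d0 d00 hd0] : exists2 d : R, 0 < d & forall w, nm (w - z) < d -> ~ G w.
    by have [d d0 hd] := curve_far Ggam Gz; exists d => // w wz /hd; rewrite leNgt wz.
  have [pz|pz] := pselect (comp p z).
    have zq : z <> q by move=> zq; apply: npq; rewrite -zq.
    have /continuousCC/(_ e e0)[d1 d10 hd1] := cF1 _ zq.
    exists (Num.min d1 d0); first by rewrite lt_min d10.
    move=> w; rewrite lt_min => /andP[w1 w2].
    rewrite /F !asboolT//; first exact: hd1.
    exact: component_ball pz hd0 w2.
  have zp : z <> p by move=> zp; apply: pz; rewrite zp.
  have /continuousCC/(_ e e0)[d1 d10 hd1] := cF2 _ zp.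
  exists (Num.min d1 (d0 / 2)); first by rewrite lt_min d10 divr_gt0.
  move=> w; rewrite lt_min => /andP[w1 w2].
  rewrite /F !asboolF//; first exact: hd1.
  move=> pw; apply: pz; apply: (@component_ball _ _ p w z (d0 / 2)) => //.
    move=> x xw; apply: hd0; apply: le_lt_trans (ler_nm_dist _ w _) _.
    by rewrite (splitr d0) ltrD.
  by rewrite nm_sub.
have F1' z : nm (F z) = 1.
  rewrite /F; case: ifPn => [/asboolP pz|/asboolPn pz].
    rewrite /F1 nmM nm_expi mul1r nm_exprz// nm_direction// => zq.
    by apply: npq; rewrite -zq.
  by rewrite /F2 nm_exprz// nm_direction// => zp; apply: pz; rewrite zp.
pose L := `|M| + nm p + 1.
have L0 : 0 < L by rewrite ltr_wpDl ?addr_ge0 ?nm_ge0.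
apply: (winding_no_extension L0 cF F1') => z zL.
(* the circle of radius L around p encloses the bounded component of p *)
have npz : ~ comp p z.
  move=> /hM; apply/negP; rewrite -ltNge.
  have : nm (z - p) <= nm z + nm p by exact: ler_nmB.
  rewrite zL /L; have := ler_norm M; lra.
rewrite /F (asboolF npz) /F2; reflexivity.
Qed.

(** Applied to (m2, -m1) in both orders, the relation between windings forces both winding
    numbers to vanish; then the relation holds for the exponents (1, 0) as well. *)
Theorem bounded_component_unique p q : ~ G p -> ~ G q ->
  bounded_set (comp p) -> bounded_set (comp q) -> comp p q.
Proof.
move=> Gp Gq bp bq; apply: contrapT => npq.
have nqp : ~ comp q p by move/connected_component_sym.
have [a1 [m1 [ca1 h1 e1]]] := winding Gp.
have [a2 [m2 [ca2 h2 e2]]] := winding Gq.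
have H := winding_relation Gp Gq npq bp ca1 ca2 h1 h2 e1 e2.
have K := winding_relation Gq Gp nqp bq ca2 ca1 h2 h1 e2 e1.
(* m1 m2 - m2 m1 = 0 *)
have m20 : m2 = 0 by apply: (H m2 (- m1)); ring.
have m10 : m1 = 0 by apply: (K m1 (- m2)); ring.
by have := H 1 0; rewrite m10 m20 !mul0r addr0 => /(_ erefl).
Qed.

End jct.

(** * Uniform limits of Laurent polynomials *)

Lemma mulf_sub_split (F : comPzRingType) (f g p q : F) :
  f * g - p * q = (f - p) * g + (f - (f - p)) * (g - q).
Proof. by ring. Qed.

Lemma geom_step (F : fieldType) (t v : F) : 1 - t != 0 ->
  (1 - t)^-1 - (1 + t * v) = t * ((1 - t)^-1 - v).
Proof.
move=> t0; apply: (mulfI t0).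
by rewrite mulrBr divff// [RHS]mulrCA mulrBr divff//; ring.
Qed.

Lemma sqrt_fix (F : fieldType) (s t : F) : (2 : F) != 0 -> s ^+ 2 = 1 - t ->
  1 - s = 2^-1 * (t + (1 - s) * (1 - s)).
Proof.
move=> t0 h; have -> : t = 1 - s ^+ 2 by rewrite h; ring.
by field.
Qed.

Lemma sqrt_step (F : comUnitRingType) (t g y : F) : y = 2^-1 * (t + y * y) ->
  2^-1 * (t + g * g) - y = 2^-1 * ((g + y) * (g - y)).
Proof. by move=> {1}->; ring. Qed.

Lemma sqrt_fact (F : comPzRingType) (s t : F) : s ^+ 2 = 1 - t ->
  t = (1 - s) * (1 + s).
Proof. by move=> h; have -> : t = 1 - s ^+ 2 by [rewrite h; ring]; ring. Qed.

Section ratapp.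
Context {R : realType}.
Notation C := (Cplx R).
Implicit Types (x y z w : C) (e : R) (f g : C -> C) (p q : {poly C}).
Variables (G : set C).

(** The closed algebra generated by z and 1/z on G. *)
Definition ratapp f := forall e, 0 < e ->
  exists p n, forall z, G z -> nm (f z - p.[z] / z ^+ n) < e.

Lemma ratapp_lim f :
  (forall e, 0 < e -> exists2 g, ratapp g & forall z, G z -> nm (f z - g z) < e) ->
  ratapp f.
Proof.
move=> h e e0; have e2 : 0 < e / 2 by rewrite divr_gt0.
have [g rg fg] := h _ e2; have [p [n gp]] := rg _ e2.
exists p, n => z Gz; apply: le_lt_trans (ler_nm_dist _ (g z) _) _.
by rewrite (splitr e) ltrD ?fg ?gp.
Qed.

Lemma ratapp_ext f g : (forall z, G z -> f z = g z) -> ratapp f -> ratapp g.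
Proof.
move=> fg rf; apply: ratapp_lim => e e0; exists f => // z Gz.
by rewrite fg// subrr nm0.
Qed.

Lemma ratapp_poly p : ratapp (horner p).
Proof.
by move=> e e0; exists p, 0%N => z Gz; rewrite expr0 divr1 subrr nm0.
Qed.

Lemma ratapp_cst c : ratapp (fun=> c).
Proof.
by apply: ratapp_ext (ratapp_poly c%:P) => z _; rewrite hornerC.
Qed.

Lemma ratapp_id : ratapp id.
Proof. by apply: ratapp_ext (ratapp_poly 'X) => z _; rewrite hornerX. Qed.

Lemma ratapp_inv : ratapp (fun z => z^-1).
Proof.
move=> e e0; exists 1%:P, 1%N => z Gz.
by rewrite hornerC expr1 mul1r subrr nm0.
Qed.

Variables (M delta : R).
Hypothesis (delta0 : 0 < delta).
Hypothesis GM : forall z, G z -> delta <= nm z <= M.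

Lemma annulus_neq0 z : G z -> z != 0.
Proof. by move=> /GM /andP[h _]; rewrite -nm_gt0 (lt_le_trans delta0). Qed.

Lemma poly_bounded p : exists K : R, forall z, G z -> nm p.[z] <= K.
Proof.
elim/poly_ind: p => [|p c [K hK]].
  by exists 0 => z _; rewrite horner0 nm0.
exists (K * M + nm c) => z Gz; rewrite hornerMXaddC (le_trans (ler_nmD _ _))//.
by rewrite lerD2r nmM ler_pM ?nm_ge0 ?hK//; case/andP: (GM Gz).
Qed.

Lemma ratapp_bounded f : ratapp f ->
  exists2 K : R, 0 < K & forall z, G z -> nm (f z) <= K.
Proof.
move=> /(_ 1 ltr01)[p [n h]]; have [K hK] := poly_bounded p.
exists (`|K| * delta ^- n + 1).
  by rewrite ltr_wpDl// mulr_ge0// invr_ge0 exprn_ge0// ltW.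
move=> z Gz; rewrite -[f z](subrK (p.[z] / z ^+ n)).
apply: le_trans (ler_nmD _ _) _; rewrite addrC lerD//; last by rewrite ltW// h.
have /andP[dz _] := GM Gz.
rewrite nmM nmV nmX ler_pM ?nm_ge0 ?invr_ge0 ?exprn_ge0 ?nm_ge0//.
  by rewrite (le_trans (hK _ Gz))// ler_norm.
have nz : 0 < nm z by exact: lt_le_trans dz.
by rewrite lef_pV2 ?posrE ?exprn_gt0// lerXn2r ?nnegrE ?nm_ge0// ltW.
Qed.

Lemma ratappD f g : ratapp f -> ratapp g -> ratapp (fun z => f z + g z).
Proof.
move=> rf rg e e0; have e2 : 0 < e / 2 by rewrite divr_gt0.
have [p [n hp]] := rf _ e2; have [q [m hq]] := rg _ e2.
exists (p * 'X^m + q * 'X^n), (n + m)%N => z Gz.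
have z0 := annulus_neq0 Gz.
have -> : (p * 'X^m + q * 'X^n).[z] / z ^+ (n + m) = p.[z] / z ^+ n + q.[z] / z ^+ m.
  by rewrite hornerD !hornerM !hornerXn exprD addf_div// expf_neq0.
rewrite opprD addrACA (splitr e); apply: le_lt_trans (ler_nmD _ _) _.
by rewrite ltrD ?hp ?hq.
Qed.

Lemma ratappM f g : ratapp f -> ratapp g -> ratapp (fun z => f z * g z).
Proof.
move=> rf rg e e0.
have [Kf Kf0 hKf] := ratapp_bounded rf; have [Kg Kg0 hKg] := ratapp_bounded rg.
pose K := Kf + Kg + 2; have K0 : 0 < K by rewrite /K; lra.
(* d (Kg + Kf + d) < e *)
pose d := Num.min 1 (e / K).
have d0 : 0 < d by rewrite lt_min ltr01 divr_gt0.
have [p [n hp]] := rf _ d0; have [q [m hq]] := rg _ d0.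
exists (p * q), (n + m)%N => z Gz.
have z0 := annulus_neq0 Gz.
have -> : (p * q).[z] / z ^+ (n + m) = (p.[z] / z ^+ n) * (q.[z] / z ^+ m).
  by rewrite hornerM exprD mulf_div.
set P := p.[z] / z ^+ n; set Q := q.[z] / z ^+ m.
rewrite mulf_sub_split.
have hp' : nm (f z - P) < d by exact: hp.
have hq' : nm (g z - Q) < d by exact: hq.
apply: le_lt_trans (ler_nmD _ _) _; rewrite !nmM.
have d1 : d <= 1 by rewrite ge_min lexx.
have dK : d * K <= e by rewrite -ler_pdivlMr// ge_min lexx orbT.
have h1 : nm (f z - P) * nm (g z) <= d * Kg.
  by rewrite ler_pM ?nm_ge0// ?hKg// ltW.
have h2 : nm (f z - (f z - P)) * nm (g z - Q) <= (Kf + d) * d.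
  rewrite ler_pM ?nm_ge0 ?(ltW hq')// (le_trans (ler_nmB _ _))//.
  by rewrite lerD ?hKf// ltW.
apply: (@le_lt_trans _ _ (d * Kg + (Kf + d) * d)); first exact: lerD.
have := ler_wpM2l (ltW d0) d1; move: dK; rewrite /K; lra.
Qed.

Lemma ratappN f : ratapp f -> ratapp (fun z => - f z).
Proof.
move=> rf; apply: ratapp_ext (ratappM (ratapp_cst (-1)) rf) => z _.
by rewrite mulN1r.
Qed.

Lemma ratappB f g : ratapp f -> ratapp g -> ratapp (fun z => f z - g z).
Proof. by move=> rf rg; apply: ratappD => //; exact: ratappN. Qed.

Lemma ratapp_sum (I : Type) (r : seq I) (F : I -> C -> C) :
  (forall i, ratapp (F i)) -> ratapp (fun z => \sum_(i <- r) F i z).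
Proof.
move=> rF; elim: r => [|i r IH].
  by apply: ratapp_ext (ratapp_cst 0) => z _; rewrite big_nil.
by apply: ratapp_ext (ratappD (rF i) IH) => z _; rewrite big_cons.
Qed.

Lemma ratapp_geo f (g : nat -> C -> C) (K : R) : (forall n, ratapp (g n)) ->
  (forall n z, G z -> nm (f z - g n z) <= K * 2^-1 ^+ n) -> ratapp f.
Proof.
move=> rg fg; apply: ratapp_lim => e e0.
have : (fun n => `|K| * 2^-1 ^+ n) @ \oo --> (0 : R).
  rewrite -[X in _ --> X](mulr0 `|K|); apply: cvgMr; apply: cvg_expr.
  by rewrite ger0_norm// invf_lt1// ltr1n.
move=> /cvgrPdist_lt/(_ e e0)[n _ /(_ n (leqnn n))] /=.
rewrite sub0r normrN => h.
exists (g n) => // z Gz; apply: le_lt_trans (fg _ _ Gz) _.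
apply: le_lt_trans h; rewrite (le_trans (ler_norm _))// !normrM.
by rewrite normr_id.
Qed.

(** The iterates of v -> 1 + t v are the partial sums of the geometric series. *)
Lemma ratapp_geom t : ratapp t -> (forall z, G z -> nm (t z) <= 2^-1) ->
  ratapp (fun z => (1 - t z)^-1).
Proof.
move=> rt t2.
pose g := fix g n : C -> C := if n is n.+1 then fun z => 1 + t z * g n z else fun=> 0.
apply: (@ratapp_geo _ g 2).
  elim=> [|n IH]; first exact: ratapp_cst.
  by apply: ratappD; [exact: ratapp_cst|exact: ratappM].
move=> n z Gz; have tz := t2 _ Gz.
have n1 : 2^-1 <= nm (1 - t z).
  by apply: le_trans (lerB_nm _ _); rewrite nm1; lra.
have n0 : 1 - t z != 0.
  by rewrite -nm_gt0 (lt_le_trans _ n1)// invr_gt0.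
elim: n => [|n IH] /=.
  by rewrite subr0 mulr1 nmV -[leRHS]invrK lef_pV2 ?posrE// (lt_le_trans _ n1).
by rewrite geom_step// nmM exprS mulrCA ler_pM ?nm_ge0.
Qed.

(** The square root with nonnegative real part. *)
Definition psqrt z : C := if 0 <= Re (sqrtC z) then sqrtC z else - sqrtC z.

Lemma psqrt_sqr z : psqrt z ^+ 2 = z.
Proof. by rewrite /psqrt; case: ifP; rewrite ?sqrrN sqrtCK. Qed.

Lemma psqrt_ge0 z : 0 <= Re (psqrt z).
Proof.
rewrite /psqrt; case: ifPn => //; rewrite -ltNge ReN oppr_ge0.
exact: ltW.
Qed.

Lemma psqrt_gt0 z : 0 < Re z -> 0 < Re (psqrt z).
Proof.
move=> z0; rewrite lt_neqAle psqrt_ge0 andbT eq_sym; apply/eqP => h.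
move: z0; rewrite -{1}(psqrt_sqr z) expr2 RecM h mul0r sub0r oppr_gt0 -expr2.
by rewrite ltNge sqr_ge0.
Qed.

(** The fixed-point iteration y -> (t + y^2) / 2 converges to 1 - sqrt(1 - t); it maps the
    disc of radius 1/2 to itself, where it is a contraction. *)
Lemma ratapp_sqrt t : ratapp t -> (forall z, G z -> nm (t z) <= 2^-1) ->
  ratapp (fun z => psqrt (1 - t z)).
Proof.
move=> rt t2.
pose g := fix g n : C -> C := if n is n.+1
  then fun z => 2^-1 * (t z + g n z * g n z) else fun=> 0.
apply: (@ratapp_geo _ (fun n z => 1 - g n z) 1).
  suff h n : ratapp (g n) by move=> n; apply: ratappB => //; exact: ratapp_cst.
  elim: n => [|n IH]; first exact: ratapp_cst.
  apply: ratappM; first exact: ratapp_cst.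
  by apply: ratappD => //; exact: ratappM.
have half : nm (2^-1 : C) = 2^-1 by rewrite nmV nm_nat.
have two0 : (2 : C) != 0 by rewrite pnatr_eq0.
move=> n z Gz; have tz := t2 _ Gz.
have gb m : nm (g m z) <= 2^-1.
  elim: m => [|m IH] /=; first by rewrite nm0 invr_ge0.
  rewrite nmM half ler_piMr ?invr_ge0// (le_trans (ler_nmD _ _))// nmM.
  have h : nm (g m z) * nm (g m z) <= 2^-1 * 2^-1 by rewrite ler_pM ?nm_ge0.
  by move: (nm (g m z) * _) h (nm (t z)) tz => u h v; lra.
set s := psqrt (1 - t z); have ss : s ^+ 2 = 1 - t z by exact: psqrt_sqr.
set y := 1 - s.
have sE m : nm (s - (1 - g m z)) = nm (g m z - y).
  by rewrite /y !opprB addrCA.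
have ty : y = 2^-1 * (t z + y * y) by exact: sqrt_fix.
(* t = y (1 + s), and 1 + s has modulus at least 1 *)
have yb : nm y <= 2^-1.
  have s1 : 1 <= nm (1 + s).
    apply: le_trans (Re_le_nm _); rewrite ReD Re1 ger0_norm ?lerDl ?psqrt_ge0//.
    by rewrite addr_ge0 ?psqrt_ge0.
  by apply: le_trans tz; rewrite (sqrt_fact ss) nmM ler_peMr// nm_ge0.
rewrite sE mul1r; elim: n => [|n IH] /=.
  rewrite sub0r nmN expr0 (le_trans yb)//; lra.
rewrite sqrt_step// exprS !nmM half ler_pM2l ?invr_gt0//.
apply: le_trans IH; rewrite ler_piMl ?nm_ge0// (le_trans (ler_nmD _ _))//.
by have := gb n; lra.
Qed.

End ratapp.

(** * Bounded substitutes for Cauchy kernels *)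

Lemma cauchy_shift (F : fieldType) (z a b : F) : z - a != 0 ->
  1 - (b - a) / (z - a) = (z - b) / (z - a).
Proof. by move=> h; apply: (mulIf h); rewrite mulrBl !divfK//; ring. Qed.

Lemma joukowski_sub (F : fieldType) (s W : F) : s + 1 != 0 -> s ^+ 2 = 1 + W ->
  4 * (s - 1) / (s + 1) - W = - ((s - 1) ^+ 2 * ((s + 3) / (s + 1))).
Proof.
move=> s1 h; have -> : W = s ^+ 2 - 1 by rewrite h; ring.
by field.
Qed.

Lemma joukowski_div (F : fieldType) (s W : F) : W != 0 -> s ^+ 2 = 1 + W ->
  (s - 1) / (s + 1) = (s - 1) ^+ 2 * W^-1.
Proof.
move=> W0 h; have E : W = (s - 1) * (s + 1).
  by have -> : W = s ^+ 2 - 1 by [rewrite h; ring]; ring.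
move: W0; rewrite E mulf_eq0 negb_or => /andP[h1 h2].
by field; rewrite h1 h2.
Qed.

Lemma near_quot_bound (R : realFieldType) (d z r : R) : 0 < d -> 0 < z -> d <= 2 * r ->
  3 * (d / z) ^+ 2 <= 6 * r / z ^+ 2 * d.
Proof.
move=> d0 z0 dr; rewrite expr_div_n mulrA [leRHS]mulrAC.
by rewrite ler_pM2r ?invr_gt0 ?exprn_gt0// expr2 mulrA ler_pM2r//; lra.
Qed.

Lemma shift_quot_bound1 (R : realFieldType) (a D W r : R) : 0 < D -> 0 < r ->
  2 / 3 * D <= W -> a <= r -> a / (W * D) <= 3 / 2 * r / D ^+ 2.
Proof.
move=> D0 r0 DW ar; have W0 : 0 < W by lra.
rewrite ler_pdivrMr ?mulr_gt0// mulrAC ler_pdivlMr ?exprn_gt0//.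
rewrite expr2 mulrA [_ * (W * D)]mulrA ler_pM2r//.
have h1 : a * D <= r * D by rewrite ler_pM2r.
have h2 : r * (2 / 3 * D) <= r * W by rewrite ler_pM2l.
by move: h1 h2; rewrite mulrA; lra.
Qed.

Lemma shift_quot_bound2 (R : realFieldType) (D W r : R) : 0 < D -> 0 < r ->
  2 / 3 * D <= W -> 6 * r / W ^+ 2 <= 27 / 2 * r / D ^+ 2.
Proof.
move=> D0 r0 DW; have W0 : 0 < W by lra.
rewrite ler_pdivrMr ?exprn_gt0// mulrAC ler_pdivlMr ?exprn_gt0//.
have : (2 / 3 * D) ^+ 2 <= W ^+ 2 by apply: lerXn2r; rewrite ?nnegrE; lra.
rewrite exprMn => h; have {}h : r * ((2 / 3) ^+ 2 * D ^+ 2) <= r * W ^+ 2 by rewrite ler_pM2l.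
by lra.
Qed.

Section kernel.
Context {R : realType}.
Notation C := (Cplx R).
Implicit Types (x y z w a b : C) (e r : R) (f g s : C -> C).
Variables (G : set C) (gam : R -> C) (M delta : R).
Hypothesis Ggam : jparam G gam.
Hypothesis (delta0 : 0 < delta).
Hypothesis GM : forall z, G z -> delta <= nm z <= M.
Hypothesis G0 : jordan_int G 0.
Local Notation comp := (connected_component (~` G)).
Local Notation rat := (ratapp G).

Lemma notin_curve_sub a z : ~ G a -> G z -> z - a != 0.
Proof. by move=> Ga Gz; rewrite subr_eq0; apply/eqP => za; apply: Ga; rewrite -za. Qed.

(** With t = (b - a) / (z - a) one has 1 / (z - b) = (1 / (z - a)) (1 - t)^(-1). *)
Lemma cauchy_step a b : ~ G a -> (forall z, G z -> nm (b - a) <= 2^-1 * nm (z - a)) ->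
  rat (fun z => (z - a)^-1) -> rat (fun z => (z - b)^-1).
Proof.
move=> Ga h ra.
pose t z := (b - a) * (z - a)^-1.
have rt : rat t by exact: (ratappM delta0 GM (ratapp_cst G (b - a)) ra).
have t2 z : G z -> nm (t z) <= 2^-1.
  move=> Gz; rewrite nmM nmV ler_pdivrMr; first exact: h.
  by rewrite nm_gt0 notin_curve_sub.
apply: ratapp_ext (ratappM delta0 GM ra (ratapp_geom delta0 GM rt t2)) => z Gz.
have za := notin_curve_sub Ga Gz.
by rewrite /t cauchy_shift// invf_div mulrA mulVf// mul1r.
Qed.

(** Moving the pole a little does not leave the algebra, so the admissible poles are a
    union of components.  The bounded one contains 0, and the unbounded one contains
    points b large enough for the geometric series in z / b. *)
Lemma ratapp_cauchy a : ~ G a -> rat (fun z => (z - a)^-1).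
Proof.
move=> Ga.
have loc : forall x, ~ G x -> exists2 e : R, 0 < e & forall y, nm (y - x) < e ->
    (rat (fun z => (z - x)^-1) <-> rat (fun z => (z - y)^-1)).
  move=> x Gx; have [d d0 hd] := curve_far Ggam Gx.
  exists (d / 3); first by rewrite divr_gt0.
  move=> y yx; have hy z : G z -> 2 * d / 3 <= nm (z - y).
    move=> Gz; have := ler_nm_dist z y x; have := hd _ Gz; lra.
  have Gy : ~ G y by move=> /hy; rewrite subrr nm0; lra.
  split; apply: cauchy_step => // z Gz; first by have := hd _ Gz; lra.
  by rewrite nm_sub; have := hy _ Gz; lra.
have far b : 2 * M < nm b -> rat (fun z => (z - b)^-1).
  move=> Mb.
  have [->|/set0P[z0 Gz0]] := eqVneq G set0.
    by move=> e e0; exists 0, 0%N.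
  have M0 : 0 < M by have /andP[/(lt_le_trans delta0)/lt_le_trans] := GM Gz0; apply.
  have b0 : 0 < nm b by rewrite (lt_trans _ Mb)// mulr_gt0.
  have b0' : b != 0 by rewrite -nm_gt0.
  pose t z := b^-1 * z.
  have rt : rat t by exact: (ratappM delta0 GM (ratapp_cst G b^-1) (ratapp_id G)).
  have t2 z : G z -> nm (t z) <= 2^-1.
    move=> /GM/andP[_ zM]; rewrite /t mulrC nmM nmV ler_pdivrMr//; lra.
  apply: ratapp_ext (ratappM delta0 GM (ratapp_cst G (- b^-1)) (ratapp_geom delta0 GM rt t2)) => z Gz.
  by rewrite /t mulNr -invfM mulrBr mulr1 mulrA divff// mul1r -invrN opprB.
have [bd|nbd] := pselect (bounded_set (comp a)).
  have c0a : comp 0 a by apply: (bounded_component_unique Ggam) => //; case: G0.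
  apply: (component_clopen (closed_curve Ggam) _ loc c0a).
  by apply: ratapp_ext (ratapp_inv G) => z _; rewrite subr0.
have [b cb Mb] : exists2 b, comp a b & 2 * M < nm b.
  apply: contrapT => /forall2NP h; apply: nbd; apply/bounded_setCP.
  exists (2 * M) => z cz; rewrite leNgt; apply/negP => Mz.
  by case: (h z).
apply: (component_clopen (closed_curve Ggam) _ loc (connected_component_sym cb)).
exact: far.
Qed.

(** A branch on G of the square root of (z - a) / (z - w).  The sign is fixed only at
    distance 2r from w, where the quotient stays in the right half-plane while
    |a - w| < 2r. *)
Definition root_branch w r a := exists2 s, rat s &
  (forall z, G z -> s z ^+ 2 = (z - a) / (z - w)) /\
  (forall z, G z -> 2 * r <= nm (z - w) -> 0 < Re (s z)).

Lemma Re_ratio_gt0 z a w : nm (a - w) < nm (z - w) -> 0 < Re ((z - a) / (z - w)).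
Proof.
move=> h; have zw : 0 < nm (z - w) by exact: le_lt_trans (nm_ge0 _) h.
rewrite -cauchy_shift; last by rewrite -nm_gt0.
rewrite ReB Re1 subr_gt0 (le_lt_trans (ler_norm _))// (le_lt_trans (Re_le_nm _))//.
by rewrite nm_div ltr_pdivrMr// mul1r.
Qed.

(** Both factors lie in the sector |arg| < pi/4, because their squares have positive real
    part. *)
Lemma sector_mul (s p : C) : 0 < Re s -> 0 < Re (s ^+ 2) -> 0 < Re p ->
  0 < Re (p ^+ 2) -> 0 < Re (s * p).
Proof.
rewrite !expr2 !RecM -!expr2 !subr_gt0 => s0 s2 p0 p2.
have lt (u v : R) : 0 < u -> v ^+ 2 < u ^+ 2 -> `|v| < u.
  move=> u0; rewrite -(real_normK (num_real v)) ltr_pXn2r// ?nnegrE//.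
  exact: ltW.
apply: le_lt_trans (ler_norm _) _; rewrite normrM.
by apply: ltr_pM => //; exact: lt.
Qed.

(** Multiply by the principal root of (z - b) / (z - a) = 1 - (b - a) / (z - a). *)
Lemma root_branch_step w r a b : ~ G a -> nm (a - w) < 2 * r ->
  (forall z, G z -> nm (b - a) <= 2^-1 * nm (z - a)) ->
  root_branch w r a -> root_branch w r b.
Proof.
move=> Ga aw hb [s rs [s2 sp]].
pose t z := (b - a) * (z - a)^-1.
have rt : rat t.
  exact: (ratappM delta0 GM (ratapp_cst G (b - a)) (ratapp_cauchy Ga)).
have t2 z : G z -> nm (t z) <= 2^-1.
  move=> Gz; rewrite nmM nmV ler_pdivrMr; first exact: hb.
  by rewrite nm_gt0 notin_curve_sub.
exists (fun z => s z * psqrt (1 - t z)).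
  exact: (ratappM delta0 GM rs (ratapp_sqrt delta0 GM rt t2)).
have za z : G z -> z - a != 0 by exact: notin_curve_sub.
split=> z Gz.
  rewrite exprMn s2// psqrt_sqr /t cauchy_shift ?za//.
  by rewrite mulrC mulrA divfK ?za.
move=> zr; have t0 : 0 < Re (1 - t z).
  rewrite ReB Re1 subr_gt0 (le_lt_trans (ler_norm _))// (le_lt_trans (Re_le_nm _))//.
  by have := t2 _ Gz; lra.
apply: sector_mul; rewrite ?psqrt_sqr//; first exact: sp.
  by rewrite s2//; apply: Re_ratio_gt0; exact: lt_le_trans zr.
exact: psqrt_gt0.
Qed.

(** Otherwise the points a with |a - w| < r that carry a branch would form a clopen part of
    the component: a step out of this part is shorter than r, so it would end at a
    point b of the required kind. *)
Lemma root_branch_exit w r c : ~ G w -> 0 < r -> comp w c -> r <= nm (c - w) ->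
  exists2 b, r <= nm (b - w) < 2 * r & root_branch w r b.
Proof.
move=> Gw r0 wc cr; apply: contrapT => /forall2NP h.
pose S a := nm (a - w) < r /\ root_branch w r a.
suff /(_ c wc)[] : comp w `<=` S by rewrite ltNge cr.
apply: (component_clopen (closed_curve Ggam)).
  split; first by rewrite subrr nm0.
  exists (fun=> 1); first exact: ratapp_cst.
  split=> z Gz; last by rewrite Re1.
  by rewrite expr1n divff// notin_curve_sub.
have step a b : ~ G a -> (forall z, G z -> nm (b - a) <= 2^-1 * nm (z - a)) ->
    nm (b - a) < r -> S a -> S b.
  move=> Ga hb br [ar ga].
  have gb : root_branch w r b by apply: root_branch_step ga => //; lra.
  split => //; rewrite ltNge; apply/negP => rb.
  have [nb|//] := h b; apply: nb; rewrite rb /=.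
  by have := ler_nm_dist b a w; lra.
move=> x Gx; have [d d0 hd] := curve_far Ggam Gx.
exists (Num.min (d / 3) r); first by rewrite lt_min divr_gt0.
move=> y; rewrite lt_min => /andP[yx yr]; have hy z : G z -> 2 * d / 3 <= nm (z - y).
  move=> Gz; have := ler_nm_dist z y x; have := hd _ Gz; lra.
have Gy : ~ G y by move=> /hy; rewrite subrr nm0; lra.
split; first by apply: step => // z Gz; have := hd _ Gz; lra.
apply: step => //; last by rewrite nm_sub.
by move=> z Gz; rewrite nm_sub; have := hy _ Gz; lra.
Qed.

(** With u = (s - 1) / (s + 1), W = 4 u / (1 - u)^2 is the Koebe function, so that 4 u
    agrees with W to first order; Re s > 0 keeps s away from the pole s = -1. *)
Lemma joukowski_far (s W : C) : s ^+ 2 = 1 + W -> 0 < Re s ->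
  nm (4 * (s - 1) / (s + 1) - W) <= 3 * nm W ^+ 2 /\
  nm (4 * (s - 1) / (s + 1)) <= 44.
Proof.
move=> sW s0.
have s1 : 1 <= nm (s + 1).
  by apply: le_trans (Re_le_nm _); rewrite ReD Re1 ger0_norm ?lerDr ?addr_ge0// ltW.
have s10 : s + 1 != 0 by rewrite -nm_gt0 (lt_le_trans _ s1).
have n4 : nm (4 : C) = 4 by rewrite nm_nat.
have h3 : nm (s + 3) <= 3 * nm (s + 1).
  have -> : s + 3 = (s + 1) + 2 by rewrite -addrA; congr (_ + _); rewrite -(natrD _ 1 2).
  by rewrite (le_trans (ler_nmD _ _))// nm_nat; lra.
have hW : nm W = nm (s - 1) * nm (s + 1).
  rewrite -nmM; congr nm; have -> : W = s ^+ 2 - 1 by rewrite sW addrAC subrr add0r.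
  by rewrite -subr_sqr expr1n.
split.
  rewrite joukowski_sub// nmN nmM nmX nm_div mulrC ler_pM ?divr_ge0 ?exprn_ge0 ?nm_ge0//.
    by rewrite ler_pdivrMr// (lt_le_trans _ s1).
  by rewrite lerXn2r ?nnegrE ?nm_ge0// hW ler_peMr ?nm_ge0.
rewrite nm_div nmM n4 ler_pdivrMr ?(lt_le_trans _ s1)//.
have -> : s - 1 = (s + 1) - 2 by rewrite -addrA; congr (_ + _); rewrite -opprB; congr (- _); rewrite -(natrB _ (isT : 1 <= 2)%N).
by have := ler_nmB (s + 1) 2; rewrite nm_nat; lra.
Qed.

(** Here the sign of s is unknown, but s = -1 would force W = 0. *)
Lemma joukowski_near (s W : C) : s ^+ 2 = 1 + W -> 2^-1 < nm W ->
  nm (4 * (s - 1) / (s + 1)) <= 44.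
Proof.
move=> sW W2.
have hW : nm W = nm (s - 1) * nm (s + 1).
  rewrite -nmM; congr nm; have -> : W = s ^+ 2 - 1 by rewrite sW addrAC subrr add0r.
  by rewrite -subr_sqr expr1n.
have s1 : nm (s - 1) <= nm (s + 1) + 2.
  have -> : s - 1 = (s + 1) - 2 by rewrite -addrA; congr (_ + _); rewrite -opprB; congr (- _); rewrite -(natrB _ (isT : 1 <= 2)%N).
  by have := ler_nmB (s + 1) 2; rewrite nm_nat.
have n4 : nm (4 : C) = 4 by rewrite nm_nat.
(* if |s + 1| < 1/5 then |W| = |s - 1| |s + 1| < 11/25 *)
have h5 : 5^-1 <= nm (s + 1).
  rewrite leNgt; apply/negP => h.
  have : nm (s - 1) * nm (s + 1) <= (5^-1 + 2) * 5^-1.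
    rewrite ler_pM ?nm_ge0// ?(ltW h)//; lra.
  by move: W2; rewrite hW; lra.
rewrite nm_div nmM n4 ler_pdivrMr; first lra.
by rewrite (lt_le_trans _ h5)// invr_gt0.
Qed.

(** The kernel is the Koebe-type quotient of the branch reached at b, divided by w - b.
    The quotient 4 (s - 1) / (s + 1) equals 4 (s - 1)^2 / W, which shows that it is in
    the algebra. *)
Lemma kernel_at w r c : ~ G w -> 0 < r -> comp w c -> r <= nm (c - w) ->
  exists2 k, rat k & forall z, G z -> nm (k z) <= 44 / r /\
    (2 * r <= nm (z - w) -> nm (k z - (z - w)^-1) <= 6 * r / nm (z - w) ^+ 2).
Proof.
move=> Gw r0 wc cr; have [b /andP[b1 b2] [s rs [s2 sp]]] := root_branch_exit Gw r0 wc cr.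
pose d := w - b.
have nd : nm d = nm (b - w) by rewrite nm_sub.
have d0 : d != 0 by rewrite -nm_gt0 nd (lt_le_trans r0).
pose W z := d / (z - w).
have sW z : G z -> s z ^+ 2 = 1 + W z.
  move=> Gz; rewrite s2//; have zw := notin_curve_sub Gw Gz.
  by rewrite /W /d -cauchy_shift// -[in RHS]opprB mulNr.
have W0 z : G z -> W z != 0.
  by move=> Gz; rewrite mulf_neq0// invr_eq0 notin_curve_sub.
exists (fun z => 4 * (s z - 1) ^+ 2 * (z - w) * d^-1 * d^-1).
  have rs1 : rat (fun z => s z - 1).
    by apply: (ratappB delta0 GM) => //; exact: ratapp_cst.
  apply: (ratappM delta0 GM); last exact: ratapp_cst.
  apply: (ratappM delta0 GM); last exact: ratapp_cst.
  apply: (ratappM delta0 GM); last first.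
    by apply: (ratappB delta0 GM); [exact: ratapp_id|exact: ratapp_cst].
  apply: (ratappM delta0 GM); first exact: ratapp_cst.
  by apply: ratapp_ext (ratappM delta0 GM rs1 rs1) => z _.
move=> z Gz; have zw := notin_curve_sub Gw Gz.
have kE : 4 * (s z - 1) ^+ 2 * (z - w) * d^-1 * d^-1 =
    (4 * (s z - 1) / (s z + 1)) / d.
  congr (_ * _); rewrite -2!mulrA -[RHS]mulrA; congr (_ * _).
  by rewrite (joukowski_div (W0 _ Gz) (sW _ Gz)) /W invf_div.
rewrite kE; have WE : (z - w)^-1 = W z / d by rewrite /W mulrC mulKf.
have nW : nm (W z) = nm d / nm (z - w) by rewrite nm_div.
have nd0 : 0 < nm d by rewrite nm_gt0.
have nz0 : 0 < nm (z - w) by rewrite nm_gt0.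
have bnd : nm (4 * (s z - 1) / (s z + 1)) <= 44 ->
    nm (4 * (s z - 1) / (s z + 1) / d) <= 44 / r.
  move=> h; rewrite nm_div ler_pM ?invr_ge0 ?nm_ge0//.
  by rewrite lef_pV2 ?posrE// nd.
have [zr|zr] := leP (2 * r) (nm (z - w)).
  have [h1 h2] := joukowski_far (sW _ Gz) (sp _ Gz zr).
  split=> [|_]; first exact: bnd.
  rewrite WE -mulrBl nm_div ler_pdivrMr//; apply: le_trans h1 _.
  by rewrite nW near_quot_bound// nd ltW.
split=> //.
apply: bnd; apply: joukowski_near (sW _ Gz) _.
rewrite nW ltr_pdivlMr// nd; lra.
Qed.

(** The component of w leaves the disc of radius r around w: it is unbounded, or it is the
    component of 0, which contains the disc of radius 4r around 0. *)
Lemma cauchy_kernel (zeta : C) r : 0 < r -> 4 * r <= delta ->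
  exists2 k, rat k & forall z, G z -> nm (k z) <= 44 / r /\
    (3 * r <= nm (z - zeta) -> nm (k z - (z - zeta)^-1) <= 15 * r / nm (z - zeta) ^+ 2).
Proof.
move=> r0 rd; have [w Gw wz] := curve_empty_interior Ggam zeta r0.
have [c wc cr] : exists2 c, comp w c & r <= nm (c - w).
  have [bd|nbd] := pselect (bounded_set (comp w)); last first.
    apply: contrapT => /forall2NP h; apply: nbd; apply/bounded_setCP.
    exists (r + nm w) => z cz; rewrite leNgt; apply/negP => zr.
    have [//|nz] := h z; apply: nz.
    by have := lerB_nm z w; lra.
  have [G00 b0] := G0.
  have cw0 : comp w 0 by exact: (bounded_component_unique Ggam).
  have cwd : comp w (ofR (delta / 2)).
    apply: (component_ball cw0 (e := delta)).
      by move=> x; rewrite subr0 => xd /GM/andP[]; rewrite leNgt xd.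
    by rewrite subr0 nm_ofR ger0_norm ?divr_ge0 ?ltW//; lra.
  (* 0 and delta/2 cannot both be within r of w *)
  have [h|h] := leP r (nm (0 - w)); first by exists 0.
  exists (ofR (delta / 2)) => //.
  have := ler_nm_dist (ofR (delta / 2)) w 0.
  rewrite !subr0 nm_ofR gtr0_norm ?divr_gt0//.
  by move: h; rewrite sub0r nmN; lra.
have [k rk hk] := kernel_at Gw r0 wc cr.
exists k => // z Gz; have [h1 h2] := hk _ Gz; split=> // zr.
set D := nm (z - zeta) in zr *.
have Dw : 2 / 3 * D <= nm (z - w).
  by have := ler_nm_dist z w zeta; rewrite -/D; lra.
have D0 : 0 < D by lra.
have w0 : 0 < nm (z - w) by lra.
have /h2 {}h2 : 2 * r <= nm (z - w) by lra.
(* moving the pole from w to zeta costs another term of order r / |z - zeta|^2 *)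
have h3 : nm ((z - w)^-1 - (z - zeta)^-1) <= 3 / 2 * r / D ^+ 2.
  have zw : z - w != 0 by rewrite -nm_gt0.
  have zz : z - zeta != 0 by rewrite -nm_gt0.
  have -> : (z - w)^-1 - (z - zeta)^-1 = (w - zeta) / ((z - w) * (z - zeta)).
    rewrite -[X in X - _]mul1r -[X in _ - X]mul1r -mulNr addf_div//.
    by congr (_ / _); rewrite mul1r mulN1r opprB addrC addrA subrK.
  by rewrite nm_div nmM -/D shift_quot_bound1// ltW.
have h4 : 6 * r / nm (z - w) ^+ 2 <= 27 / 2 * r / D ^+ 2.
  exact: shift_quot_bound2.
apply: le_trans (ler_nm_dist _ (z - w)^-1 _) _.
apply: le_trans (lerD (le_trans h2 h4) h3) _.
by rewrite -mulrDl -mulrDl ler_pM2r ?invr_gt0 ?exprn_gt0// ler_pM2r//; lra.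
Qed.

End kernel.

(** * Equidistributed points on a circle *)

(** At roots of unity this gives the closed form of their Cauchy sum. *)
Lemma log_derivative (F : fieldType) (rs : seq F) (z : F) :
  (forall x, x \in rs -> z != x) ->
  \sum_(x <- rs) (z - x)^-1 =
  (\prod_(x <- rs) ('X - x%:P))^`().[z] / (\prod_(x <- rs) ('X - x%:P)).[z].
Proof.
elim: rs => [|a rs IH] h; first by rewrite !big_nil derivC horner0 mul0r.
rewrite !big_cons IH; last by move=> x xr; apply: h; rewrite inE xr orbT.
have za : z - a != 0 by rewrite subr_eq0 h// mem_head.
set P := \prod_(x <- rs) _.
have Pz : P.[z] != 0.
  rewrite /P horner_prod prodf_seq_neq0; apply/allP => x xr /=.
  by rewrite hornerXsubC subr_eq0 h// inE xr orbT.
rewrite derivM derivXsubC mul1r !hornerE; field.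
by rewrite za Pz.
Qed.

Lemma mulr_subr_frac (F : fieldType) (N Z c : F) : Z - c != 0 ->
  N * Z / (Z - c) - N = N * (c / (Z - c)).
Proof. by move=> h; apply: (mulIf h); rewrite mulrBl mulrA !divfK//; ring. Qed.

Section circle.
Context {R : realType}.
Notation C := (Cplx R).
Implicit Types (x y z w : C) (e r rho : R) (n : nat) (rs : seq C).

(** Abstracts the roots of X^n - rho^n: the means below need their number, their
    modulus and their Cauchy sum. *)
Definition circle_pts n rho rs := [/\ size rs = n, (forall x, x \in rs -> nm x = rho) &
  forall z, z ^+ n != ofR (rho ^+ n) ->
    \sum_(x <- rs) x / (z - x) = n%:R * (ofR (rho ^+ n) / (z ^+ n - ofR (rho ^+ n)))].

(** Sum x / (z - x) = z / (z - x) - 1, and use the logarithmic derivative of z^n - rho^n. *)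
Lemma circle_pts_exist n rho : 0 < rho -> (0 < n)%N -> exists rs, circle_pts n rho rs.
Proof.
move=> r0 n0; pose c : C := ofR (rho ^+ n).
pose P : {poly C} := 'X^n - c%:P.
have sP : size P = n.+1 by rewrite size_XnsubC.
have [rs hrs] := closed_field_poly_normal P.
have lP : lead_coef P = 1 by exact: lead_coefXnsubC.
rewrite lP scale1r in hrs.
exists rs.
have srs : size rs = n.
  by have := size_prod_XsubC rs id; rewrite -hrs sP => -[].
have root x : x \in rs -> x ^+ n = c.
  move=> xr; have : root P x by rewrite hrs root_prod_XsubC.
  by rewrite /root !hornerE subr_eq0 => /eqP.
split => // [x /root xn|z zn].
  apply/eqP; rewrite -(@eqrXn2 _ n) ?nm_ge0 ?ltW//.
  by rewrite -nmX xn nm_ofR ger0_norm// exprn_ge0// ltW.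
have zx x : x \in rs -> z != x by move=> /root xn; apply: contraNneq zn => ->; rewrite xn.
have n0' : (n%:R : C) != 0 by rewrite pnatr_eq0 -lt0n.
have d0 : z ^+ n - c != 0 by rewrite subr_eq0.
rewrite (eq_big_seq (fun x => z * (z - x)^-1 - 1)); last first.
  move=> x /zx zx'; have : z - x != 0 by rewrite subr_eq0.
  by move=> h; apply: (mulIf h); rewrite mulrBl !divfK// mul1r opprB addrC subrK.
rewrite sumrB -mulr_sumr log_derivative// -hrs.
rewrite derivB derivXn derivC subr0 ?hornerMn ?hornerD ?hornerN ?hornerC ?hornerXn ?hornerMn ?hornerXn.
rewrite big_const_seq count_predT srs iter_addr_0.
have E : z * (z ^+ n.-1 *+ n) = n%:R * z ^+ n.
  by rewrite -mulr_natl mulrCA -exprS prednK.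
rewrite [z * (_ / _)]mulrA E.
exact: mulr_subr_frac.
Qed.

End circle.

(** * Means over equidistributed points *)

Lemma cayley_frac (F : fieldType) (z x : F) : z - x != 0 ->
  1 + 2 * (x / (z - x)) = (z + x) / (z - x).
Proof. by move=> h; apply: (mulIf h); rewrite mulrDl mulrA !divfK//; ring. Qed.

Section circle_bounds.
Context {R : realType}.
Notation C := (Cplx R).
Implicit Types (x y z w : C) (e r rho : R) (n : nat) (rs : seq C).

(** The real part of (z + x) / (z - x). *)
Lemma poisson_kernel x z : z != x ->
  Re (1 + 2 * (x / (z - x))) = (nm z ^+ 2 - nm x ^+ 2) * nm (z - x) ^- 2.
Proof.
rewrite -subr_eq0 => zx; rewrite cayley_frac// invCE mulrCA ReZ mulrC; congr (_ * _).
by rewrite RecM Rec_conj Imc_conj !sqr_nm !ReD !ImD !ReN !ImN; ring.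
Qed.

Lemma small_quot (c Z : C) e : Z != 0 -> e <= 2^-1 -> nm c <= e * nm Z ->
  Z != c /\ nm (c / (Z - c)) <= 2 * e.
Proof.
move=> Z0 e2 cZ; have nZ : 0 < nm Z by rewrite nm_gt0.
have h : 2^-1 * nm Z <= nm (Z - c).
  have := lerB_nm Z c; have : e * nm Z <= 2^-1 * nm Z by rewrite ler_pM2r.
  by lra.
have h0 : 0 < nm (Z - c) by apply: lt_le_trans h; rewrite mulr_gt0// invr_gt0.
split; first by rewrite -subr_eq0 -nm_gt0.
rewrite nm_div ler_pdivrMr// (le_trans cZ)//.
have e0 : 0 <= e.
  by rewrite -(pmulr_lge0 _ nZ) (le_trans _ cZ)// nm_ge0.
have : 2 * e * (2^-1 * nm Z) <= 2 * e * nm (Z - c).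
  by rewrite ler_wpM2l// mulr_ge0.
by move: (nm (Z - c)) (nm Z) => a b; lra.
Qed.

(** For large n a fixed gap between radii makes the n-th powers incomparable. *)
Lemma pow_gap (a b g L e : R) n : 0 <= a -> 0 < g -> a + g <= b -> b <= L ->
  (1 - g / L) ^+ n <= e -> a ^+ n <= e * b ^+ n.
Proof.
move=> a0 g0 ab bL he; have b0 : 0 < b by lra.
have L0 : 0 < L by exact: lt_le_trans bL.
have h : a <= (1 - g / L) * b.
  rewrite mulrBl mul1r lerBrDr (le_trans _ ab)// lerD2l mulrAC ler_pdivrMr//.
  by rewrite ler_pM2l.
have h0 : 0 <= 1 - g / L.
  by rewrite subr_ge0 ler_pdivrMr// mul1r; lra.
apply: (@le_trans _ _ (((1 - g / L) * b) ^+ n)).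
  by apply: lerXn2r => //; rewrite nnegrE ?mulr_ge0// ltW.
by rewrite exprMn ler_pM2r// exprn_gt0.
Qed.

Lemma Re_sum (I : Type) (s : seq I) (F : I -> C) :
  Re (\sum_(i <- s) F i) = \sum_(i <- s) Re (F i).
Proof. by elim: s => [|i s IH]; rewrite ?big_nil// !big_cons ReD IH. Qed.

Definition cmean rs (F : C -> C) : C := (\sum_(x <- rs) F x) / (size rs)%:R.
Definition rmean rs (F : C -> R) : R := (\sum_(x <- rs) F x) / (size rs)%:R.

Lemma ler_rmean rs F F' : (forall x, x \in rs -> F x <= F' x) -> rmean rs F <= rmean rs F'.
Proof.
move=> h; rewrite /rmean ler_wpM2r ?invr_ge0//.
by rewrite big_seq [leRHS]big_seq; apply: ler_sum.
Qed.

Lemma nm_cmean rs F : nm (cmean rs F) <= rmean rs (fun x => nm (F x)).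
Proof. by rewrite nm_div nm_nat ler_wpM2r ?invr_ge0// ler_nm_sum. Qed.

Lemma rmeanZ rs F (c : R) : rmean rs (fun x => c * F x) = c * rmean rs F.
Proof. by rewrite /rmean -mulr_sumr mulrA. Qed.

Lemma rmeanD rs F F' : rmean rs (fun x => F x + F' x) = rmean rs F + rmean rs F'.
Proof. by rewrite /rmean big_split mulrDl. Qed.

Lemma rmean_cst rs (c : R) : (0 < size rs)%N -> rmean rs (fun=> c) = c.
Proof.
move=> s0; rewrite /rmean big_const_seq count_predT iter_addr_0 -[c *+ _]mulr_natr mulfK//.
by rewrite pnatr_eq0 -lt0n.
Qed.

Lemma cmeanB rs F F' : cmean rs (fun x => F x - F' x) = cmean rs F - cmean rs F'.
Proof. by rewrite /cmean sumrB mulrBl. Qed.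

Section one_circle.
Variables (n : nat) (rho L g e : R) (rs : seq C).
Hypotheses (n0 : (0 < n)%N) (rho0 : 0 < rho) (rhoL : rho <= L) (g0 : 0 < g)
  (e2 : e <= 2^-1) (hn : (1 - g / L) ^+ n <= e) (hrs : circle_pts n rho rs).

Local Notation u z := (cmean rs (fun x => x / (z - x))).

Let c0 : nm (ofR (rho ^+ n) : C) = rho ^+ n.
Proof. by rewrite nm_ofR ger0_norm// exprn_ge0// ltW. Qed.

Let uE z : z ^+ n != ofR (rho ^+ n) ->
  u z = ofR (rho ^+ n) / (z ^+ n - ofR (rho ^+ n)).
Proof.
move=> zn; case: hrs => srs _ /(_ z zn); rewrite /cmean => ->.
by rewrite srs mulrC mulKf// pnatr_eq0 -lt0n.
Qed.

Lemma cauchy_mean_out z : nm z <= L -> rho + g <= nm z -> nm (u z) <= 2 * e.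
Proof.
move=> zL zr; have z0 : z ^+ n != 0.
  by rewrite expf_neq0// -nm_gt0 (lt_le_trans _ zr)// addr_gt0.
have [|zn h] := small_quot z0 e2 (c := ofR (rho ^+ n)).
  by rewrite c0 nmX; apply: pow_gap hn => //; exact: ltW.
by rewrite uE.
Qed.

Lemma cauchy_mean_in z : nm z + g <= rho -> nm (u z + 1) <= 2 * e.
Proof.
move=> zr.
have z0 : ofR (rho ^+ n) != 0 :> C by rewrite -nm_gt0 c0 exprn_gt0.
have [|zn h] := small_quot z0 e2 (c := z ^+ n).
  by rewrite c0 nmX; apply: pow_gap hn => //; exact: nm_ge0.
rewrite uE 1?eq_sym//.
have zc : z ^+ n - ofR (rho ^+ n) != 0 by rewrite subr_eq0 eq_sym.
rewrite -[X in _ + X](divff zc) -mulrDl addrCA subrr addr0.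
by rewrite -nmN -mulrN -invrN opprB.
Qed.

(** On the circle the Poisson kernel is |z|^2 - rho^2 over |z - x|^2, and its mean is the real
    part of 1 + 2 u, where u is close to 0 or to -1. *)
Lemma poisson_mean z : nm z <= L -> g <= `|nm z - rho| ->
  rmean rs (fun x => nm (z - x) ^- 2) * (`|nm z - rho| * (nm z + rho)) <= 3.
Proof.
move=> zL zg; have [srs rsn _] := hrs.
have key : `|Re (1 + 2 * u z)| <= 3.
  have [h|h] := leP rho (nm z).
    have zg' : rho + g <= nm z.
      by move: zg; rewrite ger0_norm ?subr_ge0// lerBrDl.
    apply: le_trans (Re_le_nm _) _; apply: le_trans (ler_nmD _ _) _.
    rewrite nm1 nmM nm_nat; have := cauchy_mean_out zL zg'.
    by move: e2 (nm _) => e2' a; lra.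
  have zg' : nm z + g <= rho.
    by move: zg; rewrite ltr0_norm ?subr_lt0// opprB lerBrDl.
  apply: le_trans (Re_le_nm _) _.
  have -> : 1 + 2 * u z = 2 * (u z + 1) - 1 by rewrite mulrDr mulr1 -addrA [RHS]addrC; congr (_ + _); rewrite -(natrB _ (isT : 1 <= 2)%N).
  apply: le_trans (ler_nmB _ _) _.
  rewrite nm1 nmM nm_nat; have := cauchy_mean_in zg'.
  by move: e2 (nm _) => e2' a; lra.
have zx x : x \in rs -> z != x.
  move=> /rsn xr; apply: contraTneq zg => ->.
  by rewrite xr subrr normr0 -ltNge.
have s0 : (size rs)%:R != 0 :> C by rewrite pnatr_eq0 srs -lt0n.
have E : Re (1 + 2 * u z) =
    (nm z ^+ 2 - rho ^+ 2) * rmean rs (fun x => nm (z - x) ^- 2).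
  have -> : 1 + 2 * u z = (\sum_(x <- rs) (1 + 2 * (x / (z - x)))) * ofR ((size rs)%:R^-1).
    have -> : ofR ((size rs)%:R^-1) = (size rs)%:R^-1 :> C.
      by apply: (mulIf s0); rewrite mulVf// -ofR_nat -ofRM mulVf// pnatr_eq0 srs -lt0n.
    rewrite big_split -mulr_sumr /= big_const_seq count_predT iter_addr_0.
    by rewrite [RHS]mulrDl divff// -mulrA.
  rewrite mulrC ReZ -rmeanZ /rmean [LHS]mulrC; congr (_ / _).
  rewrite Re_sum.
  by apply: eq_big_seq => x xr; rewrite poisson_kernel ?zx// (rsn _ xr).
move: key; rewrite E normrM mulrC => key; apply: le_trans key.
rewrite subr_sqr [`|(_ - _) * _|]normrM [`|nm z + rho|]ger0_norm ?addr_ge0 ?nm_ge0 ?(ltW rho0)//.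
by rewrite ler_wpM2r ?mulr_ge0 ?addr_ge0 ?nm_ge0 ?(ltW rho0)// ler_norm.
Qed.

End one_circle.

End circle_bounds.

(** * Approximate indicators of discs *)

Lemma kernel_size_bound (R : realFieldType) (k D r : R) : 0 < r -> 0 <= D ->
  k <= 44 / r -> (3 * r <= D -> k <= D^-1 + 15 * r / D ^+ 2) -> k <= 176 / (r + D).
Proof.
move=> r0 D0 k1 k2; have [h|h] := leP (3 * r) D.
  apply: le_trans (k2 h) _; have D1 : 0 < D by lra.
  have h1 : 15 * r / D ^+ 2 <= 5 / D.
    rewrite expr2 invfM mulrA ler_pM2r ?invr_gt0// ler_pdivrMr//; lra.
  have h2 : D^-1 + 15 * r / D ^+ 2 <= 6 / D.
    apply: le_trans (lerD (lexx _) h1) _.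
    by rewrite -[X in X + _]mul1r -mulrDl ler_pM2r ?invr_gt0//; lra.
  apply: le_trans h2 _; rewrite ler_pdivrMr// mulrAC ler_pdivlMr; lra.
apply: le_trans k1 _; rewrite ler_pdivrMr// mulrAC ler_pdivlMr; lra.
Qed.

(** Trades the mean of 1/d for the mean of 1/d^2, which the Poisson kernel controls. *)
Lemma inv_amgm (R : realFieldType) (q d : R) : 0 < q -> 0 < d ->
  d^-1 <= 2^-1 * (q ^+ 2 * d ^- 2 + q ^- 2).
Proof.
move=> q0 d0; have := sqr_ge0 (q / d - q^-1).
have -> : (q / d - q^-1) ^+ 2 = q ^+ 2 * d ^- 2 + q ^- 2 - 2 * d^-1.
  by field; rewrite !gt_eqF.
by lra.
Qed.

Lemma mean_quot_bound (R : realFieldType) (A B D b d : R) : 0 < b -> 0 < d ->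
  b <= B -> d <= D -> 0 <= A -> A * (B * D) <= 3 -> A <= 3 / (b * d).
Proof.
move=> b0 d0 bB dD A0 h; rewrite ler_pdivlMr ?mulr_gt0//.
by apply: le_trans h; rewrite ler_wpM2l// ler_pM// ltW.
Qed.

Section modulus.
Context {R : realType}.
Notation C := (Cplx R).
Implicit Types (x y z w : C) (e r rho : R) (n : nat) (rs : seq C).
Variables (G : set C) (gam : R -> C) (M delta : R).
Hypothesis Ggam : jparam G gam.
Hypothesis (delta0 : 0 < delta).
Hypothesis GM : forall z, G z -> delta <= nm z <= M.
Hypothesis G0 : jordan_int G 0.
Local Notation rat := (ratapp G).

Let L := M + 1.

Lemma rmean_ge0 rs (F : C -> R) : (forall x, 0 <= F x) -> 0 <= rmean rs F.
Proof. by move=> F0; rewrite /rmean mulr_ge0 ?invr_ge0// sumr_ge0. Qed.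

Lemma bound_gt0 : 0 < M.
Proof.
have [_ _ Gg _ _] := Ggam.
by have /andP[/(lt_le_trans delta0)/lt_le_trans] := GM (Gg 0); apply.
Qed.

Let L0 : 0 < L. Proof. by rewrite addr_gt0// bound_gt0. Qed.

(** A point close to the circle is pushed off it by r, away from the circle, so that
    the Poisson bound applies. *)
Lemma radial_shift z rho r : 0 < r -> r <= nm z -> exists z',
  [/\ nm (z' - z) = r, r <= `|nm z' - rho|, nm z - r <= nm z' & nm z' <= nm z + r].
Proof.
move=> r0 rz; have nz : 0 < nm z by exact: lt_le_trans rz.
have key (s : R) : `|s| = 1 -> 0 <= s * (nm z - rho) -> exists z',
  [/\ nm (z' - z) = r, r <= `|nm z' - rho|, nm z - r <= nm z' & nm z' <= nm z + r].
  move=> s1 sr; exists (ofR (1 + s * r / nm z) * z).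
  have d : nm (ofR (1 + s * r / nm z) * z - z) = r.
    rewrite -[X in _ - X]mul1r -mulrBl -ofR1 -ofRN -ofRD addrAC subrr add0r.
    rewrite nmM nm_ofR !normrM s1 mul1r normfV [`|nm z|]gtr0_norm// divfK ?gt_eqF//.
    by rewrite gtr0_norm.
  have h1 := lerB_nm (ofR (1 + s * r / nm z) * z) z.
  have h2 := lerB_nm z (ofR (1 + s * r / nm z) * z).
  rewrite nm_sub d in h2; rewrite d in h1.
  split => //; last 2 first.
  - by rewrite lerBlDr -lerBlDl.
  - by rewrite -lerBlDl.
  have -> : nm (ofR (1 + s * r / nm z) * z) = `|nm z + s * r|.
    by rewrite nmM nm_ofR -[X in _ * X]gtr0_norm// -normrM mulrDl mul1r divfK ?gt_eqF.
  have sr0 : - r <= s * r.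
    have : `|s * r| = r by rewrite normrM s1 mul1r gtr0_norm.
    by have := ler_norm (- (s * r)); rewrite normrN; lra.
  rewrite [`|nm z + _|]ger0_norm; last by lra.
  have ss : s * s = 1 by rewrite -expr2 -real_normK ?num_real// s1 expr1n.
  have : s * (nm z + s * r - rho) = s * (nm z - rho) + r.
    by rewrite addrAC mulrDr mulrA ss mul1r.
  have := ler_norm (s * (nm z + s * r - rho)); rewrite normrM s1 mul1r.
  by move: sr; lra.
have [h|h] := leP rho (nm z).
  by apply: (key 1); rewrite ?normr1// mul1r subr_ge0.
by apply: (key (-1)); rewrite ?normrN1// mulN1r oppr_ge0 subr_le0 ltW.
Qed.

(** V is the mean of x K_x(z) over n points x of the circle, where K_x replaces
    1 / (z - x).  The scales are nested: kernels with r = q^4, an annulus of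
    half-width q^3, and an error of order q off it.  On the annulus |K_x(z)| is at
    most a multiple of 1 / |z' - x| for the shifted point z', and inv_amgm bounds the
    mean by a multiple of 1 / q^2. *)
Lemma disc_indicator_exists q rho : 0 < q -> q <= 3^-1 -> 4 * q <= delta -> 0 < rho <= L ->
  exists2 V : C -> C, rat V & forall z, G z -> [/\
    nm (V z) <= (88 * L * (6 / delta + 1)) / q ^+ 2,
    rho + q ^+ 3 <= nm z -> nm (V z) <= (2 + 45 * L / delta) * q &
    nm z + q ^+ 3 <= rho -> nm (V z + 1) <= (2 + 45 * L / delta) * q].
Proof.
move=> q0 q3 qd /andP[rho0 rhoL].
pose r := q ^+ 4.
have r0 : 0 < r by rewrite exprn_gt0.
have rq3 : r = q * q ^+ 3 by rewrite /r exprS.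
have q30 : 0 < q ^+ 3 by rewrite exprn_gt0.
have q31 : q ^+ 3 <= 1 by rewrite exprn_ile1 ?(ltW q0)//; lra.
have rq : r <= q by rewrite rq3 ler_piMr// ltW.
have r3 : 3 * r <= q ^+ 3.
  by rewrite rq3 mulrA ler_piMl ?(ltW q30)//; lra.
have rd : 4 * r <= delta by lra.
have /choice[K hK] : forall x, exists k, rat k /\ forall z, G z -> nm (k z) <= 44 / r /\
    (3 * r <= nm (z - x) -> nm (k z - (z - x)^-1) <= 15 * r / nm (z - x) ^+ 2).
  by move=> x; have [k ? ?] := cauchy_kernel Ggam delta0 GM G0 x r0 rd; exists k.
have rL : 0 < r / L < 1.
  rewrite divr_gt0//= ltr_pdivrMr// mul1r /L; have := bound_gt0; lra.
have [n n0 hn] : exists2 n, (0 < n)%N & (1 - r / L) ^+ n <= q.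
  have : (fun n => (1 - r / L) ^+ n) @ \oo --> (0 : R).
    by apply: cvg_expr; rewrite ger0_norm; lra.
  move=> /cvgrPdist_lt/(_ q q0)[n _ /(_ n.+1 (leqnSn n))] /=.
  rewrite sub0r normrN => h; exists n.+1 => //.
  exact: le_trans (ler_norm _) (ltW h).
have [rs hrs] := circle_pts_exist rho0 n0; have [srs rsn _] := hrs.
have q2 : q <= 2^-1 by lra.
exists (fun z => cmean rs (fun x => x * K x z)).
  rewrite /cmean; apply: (ratappM delta0 GM); last exact: ratapp_cst.
  apply: (ratapp_sum delta0 GM) => x; apply: (ratappM delta0 GM); first exact: ratapp_cst.
  by case: (hK x).
move=> z Gz; have /andP[dz zM] := GM Gz.
have rz0 : r <= nm z by lra.
have zL : nm z <= L by rewrite /L; lra.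
(* replacing 1 / (z - x) by the kernels costs the mean of r / |z - x|^2, of order
   r / q^3 = q *)
have far : q ^+ 3 <= `|nm z - rho| ->
    nm (cmean rs (fun x => x * K x z) - cmean rs (fun x => x / (z - x))) <= 45 * L / delta * q.
  move=> zr; rewrite -cmeanB; apply: le_trans (nm_cmean _ _) _.
  apply: (@le_trans _ _ (rmean rs (fun x => 15 * r * L * nm (z - x) ^- 2))).
    apply: ler_rmean => x xr; rewrite -mulrBr nmM rsn//.
    have [_ /(_ z Gz)[_ hk]] := hK x.
    have {}hk : nm (K x z - (z - x)^-1) <= 15 * r / nm (z - x) ^+ 2.
      apply: hk; apply: le_trans r3 (le_trans zr _).
      rewrite -(rsn _ xr) ler_norml lerB_nm andbT lerNl opprB.
      by rewrite nm_sub lerB_nm.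
    apply: le_trans (ler_pM (ltW rho0) (nm_ge0 _) rhoL hk) _.
    by rewrite mulrA [L * _]mulrC.
  rewrite rmeanZ.
  have rz : r <= `|nm z - rho| by lra.
  have zrd : delta <= nm z + rho by lra.
  have A0 : 0 <= rmean rs (fun x => nm (z - x) ^- 2).
    by apply: rmean_ge0 => x; rewrite invr_ge0 exprn_ge0// nm_ge0.
  have A := mean_quot_bound q30 delta0 zr zrd A0 (poisson_mean n0 rho0 rhoL r0 q2 hn hrs zL rz).
  apply: le_trans (ler_wpM2l _ A) _.
  - by rewrite !mulr_ge0// ltW.
  - rewrite rq3 le_eqVlt; apply/orP; left; apply/eqP; field.
    by rewrite !gt_eqF.
(* on the annulus the bound is only of order 1 / q^2 *)
have near : nm (cmean rs (fun x => x * K x z)) <= 88 * L * (6 / delta + 1) / q ^+ 2.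
  have [z' [z1 z2 z3 z4]] := radial_shift rho r0 rz0.
  have z'L : nm z' <= L by rewrite /L; lra.
  have z'd : delta / 2 <= nm z' + rho by lra.
  have d20 : 0 < delta / 2 by rewrite divr_gt0.
  apply: le_trans (nm_cmean _ _) _.
  apply: (@le_trans _ _ (rmean rs (fun x => 88 * L * (q ^+ 2 * nm (z' - x) ^- 2 + q ^- 2)))).
    apply: ler_rmean => x xr; rewrite nmM rsn//.
    have [_ /(_ z Gz)[hk1 hk2]] := hK x.
    have hk : nm (K x z) <= 176 / (r + nm (z - x)).
      apply: kernel_size_bound => //; first exact: nm_ge0.
      move=> /hk2 h; rewrite -[K x z](subrK (z - x)^-1) addrC.
      by apply: le_trans (ler_nmD _ _) _; rewrite nmV lerD2l.
    have d'0 : 0 < nm (z' - x).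
      have := lerB_nm z' x; have := lerB_nm x z'; rewrite nm_sub (rsn _ xr) => u1 u2.
      by apply: lt_le_trans r0 (le_trans z2 _); rewrite ler_norml u2 andbT lerNl opprB.
    have d'D : nm (z' - x) <= r + nm (z - x) by rewrite -z1; exact: ler_nm_dist.
    have h : 176 / (r + nm (z - x)) <= 176 * (2^-1 * (q ^+ 2 * nm (z' - x) ^- 2 + q ^- 2)).
      rewrite ler_pM2l//; apply: le_trans (inv_amgm q0 d'0).
      by rewrite lef_pV2 ?posrE// (lt_le_trans d'0).
    apply: le_trans (ler_pM (ltW rho0) (nm_ge0 _) rhoL (le_trans hk h)) _.
    by move: (q ^+ 2 * _ + _) => u; lra.
  rewrite rmeanZ rmeanD rmeanZ rmean_cst ?srs//.
  have A0 : 0 <= rmean rs (fun x => nm (z' - x) ^- 2).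
    by apply: rmean_ge0 => x; rewrite invr_ge0 exprn_ge0// nm_ge0.
  have A := mean_quot_bound r0 d20 z2 z'd A0 (poisson_mean n0 rho0 rhoL r0 q2 hn hrs z'L z2).
  rewrite -[leRHS]mulrA ler_pM2l ?mulr_gt0// mulrDl mul1r lerD2r.
  apply: le_trans (ler_wpM2l (exprn_ge0 2 (ltW q0)) A) _.
  rewrite le_eqVlt; apply/orP; left; apply/eqP; rewrite /r; field.
  by rewrite !gt_eqF.
pose V := cmean rs (fun x => x * K x z).
pose u := cmean rs (fun x => x / (z - x)).
split => // [zr|zr].
- have zr' : q ^+ 3 <= `|nm z - rho| by rewrite ger0_norm ?subr_ge0 ?lerBrDl//; lra.
  have h1 : nm u <= 2 * q.
    by apply: (cauchy_mean_out n0 rho0 r0 q2 hn hrs) => //; lra.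
  rewrite mulrDl -/V -[V](subrK u) addrC; apply: le_trans (ler_nmD _ _) _.
  exact: lerD h1 (far zr').
- have zr' : q ^+ 3 <= `|nm z - rho|.
    by rewrite distrC ger0_norm ?subr_ge0 ?lerBrDl//; lra.
  have h1 : nm (u + 1) <= 2 * q.
    by apply: (cauchy_mean_in n0 rho0 rhoL r0 q2 hn hrs) => //; lra.
  rewrite mulrDl -/V -[V](subrK u) -addrA addrC; apply: le_trans (ler_nmD _ _) _.
  exact: lerD h1 (far zr').
Qed.

End modulus.

(** * The modulus is a limit of Laurent polynomials *)

Section staircase.
Context {R : realType}.
Notation C := (Cplx R).
Implicit Types (a s h t : R).

(** Its increment over a step is the length of the part of the step beyond a. *)
Definition ramp a t : R := Num.max 0 (t - a).
(** The ramp truncated to a neighbourhood of a; its increments telescope, which bounds the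
    total length of the steps whose circle passes close to a given point. *)
Definition window a s h t : R := Num.max (- (s + h)) (Num.min s (t - a)).

Lemma ramp_incr a t h : 0 <= h -> 0 <= ramp a t - ramp a (t - h) <= h.
Proof. by rewrite /ramp => h0; case: (leP 0 (t - a)) => ?; case: (leP 0 (t - h - a)) => ?; apply/andP; split; lra. Qed.

Lemma window_incr a s h t : 0 < h -> 0 < s -> 0 <= window a s h t - window a s h (t - h).
Proof.
rewrite /window => h0 s0.
case: (leP s (t - a)) => ?; case: (leP s (t - h - a)) => ?.
all: do 2?[match goal with |- context [Num.max ?x ?y] => case: (leP x y) => ? end].
all: lra.
Qed.

Lemma window_near a s h t : 0 < h -> a - s < t -> t < a + s ->
  window a s h t - window a s h (t - h) = h.
Proof.
rewrite /window => h0 s0 s1.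
case: (leP s (t - a)) => ?; case: (leP s (t - h - a)) => ?.
all: do 2?[match goal with |- context [Num.max ?x ?y] => case: (leP x y) => ? end].
all: lra.
Qed.

Lemma window_le a s h t : 0 < h -> 0 < s -> window a s h t <= s.
Proof.
by move=> h0 s0; rewrite ge_max ge_min lexx /= andbT; lra.
Qed.

Lemma window_ge a s h t : - (s + h) <= window a s h t.
Proof. by rewrite le_max lexx. Qed.

(** One step of the staircase in the radius t, at a point of modulus a.  Off the window the
    error is h k2; in the window it is at most (k1 + 1) h, and there h is the
    increment of the window. *)
Lemma staircase_step (V : C) a s h t k1 k2 : 0 < h -> h <= s -> 0 <= k1 -> 0 <= k2 ->
  nm V <= k1 -> (t + s <= a -> nm V <= k2) -> (a + s <= t -> nm (V + 1) <= k2) ->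
  nm (ofR h * V + ofR (ramp a t - ramp a (t - h))) <=
  h * k2 + (k1 + 1) * (window a s h t - window a s h (t - h)).
Proof.
move=> h0 hs k10 k20 V1 V2 V3.
have w0 : 0 <= window a s h t - window a s h (t - h).
  by apply: window_incr => //; exact: lt_le_trans hs.
have nh : nm (ofR h : C) = h by rewrite nm_ofR gtr0_norm.
have kw : 0 <= (k1 + 1) * (window a s h t - window a s h (t - h)).
  by rewrite mulr_ge0// addr_ge0.
have [c1|c1] := leP (t + s) a.
  have -> : ramp a t - ramp a (t - h) = 0.
    by rewrite /ramp; case: (leP 0 (t - a)) => ?; case: (leP 0 (t - h - a)) => ?; lra.
  rewrite ofR0 addr0 nmM nh.
  have : h * nm V <= h * k2 by rewrite ler_pM2l// V2.
  by move: kw; lra.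
have [c2|c2] := leP (a + s) t.
  have -> : ramp a t - ramp a (t - h) = h.
    by rewrite /ramp; case: (leP 0 (t - a)) => ?; case: (leP 0 (t - h - a)) => ?; lra.
  rewrite -[X in _ + X]mulr1 -mulrDr nmM nh.
  have : h * nm (V + 1) <= h * k2 by rewrite ler_pM2l// V3.
  by move: kw; lra.
rewrite window_near//; last by lra.
have /andP[r0 r1] := ramp_incr a t (ltW h0).
apply: le_trans (ler_nmD _ _) _; rewrite nmM nh nm_ofR ger0_norm//.
have : h * nm V <= h * k1 by rewrite ler_pM2l.
have : 0 <= h * k2 by rewrite mulr_ge0// ltW.
by lra.
Qed.

End staircase.

Lemma ofR_sum (R : realType) (I : Type) (s : seq I) (F : I -> R) :
  ofR (\sum_(i <- s) F i) = \sum_(i <- s) ofR (F i).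
Proof. by elim: s => [|i s IH]; rewrite ?big_nil// !big_cons ofRD IH. Qed.

Section modulus.
Context {R : realType}.
Notation C := (Cplx R).
Implicit Types (x y z w : C) (e r rho : R) (n : nat) (rs : seq C).
Variables (G : set C) (gam : R -> C) (M delta : R).
Hypothesis Ggam : jparam G gam.
Hypothesis (delta0 : 0 < delta).
Hypothesis GM : forall z, G z -> delta <= nm z <= M.
Hypothesis G0 : jordan_int G 0.
Local Notation rat := (ratapp G).

(** The sum over radii t_j = j h of h V_j approximates minus the total increment of the ramp
    at |z|, that is |z| - L.  The annuli hit by |z| have total length at most 3 q^3 and
    carry an error of order 1 / q^2. *)
Lemma modulus_approx q : 0 < q -> q <= 3^-1 -> 4 * q <= delta ->
  exists2 V : C -> C, rat V & forall z, G z ->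
  nm (ofR (nm z) - V z) <= ((M + 1) * (2 + 45 * (M + 1) / delta)
    + 3 * (88 * (M + 1) * (6 / delta + 1)) + 3) * q.
Proof.
move=> q0 q3 qd; set L := M + 1.
have M0 : 0 < M := bound_gt0 Ggam delta0 GM.
have L0 : 0 < L by rewrite /L; lra.
have q30 : 0 < q ^+ 3 by rewrite exprn_gt0.
set K1 := 88 * L * (6 / delta + 1); set K2 := 2 + 45 * L / delta.
have d6 : 0 <= 6 / delta by rewrite divr_ge0// ltW.
have K10 : 0 <= K1 by apply: mulr_ge0; [apply: mulr_ge0 => //; exact: ltW|exact: addr_ge0].
have K20 : 0 <= K2.
  by apply: addr_ge0 => //; apply: divr_ge0; [apply: mulr_ge0 => //|]; exact: ltW.
(* the step h is at most the half-width q^3 of the annuli *)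
pose J := (Num.bound (L / q ^+ 3)).+1.
have J0 : 0 < J%:R :> R by rewrite ltr0n.
pose h := L / J%:R.
have h0 : 0 < h by rewrite divr_gt0.
have hq : h <= q ^+ 3.
  rewrite /h ler_pdivrMr// mulrC -ler_pdivrMr//.
  have b : 0 <= L / q ^+ 3 by rewrite divr_ge0// ltW.
  by apply: le_trans (ltW (archi_boundP b)) _; rewrite ler_nat.
have /choice[V hV] : forall j : nat, exists V : C -> C, rat V /\ ((j < J)%N ->
  forall z, G z -> [/\ nm (V z) <= K1 / q ^+ 2,
    j.+1%:R * h + q ^+ 3 <= nm z -> nm (V z) <= K2 * q &
    nm z + q ^+ 3 <= j.+1%:R * h -> nm (V z + 1) <= K2 * q]).
  move=> j; have [jJ|_] := ltnP j J; last by exists (fun=> 0); split => //; exact: ratapp_cst.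
  have rj : 0 < j.+1%:R * h <= L.
    apply/andP; split; first by rewrite mulr_gt0.
    by rewrite /h mulrCA ler_piMr ?(ltW L0)// ler_pdivrMr// mul1r ler_nat.
  by have [W rW hW] := disc_indicator_exists Ggam delta0 GM G0 q0 q3 qd rj; exists W.
pose S z := \sum_(0 <= j < J) ofR h * V j z.
exists (fun z => ofR L + S z).
  apply: (ratappD delta0 GM); first exact: ratapp_cst.
  apply: (ratapp_sum delta0 GM) => j; apply: (ratappM delta0 GM); first exact: ratapp_cst.
  by case: (hV j).
move=> z Gz; set a := nm z.
have tel (f : R -> R) : \sum_(0 <= j < J) (f (j.+1%:R * h) - f (j%:R * h)) = f L - f 0.
  rewrite (telescope_sumr (fun j => f (j%:R * h)))// mul0r; congr (f _ - _).
  by rewrite /h mulrC divfK// gt_eqF.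
have aM : a <= M by have /andP[] := GM Gz.
have a0 : 0 <= a by exact: nm_ge0.
have rampE : L - a = \sum_(0 <= j < J) (ramp a (j.+1%:R * h) - ramp a (j%:R * h)).
  rewrite tel /ramp; case: (leP 0 (L - a)) => ?; case: (leP 0 (0 - a)) => ?; have LE : L = M + 1 by []; lra.
have -> : nm (ofR a - (ofR L + S z)) = nm (S z + ofR (L - a)).
  by rewrite -nmN opprB ofRD ofRN addrAC addrC addrA.
rewrite rampE ofR_sum /S -big_split /=.
apply: le_trans (ler_nm_sum _ _ _) _.
pose w := window a (q ^+ 3) h.
apply: (@le_trans _ _ (\sum_(0 <= j < J)
    (h * (K2 * q) + (K1 / q ^+ 2 + 1) * (w (j.+1%:R * h) - w (j%:R * h))))).
  rewrite !big_nat; apply: ler_sum => j /andP[_ jJ].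
  have jh : j%:R * h = j.+1%:R * h - h by rewrite -natr1 mulrDl mul1r addrK.
  have [_ /(_ jJ z Gz)[v1 v2 v3]] := hV j.
  rewrite jh; apply: staircase_step => //.
  - by rewrite divr_ge0// exprn_ge0// ltW.
  - by rewrite mulr_ge0// ltW.
rewrite big_split /= sumr_const_nat subn0 -mulr_sumr (tel w) -[_ *+ J]mulr_natr.
have Jh : h * J%:R = L by rewrite /h divfK// gt_eqF.
rewrite mulrAC Jh.
have wb : w L - w 0 <= 3 * q ^+ 3.
  have := window_le a (L) h0 q30; have := window_ge a (q ^+ 3) h 0; rewrite -/w; lra.
have kw : (K1 / q ^+ 2 + 1) * (w L - w 0) <= (K1 / q ^+ 2 + 1) * (3 * q ^+ 3).
  by rewrite ler_wpM2l// addr_ge0// divr_ge0// exprn_ge0// ltW.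
apply: le_trans (lerD (lexx _) kw) _.
have -> : (K1 / q ^+ 2 + 1) * (3 * q ^+ 3) = 3 * K1 * q + 3 * q ^+ 3.
  by field; rewrite gt_eqF.
have : q ^+ 3 <= q by rewrite exprS ler_piMr ?(ltW q0)// exprn_ile1 ?(ltW q0)//; lra.
by move: (q ^+ 3) => u uq; rewrite mulrA; lra.
Qed.

Lemma modulus_ratapp : rat (fun z => ofR (nm z)).
Proof.
apply: ratapp_lim => e e0.
set K := (M + 1) * (2 + 45 * (M + 1) / delta)
    + 3 * (88 * (M + 1) * (6 / delta + 1)) + 3.
have M0 : 0 < M := bound_gt0 Ggam delta0 GM.
have K0 : 0 < K.
  by rewrite /K !addr_gt0 ?mulr_gt0 ?addr_gt0 ?divr_gt0 ?mulr_gt0 ?addr_gt0.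
pose q := Num.min 3^-1 (Num.min (delta / 4) (e / (2 * K))).
have q0 : 0 < q by rewrite !lt_min invr_gt0 ltr0n /= !divr_gt0// mulr_gt0.
have q3 : q <= 3^-1 by rewrite ge_min lexx.
have qd : 4 * q <= delta.
  by rewrite mulrC -ler_pdivlMr// !ge_min lexx !orbT.
have qe : K * q < e.
  have : q <= e / (2 * K) by rewrite !ge_min lexx !orbT.
  rewrite ler_pdivlMr ?mulr_gt0//; lra.
have [V rV hV] := modulus_approx q0 q3 qd.
by exists V => // z Gz; exact: le_lt_trans (hV _ Gz) qe.
Qed.

(** conj z = |z|^2 / z. *)
Lemma conj_ratapp : rat (fun z => z^*).
Proof.
have rm := modulus_ratapp.
apply: ratapp_ext (ratappM delta0 GM (ratappM delta0 GM rm rm) (ratapp_inv G)) => z Gz.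
have z0 := annulus_neq0 delta0 GM Gz.
by rewrite -ofRM -expr2 -mul_conj mulrAC divff// mul1r.
Qed.

Lemma Re_ratapp : rat (fun z => ofR (Re z)).
Proof.
apply: ratapp_ext (ratappM delta0 GM (ratapp_cst G 2^-1)
  (ratappD delta0 GM (ratapp_id G) conj_ratapp)) => z _.
apply: (mulfI (_ : (2 : C) != 0)); first by rewrite pnatr_eq0.
rewrite mulrA divff ?pnatr_eq0// mul1r -[2]ofR_nat; apply: CE.
  by rewrite ReZ ReD Rec_conj /=; ring.
by rewrite ImZ ImD Imc_conj /= subrr mulr0.
Qed.

Lemma Im_ratapp : rat (fun z => ofR (Im z)).
Proof.
pose ii : C := Complex 0 1.
apply: ratapp_ext (ratappM delta0 GM (ratapp_cst G (- ii))
  (ratappB delta0 GM (ratapp_id G) Re_ratapp)) => z _.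
by apply: CE; rewrite ?RecM ?ImcM ?ReN ?ImN ?ReB ?ImB /=; ring.
Qed.

End modulus.

(** * Borel functions on the plane *)

Section measC.
Context {R : realType}.
Notation C := (Cplx R).
Notation B := (borelC R).
Implicit Types (x y z w : C) (f g : C -> C) (p q : {poly C}).

Lemma open_measC (U : set C) : open U -> measurable (U : set B).
Proof. by move=> oU; exact: sub_sigma_algebra. Qed.

(** Boxes with rational corners, enumerated by nat so that the empty set stands for
    numbers that code nothing. *)
Definition box (n : nat) : set C :=
  if @unpickle (rat * rat * rat * rat)%type n is Some (a, b, c, d) then
    [set z | ratr a <= Re z < ratr b /\ ratr c <= Im z < ratr d]
  else set0.

Lemma open_bigcup_box (U : set C) : open U ->
  U = \bigcup_(n in [set n | box n `<=` U]) box n.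
Proof.
move=> /openCP oU; apply/seteqP; split=> [z Uz|z [n /= nU /nU]//].
have [e e0 he] := oU _ Uz.
have lt1 (x : R) : x - e / 2 < x by rewrite ltrBlDr ltrDl divr_gt0.
have lt2 (x : R) : x < x + e / 2 by rewrite ltrDl divr_gt0.
have [a] := rat_in_itvoo (lt1 (Re z)); rewrite in_itv /= => /andP[a1 a2].
have [b] := rat_in_itvoo (lt2 (Re z)); rewrite in_itv /= => /andP[b1 b2].
have [c] := rat_in_itvoo (lt1 (Im z)); rewrite in_itv /= => /andP[c1 c2].
have [d] := rat_in_itvoo (lt2 (Im z)); rewrite in_itv /= => /andP[d1 d2].
exists (pickle (a, b, c, d)); rewrite /= /box pickleK.
  move=> w /= [/andP[w1 w2] /andP[w3 w4]]; apply: he.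
  apply: le_lt_trans (nm_le_ReIm _) _; rewrite (splitr e) ReB ImB ltrD//.
    by rewrite ltr_norml; apply/andP; split; lra.
  by rewrite ltr_norml; apply/andP; split; lra.
by split; apply/andP; split => //; exact: ltW.
Qed.

Lemma measurable_continuous (f : C -> R) : continuous f ->
  measurable_fun setT (f : B -> R).
Proof.
move=> cf; apply: (measurability _ (RGenOInfty.measurableE R)).
move=> _ [_ [x ->] <-]; rewrite setTI; apply: open_measC.
by apply: open_comp; [move=> z _; exact: cf|exact: rray_open].
Qed.

Lemma measurable_Re : measurable_fun setT (@Re R : B -> R).
Proof. by apply: measurable_continuous; exact: continuous_Re. Qed.

Lemma measurable_Im : measurable_fun setT (@Im R : B -> R).
Proof. by apply: measurable_continuous; exact: continuous_Im. Qed.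

Lemma measurable_nm : measurable_fun setT (@nm R : B -> R).
Proof. by apply: measurable_continuous; exact: continuous_nm. Qed.

Lemma measurable_box (f : B -> B) : measurable_fun setT (fun z : B => Re (f z)) ->
  measurable_fun setT (fun z : B => Im (f z)) ->
  forall n, measurable (f @^-1` box n).
Proof.
move=> mr mi n; rewrite /box; case: unpickle => [[[[a b] c] d]|]; last first.
  by rewrite preimage_set0; exact: measurable0.
rewrite (_ : _ @^-1` _ = ((fun z : B => Re (f z)) @^-1` `[ratr a, ratr b[) `&`
                 ((fun z : B => Im (f z)) @^-1` `[ratr c, ratr d[)).
  apply: measurableI.
    by rewrite -[X in measurable X]setTI; apply: mr => //; exact: measurable_itv.
  by rewrite -[X in measurable X]setTI; apply: mi => //; exact: measurable_itv.
by apply/seteqP; split=> z /=; rewrite !in_itv.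
Qed.

Definition measC f := measurable_fun setT (f : B -> B).

Lemma measCP f : measC f <-> measurable_fun setT (fun z : B => Re (f z)) /\
  measurable_fun setT (fun z : B => Im (f z)).
Proof.
split=> [mf|[mr mi]].
  split; first exact: (measurableT_comp measurable_Re mf).
  exact: (measurableT_comp measurable_Im mf).
suff : forall U : set C, open U -> measurable ((f : B -> B) @^-1` U).
  move=> h _ Y mY; rewrite setTI.
  apply: (smallest_sub (C := sigma_algebra setT) (X := [set Y | measurable ((f : B -> B) @^-1` Y)])) mY => //.
  split.
  - by rewrite /= preimage_set0; exact: measurable0.
  - move=> A mA /=; rewrite (_ : _ @^-1` _ = ~` ((f : B -> B) @^-1` A)).
      by exact: (@measurableC _ B _ mA).
    by apply/seteqP; split=> [x []//|x nh]; split.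
  - by move=> F mF; rewrite /= preimage_bigcup; apply: (@bigcup_measurable _ B) => k _; exact: mF.
move=> U oU; rewrite (open_bigcup_box oU) preimage_bigcup.
by apply: (@bigcup_measurable _ B) => n _; exact: measurable_box.
Qed.

Lemma measC_nm f : measC f -> measurable_fun setT (fun z : B => nm (f z)).
Proof. by move=> mf; exact: (measurableT_comp measurable_nm mf). Qed.

Lemma measC_Complex (u v : B -> R) : measurable_fun setT u -> measurable_fun setT v ->
  measC (fun z => Complex (u z) (v z)).
Proof. by move=> mu mv; apply/measCP. Qed.

Lemma measC_ofR (u : B -> R) : measurable_fun setT u -> measC (fun z => ofR (u z)).
Proof. by move=> mu; apply: measC_Complex => //; exact: measurable_cst. Qed.

Lemma measC_cst (c : C) : measC (fun=> c).
Proof. exact: measurable_cst. Qed.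

Lemma measC_id : measC id.
Proof. exact: measurable_id. Qed.

Lemma measCD f g : measC f -> measC g -> measC (fun z => f z + g z).
Proof.
move=> /measCP[f1 f2] /measCP[g1 g2]; apply/measCP; split.
  under eq_fun do rewrite ReD; exact: measurable_funD.
under eq_fun do rewrite ImD; exact: measurable_funD.
Qed.

Lemma measCM f g : measC f -> measC g -> measC (fun z => f z * g z).
Proof.
move=> /measCP[f1 f2] /measCP[g1 g2]; apply/measCP; split.
  under eq_fun do rewrite RecM.
  by apply: measurable_funB; exact: measurable_funM.
under eq_fun do rewrite ImcM.
by apply: measurable_funD; exact: measurable_funM.
Qed.

Lemma measCB f g : measC f -> measC g -> measC (fun z => f z - g z).
Proof.
move=> mf mg; under eq_fun do rewrite -[- g _]mulN1r.
by apply: measCD => //; apply: measCM => //; exact: measC_cst.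
Qed.

Lemma measCX f n : measC f -> measC (fun z => f z ^+ n).
Proof.
move=> mf; elim: n => [|n IH]; first exact: measC_cst.
by under eq_fun do rewrite exprS; exact: measCM.
Qed.

Lemma measC_conj f : measC f -> measC (fun z => (f z)^*).
Proof.
move=> /measCP[f1 f2]; apply/measCP; split.
  by under eq_fun do rewrite Rec_conj.
under eq_fun do rewrite Imc_conj -mulN1r; apply: measurable_funM => //.
Qed.

Lemma measC_poly p : measC (horner p).
Proof.
elim/poly_ind: p => [|p c IH].
  have -> : horner (0 : {poly C}) = fun=> 0 by apply/funext => z; rewrite horner0.
  exact: measC_cst.
have -> : horner (p * 'X + c%:P) = fun z => p.[z] * z + c.
  by apply/funext => z; rewrite hornerMXaddC.
apply: measCD; last exact: measC_cst.
by apply: measCM => //; exact: measC_id.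
Qed.

End measC.

(** * Square integrals over the curve *)

Lemma twice_sum_lt (R : realType) (x y : \bar R) (e : R) : (0 <= x)%E -> (0 <= y)%E ->
  (x < (e / 4)%:E)%E -> (y < (e / 4)%:E)%E -> (2%:E * (x + y) < e%:E)%E.
Proof.
move=> x0 y0 hx hy.
have xf : x \is a fin_num by rewrite ge0_fin_numE// (lt_trans hx)// ltry.
have yf : y \is a fin_num by rewrite ge0_fin_numE// (lt_trans hy)// ltry.
move: hx hy; rewrite -(fineK xf) -(fineK yf) -EFinD -EFinM !lte_fin; lra.
Qed.

Section sqG.
Context {R : realType}.
Notation C := (Cplx R).
Notation B := (borelC R).
Implicit Types (x y z w : C) (f g h m : C -> C) (p q : {poly C}).
Variable mu : {finite_measure set (borelC R) -> \bar R}.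

Lemma measurable_boxC n : measurable (@box R n : set B).
Proof.
by apply: (@measurable_box R id); [exact: measurable_Re|exact: measurable_Im].
Qed.

(** The complement of G is covered by null open sets; as rational boxes form a countable
    base, countably many null sets suffice. *)
Lemma support_compl_null (G : set C) : closed G -> measure_support mu `<=` G ->
  mu (~` G) = 0%E.
Proof.
move=> clG sG.
have mG : measurable (~` G : set B) by apply: open_measC; exact: closed_openC.
apply/(negligibleP mu mG).
pose F n : set B := if mu (@box R n) == 0%E then @box R n else set0.
have mF n : measurable (F n).
  by rewrite /F; case: ifP => _; [exact: measurable_boxC|exact: measurable0].
apply: (@negligibleS _ _ _ _ (\bigcup_n F n)); last first.
  apply: negligible_bigcup => n; apply/negligibleP => //.
  by rewrite /F; case: ifPn => [/eqP//|_]; rewrite measure0.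
move=> z Gz; have : ~ measure_support mu z by move/sG.
move=> /existsNP[U /not_implyP[oU /not_implyP[Uz muU]]].
have mU : measurable (U : set B) by exact: open_measC.
have muU0 : mu U = 0%E.
  by apply/eqP; rewrite eq_le measure_ge0 andbT leNgt; apply/negP.
move: (Uz); rewrite (open_bigcup_box oU) => -[n nU nz].
exists n => //; rewrite /F ifT//; apply/eqP/eqP; rewrite eq_le measure_ge0 andbT.
by rewrite -muU0; apply: le_measure; rewrite ?inE//; exact: measurable_boxC.
Qed.

Variable G : set C.
Hypothesis mG : measurable (G : set B).
Hypothesis muG : mu (~` G) = 0%E.

(** Integrated over G rather than the plane, so that pointwise bounds are needed on G
    only. *)
Definition sqG f : \bar R := (\int[mu]_(z in G) ((nm (f z)) ^+ 2)%:E)%E.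

Lemma measurable_sq f (D : set B) : measC f ->
  measurable_fun D (fun z : B => ((nm (f z)) ^+ 2)%:E).
Proof.
move=> mf; apply/measurable_EFinP; apply: measurable_funTS.
by apply: measurable_funX; exact: measC_nm.
Qed.

Lemma sqG_ge0 f : (0 <= sqG f)%E.
Proof. by apply: integral_ge0 => z _; rewrite lee_fin sqr_ge0. Qed.

Lemma sqG_setT f : measC f -> sqG f = (\int[mu]_z ((nm (f z)) ^+ 2)%:E)%E.
Proof.
move=> mf; rewrite [RHS](@ge0_negligible_integral _ B _ mu setT (~` G : set B))//.
- by rewrite setDE setCK setTI.
- exact: measurableC.
- exact: measurable_sq.
- by move=> z _; rewrite lee_fin sqr_ge0.
Qed.

Lemma sqG_L2norm f : measC f -> (L2norm mu f `^ 2 = sqG f)%E.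
Proof.
move=> mf; rewrite /L2norm poweR_Lnorm// sqG_setT//.
apply: eq_integral => z _; rewrite /= -/(nm (f z)).
by rewrite ger0_norm ?nm_ge0// powR_mulrn ?nm_ge0.
Qed.

Lemma L2norm_ge0 f : (0 <= L2norm mu f)%E.
Proof. exact: Lnorm_ge0. Qed.

Lemma L2norm_lty f : measC f -> (L2norm mu f < +oo <-> sqG f < +oo)%E.
Proof.
move=> mf; rewrite -sqG_L2norm//; have := L2norm_ge0 f.
case: (L2norm mu f) => [r r0| _|//]; first by rewrite poweR_EFin !ltry.
by rewrite poweRyr.
Qed.

Lemma L2norm_lt f (e : R) : measC f -> 0 < e ->
  (L2norm mu f < e%:E <-> sqG f < (e ^+ 2)%:E)%E.
Proof.
move=> mf e0; rewrite -sqG_L2norm//; have := L2norm_ge0 f.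
case: (L2norm mu f) => [r r0| _|//].
  rewrite poweR_EFin powR_mulrn// !lte_fin ltr_pXn2r// ?nnegrE// ltW//.
by rewrite poweRyr.
Qed.

Lemma sqG_le f g (c : R) : measC f -> measC g -> 0 <= c ->
  (forall z, G z -> nm (f z) <= c * nm (g z)) ->
  (sqG f <= (c ^+ 2)%:E * sqG g)%E.
Proof.
move=> mf mg c0 fg; rewrite /sqG -ge0_integralZl_EFin//.
- apply: ge0_le_integral => //.
  + by move=> z _; rewrite lee_fin sqr_ge0.
  + exact: measurable_sq.
  + apply/measurable_EFinP; apply: measurable_funTS; apply: measurable_funM => //.
    by apply: measurable_funX; exact: measC_nm.
  + move=> z Gz; rewrite -EFinM lee_fin -exprMn lerXn2r ?nnegrE ?nm_ge0 ?mulr_ge0 ?nm_ge0//.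
    exact: fg.
- by move=> z _; rewrite lee_fin sqr_ge0.
- exact: measurable_sq.
- exact: sqr_ge0.
Qed.

Lemma sqG_le1 f g : measC f -> measC g ->
  (forall z, G z -> nm (f z) <= nm (g z)) -> (sqG f <= sqG g)%E.
Proof.
move=> mf mg fg; have := @sqG_le f g 1 mf mg ler01.
by rewrite expr1n mul1e; apply => z Gz; rewrite mul1r fg.
Qed.

Lemma sqG_add f g : measC f -> measC g ->
  (sqG (fun z => f z + g z)%R <= 2%:E * (sqG f + sqG g))%E.
Proof.
move=> mf mg; rewrite /sqG -ge0_integralD//; last 4 first.
- by move=> z _; rewrite lee_fin sqr_ge0.
- exact: measurable_sq.
- by move=> z _; rewrite lee_fin sqr_ge0.
- exact: measurable_sq.
rewrite -ge0_integralZl_EFin//.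
- apply: ge0_le_integral => //.
  + by move=> z _; rewrite lee_fin sqr_ge0.
  + by apply: measurable_sq; exact: measCD.
  + apply/measurable_EFinP; apply: measurable_funTS; apply: measurable_funM => //.
    by apply: measurable_funD; apply: measurable_funX; exact: measC_nm.
  + move=> z Gz; rewrite -EFinD -EFinM lee_fin.
    apply: (@le_trans _ _ ((nm (f z) + nm (g z)) ^+ 2)).
      by rewrite lerXn2r ?nnegrE ?addr_ge0 ?nm_ge0// ler_nmD.
    by have := sqr_ge0 (nm (f z) - nm (g z)); rewrite sqrrB sqrrD; lra.
- by move=> z _; rewrite -EFinD lee_fin addr_ge0 ?sqr_ge0.
- apply/measurable_EFinP; apply: measurable_funTS.
  by apply: measurable_funD; apply: measurable_funX; exact: measC_nm.
Qed.

Lemma sqG_bounded f (K : R) : measC f -> 0 <= K -> (forall z, G z -> nm (f z) <= K) ->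
  (sqG f < +oo)%E.
Proof.
move=> mf K0 fK; apply: (@le_lt_trans _ _ ((K ^+ 2)%:E * sqG (fun=> 1%R))%E).
  apply: sqG_le => //; first exact: measC_cst.
  by move=> z Gz; rewrite nm1 mulr1 fK.
rewrite /sqG; under eq_integral do rewrite nm1 expr1n.
rewrite integral_cst// mul1e.
have muf : mu G \is a fin_num by exact: fin_num_measure.
by rewrite lte_mul_pinfty ?lee_fin ?sqr_ge0// -ge0_fin_numE.
Qed.

Lemma sqG_dct (f_ : nat -> C -> C) f g : (forall n, measC (f_ n)) -> measC f -> measC g ->
  (sqG g < +oo)%E ->
  (forall n z, G z -> nm (f_ n z - f z) <= nm (g z)) ->
  (forall z, G z -> (fun n => nm (f_ n z - f z)) @ \oo --> (0 : R)) ->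
  forall e : R, 0 < e -> exists n, (sqG (fun z => f_ n z - f z)%R < e%:E)%E.
Proof.
move=> mf_ mf mg gy fg cf e e0.
have mF n : measurable_fun (G : set B) (fun z : B => (nm (f_ n z - f z) ^+ 2)%:E).
  by apply: measurable_sq; exact: measCB.
have [] := @dominated_convergence _ B R mu G mG
  (fun n z => (nm (f_ n z - f z) ^+ 2)%:E) (cst 0%E) (fun z => (nm (g z) ^+ 2)%:E) mF.
- exact: measurable_cst.
- apply: aeW => z Gz; rewrite -[0%E]/(0%:E).
  apply/cvg_EFin; first by apply: nearW.
  have h := cvgM (cf z Gz) (cf z Gz); rewrite mulr0 in h.
  rewrite (_ : fine \o _ = (fun n => nm (f_ n z - f z)) \* (fun n => nm (f_ n z - f z))).
    exact: h.
  by apply/funext => n; rewrite /= expr2.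
- apply/integrableP; split; first exact: measurable_sq.
  under eq_integral do rewrite gee0_abs ?lee_fin ?sqr_ge0//.
  exact: gy.
- apply: aeW => z n Gz; rewrite gee0_abs ?lee_fin ?sqr_ge0//.
  by rewrite lerXn2r ?nnegrE ?nm_ge0// fg.
move=> _ _; rewrite integral0 => cv.
have /cv : nbhs (0%E : \bar R) [set x | (x < e%:E)%E].
  apply: open_nbhs_nbhs; split; last by rewrite /= lte_fin.
  exact: open_ereal_lt_ereal.
by move=> [n _ /(_ n (leqnn n))] /= h; exists n.
Unshelve. all: by end_near. Qed.

End sqG.

(** * Multipliers of the closure of the polynomials *)

Section multipliers.
Context {R : realType}.
Notation C := (Cplx R).
Notation B := (borelC R).
Implicit Types (x y z w : C) (f g h m : C -> C) (p q : {poly C}).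
Variable mu : {finite_measure set (borelC R) -> \bar R}.
Variable G : set C.
Hypothesis mG : measurable (G : set B).
Variables (M delta : R).
Hypothesis (delta0 : 0 < delta).
Hypothesis GM : forall z, G z -> delta <= nm z <= M.
Local Notation sq := (sqG mu G).

(** Membership in the closure of the polynomials, without the finiteness of the norm,
    which follows. *)
Definition apx f := measC f /\ forall e : R, 0 < e ->
  exists p, (sq (fun z => f z - p.[z])%R < e%:E)%E.

Lemma apx_lim f : measC f -> (forall e : R, 0 < e -> exists2 g, apx g &
  (sq (fun z => f z - g z)%R < e%:E)%E) -> apx f.
Proof.
move=> mf hf; split => // e e0; have e4 : 0 < e / 4 by rewrite divr_gt0.
have [g [mg hg] fg] := hf _ e4; have [p gp] := hg _ e4.
exists p; apply: le_lt_trans (twice_sum_lt (sqG_ge0 _ _ _) (sqG_ge0 _ _ _) fg gp).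
rewrite (_ : (fun z => f z - p.[z]) = (fun z => (f z - g z) + (g z - p.[z]))).
  by apply: sqG_add => //; apply: measCB => //; exact: measC_poly.
by apply/funext => z; rewrite addrA subrK.
Qed.

Lemma apx_poly p : apx (horner p).
Proof.
split=> [|e e0]; first exact: measC_poly.
exists p; rewrite /sqG; under eq_integral do rewrite subrr nm0 expr0n.
by rewrite integral0 lte_fin.
Qed.

Lemma apxD f g : apx f -> apx g -> apx (fun z => f z + g z).
Proof.
move=> [mf hf] [mg hg]; split=> [|e e0]; first exact: measCD.
have e4 : 0 < e / 4 by rewrite divr_gt0.
have [p fp] := hf _ e4; have [q gq] := hg _ e4.
exists (p + q); apply: le_lt_trans (twice_sum_lt (sqG_ge0 _ _ _) (sqG_ge0 _ _ _) fp gq).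
rewrite (_ : (fun z => _ - _) = (fun z => (f z - p.[z]) + (g z - q.[z]))).
  by apply: sqG_add => //; apply: measCB => //; exact: measC_poly.
by apply/funext => z; rewrite hornerD opprD addrACA.
Qed.

Lemma apx_lty f : apx f -> (sq f < +oo)%E.
Proof.
move=> [mf /(_ 1 ltr01)[p fp]].
have [K hK] := poly_bounded GM p.
have py : (sq (horner p) < +oo)%E.
  apply: (@sqG_bounded R mu G mG _ `|K|) => //; first exact: measC_poly.
  by move=> z /hK/le_trans; apply; exact: ler_norm.
rewrite (_ : f = fun z => (f z - p.[z]) + p.[z]); last first.
  by apply/funext => z; rewrite subrK.
apply: (@le_lt_trans _ _ (2%:E * (sq (fun z => f z - p.[z])%R + sq (horner p)))%E).
  by apply: sqG_add => //; [apply: measCB => //|]; exact: measC_poly.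
by rewrite lte_mul_pinfty// lte_add_pinfty// (lt_trans fp)// ltry.
Qed.

Definition mult m := [/\ measC m, exists2 K : R, 0 < K & forall z, G z -> nm (m z) <= K &
  forall h, apx h -> apx (fun z => m z * h z)].

Lemma lt_scale (x : \bar R) (e K : R) : (0 <= x)%E -> 0 < K -> (x < (e / K)%:E)%E ->
  (K%:E * x < e%:E)%E.
Proof.
move=> x0 K0 xe; have xf : x \is a fin_num by rewrite ge0_fin_numE// (lt_trans xe)// ltry.
by move: xe; rewrite -(fineK xf) -EFinM !lte_fin [K * _]mulrC ltr_pdivlMr.
Qed.

Lemma mult_poly_crit m (K : R) : measC m -> 0 < K -> (forall z, G z -> nm (m z) <= K) ->
  (forall p, apx (fun z => m z * p.[z])) -> mult m.
Proof.
move=> mm K0 mK mp; split => //; first by exists K.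
move=> h [mh hh]; apply: apx_lim; first exact: measCM.
move=> e e0; have eK : 0 < e / K ^+ 2 by rewrite divr_gt0// exprn_gt0.
have [p hp] := hh _ eK; exists (fun z => m z * p.[z]); first exact: mp.
have mhp : measC (fun z => h z - p.[z]) by apply: measCB => //; exact: measC_poly.
apply: le_lt_trans (lt_scale (sqG_ge0 _ _ _) (exprn_gt0 2 K0) hp).
apply: sqG_le => //; last 2 first.
- exact: ltW.
- by move=> z Gz; rewrite -mulrBr nmM ler_wpM2r ?nm_ge0// mK.
- by apply: measCB; apply: measCM => //; exact: measC_poly.
Qed.

Lemma mult_cst c : mult (fun=> c).
Proof.
apply: (@mult_poly_crit _ (nm c + 1)); first exact: measC_cst.
- by rewrite ltr_wpDl ?nm_ge0.
- by move=> z _; rewrite lerDl.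
- move=> p; rewrite (_ : (fun z => _) = horner (c *: p)); first exact: apx_poly.
  by apply/funext => z; rewrite hornerZ.
Qed.

Lemma multD m1 m2 : mult m1 -> mult m2 -> mult (fun z => m1 z + m2 z).
Proof.
move=> [mm1 [K1 K10 h1] a1] [mm2 [K2 K20 h2] a2]; split.
- exact: measCD.
- exists (K1 + K2); first exact: addr_gt0.
  by move=> z Gz; rewrite (le_trans (ler_nmD _ _))// lerD ?h1 ?h2.
- move=> h ah; rewrite (_ : (fun z => _) = (fun z => m1 z * h z + m2 z * h z)).
    by apply: apxD; [exact: a1|exact: a2].
  by apply/funext => z; rewrite mulrDl.
Qed.

Lemma multM m1 m2 : mult m1 -> mult m2 -> mult (fun z => m1 z * m2 z).
Proof.
move=> [mm1 [K1 K10 h1] a1] [mm2 [K2 K20 h2] a2]; split.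
- exact: measCM.
- exists (K1 * K2); first exact: mulr_gt0.
  by move=> z Gz; rewrite nmM ler_pM ?nm_ge0 ?h1 ?h2.
- move=> h ah; rewrite (_ : (fun z => _) = (fun z => m1 z * (m2 z * h z))).
    by apply: a1; exact: a2.
  by apply/funext => z; rewrite mulrA.
Qed.

Lemma multB m1 m2 : mult m1 -> mult m2 -> mult (fun z => m1 z - m2 z).
Proof.
move=> h1 h2; rewrite (_ : (fun z => _) = (fun z => m1 z + -1 * m2 z)).
  by apply: multD => //; apply: multM => //; exact: mult_cst.
by apply/funext => z; rewrite mulN1r.
Qed.

Lemma multX m n : mult m -> mult (fun z => m z ^+ n).
Proof.
move=> hm; elim: n => [|n IH].
  rewrite (_ : (fun z => _) = fun=> 1); first exact: mult_cst.
  by apply/funext => z; rewrite expr0.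
rewrite (_ : (fun z => _) = fun z => m z * m z ^+ n); first exact: multM.
by apply/funext => z; rewrite exprS.
Qed.

Lemma mult_sum (I : Type) (s : seq I) (F : I -> C -> C) : (forall i, mult (F i)) ->
  mult (fun z => \sum_(i <- s) F i z).
Proof.
move=> hF; elim: s => [|i s IH].
  rewrite (_ : (fun z => _) = fun=> 0); first exact: mult_cst.
  by apply/funext => z; rewrite big_nil.
rewrite (_ : (fun z => _) = fun z => F i z + \sum_(i <- s) F i z); first exact: multD.
by apply/funext => z; rewrite big_cons.
Qed.

Lemma mult_poly p : mult (horner p).
Proof.
have [K hK] := poly_bounded GM p.
apply: (@mult_poly_crit _ (`|K| + 1)); first exact: measC_poly.
- by rewrite ltr_wpDl.
- by move=> z /hK/le_trans; apply; rewrite (le_trans (ler_norm _))// lerDl.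
- move=> q; rewrite (_ : (fun z => _) = horner (p * q)); first exact: apx_poly.
  by apply/funext => z; rewrite hornerM.
Qed.

(** The inverse of z is represented by a measurable function i that is bounded on G. *)
Lemma mult_ratapp (i f : C -> C) : mult i -> (forall z, G z -> i z = z^-1) ->
  measC f -> ratapp G f -> mult f.
Proof.
move=> mi iE mf rf; have [K K0 hK] := ratapp_bounded delta0 GM rf.
split => //; first by exists K.
move=> h ah; have [mh _] := ah; apply: apx_lim; first exact: measCM.
move=> e e0; have hy := apx_lty ah.
have hf : sq h \is a fin_num by rewrite ge0_fin_numE ?sqG_ge0.
pose s := fine (sq h); have s0 : 0 <= s by rewrite fine_ge0 ?sqG_ge0.
pose d := Num.min 1 (e / (s + 1)).
have d0 : 0 < d by rewrite lt_min ltr01 divr_gt0// ltr_wpDl.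
have [p [n fp]] := rf _ d0.
pose g z := p.[z] * i z ^+ n.
have [mg _ ag] : mult g by apply: multM; [exact: mult_poly|exact: multX].
exists (fun z => g z * h z); first exact: ag.
apply: (@le_lt_trans _ _ ((d ^+ 2)%:E * sq h)%E).
  apply: sqG_le => //; last 2 first.
  - exact: ltW.
  - move=> z Gz; rewrite -mulrBl nmM ler_wpM2r ?nm_ge0// /g iE// exprVn.
    by rewrite ltW// fp.
  - by apply: measCB; apply: measCM.
rewrite -(fineK hf) -/s -EFinM lte_fin.
apply: (@le_lt_trans _ _ (d * s)).
  rewrite ler_wpM2r// expr2 ler_piMr ?(ltW d0)//.
  by rewrite ge_min lexx.
have : d <= e / (s + 1) by rewrite ge_min lexx orbT.
rewrite ler_pdivlMr ?ltr_wpDl// => ds.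
by move: ds d0; rewrite mulrDr mulr1; lra.
Qed.

(** Bounded pointwise convergence, by dominated convergence applied to each product. *)
Lemma mult_seq (f_ : nat -> C -> C) f (K : R) : (forall n, mult (f_ n)) -> measC f ->
  0 < K -> (forall n z, G z -> nm (f_ n z) <= K) -> (forall z, G z -> nm (f z) <= K) ->
  (forall z, G z -> (fun n => nm (f_ n z - f z)) @ \oo --> (0 : R)) -> mult f.
Proof.
move=> hf mf K0 f_K fK cf; split => //; first by exists K.
move=> h ah; have [mh _] := ah; apply: apx_lim; first exact: measCM.
move=> e e0.
have mf_ n : measC (f_ n) by case: (hf n).
have mg : measC (fun z => ofR (2 * K) * h z) by apply: measCM => //; exact: measC_cst.
have [] := @sqG_dct R mu G mG (fun n z => f_ n z * h z) (fun z => f z * h z)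
  (fun z => ofR (2 * K) * h z) _ (measCM mf mh) mg _ _ _ e e0.
- by move=> n; exact: measCM.
- apply: apx_lty; have [_ _] := mult_cst (ofR (2 * K)); exact.
- move=> n z Gz; rewrite -mulrBl !nmM ler_wpM2r ?nm_ge0// nm_ofR gtr0_norm ?mulr_gt0//.
  by rewrite (le_trans (ler_nmB _ _))// mulr2n mulrDl mul1r lerD ?f_K ?fK.
- move=> z Gz.
  rewrite (_ : (fun n => _) = (fun n => nm (f_ n z - f z) * nm (h z))); last first.
    by apply/funext => n; rewrite -mulrBl nmM.
  by rewrite -(mul0r (nm (h z))); apply: cvgMl; exact: cf.
- move=> n hn; exists (fun z => f_ n z * h z); first by case: (hf n) => _ _; exact.
  by move: hn; rewrite /sqG; under eq_integral do rewrite nm_sub.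
Qed.

End multipliers.

(** * Polynomials converging to a step *)

Section step_poly.
Context {R : realType}.
Implicit Types (t x : R).

Lemma bernoulli_sub x n : 0 <= x <= 1 -> 1 - n%:R * x <= (1 - x) ^+ n.
Proof.
move=> /andP[x0 x1]; elim: n => [|n IH]; first by rewrite mul0r subr0 expr0.
have h : (1 - x) * (1 - n%:R * x) <= (1 - x) ^+ n.+1.
  by rewrite exprS ler_wpM2l// subr_ge0.
apply: le_trans h; rewrite -natr1.
have : 0 <= n%:R * x * x by rewrite !mulr_ge0.
by lra.
Qed.

Lemma bernoulli_add x n : 0 <= x -> 1 + n%:R * x <= (1 + x) ^+ n.
Proof.
move=> x0; elim: n => [|n IH]; first by rewrite mul0r addr0 expr0.
have h : (1 + x) * (1 + n%:R * x) <= (1 + x) ^+ n.+1.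
  by rewrite exprS ler_wpM2l// addr_ge0.
apply: le_trans h; rewrite -natr1.
have : 0 <= n%:R * x * x by rewrite !mulr_ge0.
by lra.
Qed.

Lemma bernoulli_upper x n : 0 <= x <= 1 -> (1 - x) ^+ n * (1 + n%:R * x) <= 1.
Proof.
move=> /andP[x0 x1]; apply: (@le_trans _ _ ((1 - x) ^+ n * (1 + x) ^+ n)).
  by rewrite ler_wpM2l ?exprn_ge0 ?subr_ge0// bernoulli_add.
rewrite -exprMn exprn_ile1//; first by rewrite mulr_ge0 ?subr_ge0 ?addr_ge0.
by have := mulr_ge0 x0 x0; lra.
Qed.

Lemma cvg_nXn x : 0 <= x < 1 -> (fun n => n%:R * x ^+ n) @ \oo --> (0 : R).
Proof.
move=> /andP[x0 x1]; pose y := Num.sqrt x.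
have y0 : 0 <= y by exact: sqrtr_ge0.
have y1 : y < 1 by rewrite -(@sqrtr1 R) ltr_sqrt.
have [->|yn0] := eqVneq x 0.
  rewrite (_ : (fun n => _) = fun=> 0); first exact: cvg_cst.
  by apply/funext => -[|n]; rewrite ?mul0r// expr0n mulr0.
have yp : 0 < y by rewrite sqrtr_gt0 lt_neqAle eq_sym yn0.
(* with y = sqrt x, n a <= y^(-n) and so n x^n <= y^n / a *)
pose a := y^-1 - 1; have a0 : 0 < a by rewrite subr_gt0 invf_gt1.
apply: (@squeeze_cvgr _ _ _ _ (fun=> 0) (fun n => a^-1 * y ^+ n)); last 2 first.
- exact: cvg_cst.
- rewrite -[X in _ --> X](mulr0 a^-1); apply: cvgMr; apply: cvg_expr.
  by rewrite ger0_norm.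
near=> n; apply/andP; split; first by rewrite mulr_ge0 ?exprn_ge0.
have -> : x ^+ n = y ^+ n * y ^+ n by rewrite -exprMn -expr2 sqr_sqrtr.
rewrite mulrA ler_wpM2r ?exprn_ge0//.
have h : 1 + n%:R * a <= y ^- n.
  by rewrite -exprVn (_ : y^-1 = 1 + a) ?bernoulli_add ?(ltW a0)// /a; ring.
have yn : 0 < y ^+ n by rewrite exprn_gt0.
rewrite -(ler_pM2r a0) mulVf ?gt_eqF// mulrAC.
have : (1 + n%:R * a) * y ^+ n <= 1 by rewrite -ler_pdivlMr// div1r.
by rewrite mulrDl mul1r; lra.
Unshelve. all: by end_near. Qed.

(** By the Bernoulli inequalities this behaves like exp(- n (2 t)^n), which switches from 1
    to 0 at t = 1/2. *)
Definition step_poly n t : R := (1 - t ^+ n) ^+ (n * 2 ^ n).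

Lemma step_poly_bound n t : 0 <= t <= 1 -> 0 <= step_poly n t <= 1.
Proof.
move=> /andP[t0 t1]; have h : 0 <= 1 - t ^+ n by rewrite subr_ge0 exprn_ile1.
rewrite /step_poly exprn_ge0//= exprn_ile1// lerBlDr lerDl exprn_ge0//.
Qed.

Lemma step_poly_cvg t : 0 <= t <= 1 ->
  (fun n => step_poly n t) @ \oo --> ((t < 2^-1)%R%:R : R).
Proof.
move=> t01; have [t0 t1] := andP t01.
have tn n : 0 <= t ^+ n <= 1 by rewrite exprn_ge0//= exprn_ile1.
have E n : (n * 2 ^ n)%:R * t ^+ n = n%:R * (2 * t) ^+ n.
  by rewrite natrM natrX exprMn mulrA.
have [th|th] := ltP t 2^-1.
  apply: (@squeeze_cvgr _ _ _ _ (fun n => 1 - n%:R * (2 * t) ^+ n) (fun=> 1)).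
  - near=> n; rewrite -E bernoulli_sub//=.
    by have /andP[] := step_poly_bound n t01.
  - rewrite -[X in _ --> X](subr0 1); apply: cvgB; first exact: cvg_cst.
    by apply: cvg_nXn; apply/andP; split; lra.
  - exact: cvg_cst.
apply: (@squeeze_cvgr _ _ _ _ (fun=> 0) (fun n => n.+1%:R^-1)).
- near=> n; have /andP[s0 _] := step_poly_bound n t01; rewrite s0 /=.
  have := bernoulli_upper (n * 2 ^ n) (tn n); rewrite E => h.
  rewrite -div1r ler_pdivlMr//; apply: le_trans h; rewrite ler_wpM2l//.
  rewrite -natr1 addrC lerD2l -[leLHS]mulr1 ler_wpM2l//.
  by rewrite exprn_ege1//; lra.
- exact: cvg_cst.
- exact: cvg_harmonic.
Unshelve. all: by end_near. Qed.

End step_poly.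

(** * Indicators of Borel sets are multipliers *)

Section indicators.
Context {R : realType}.
Notation C := (Cplx R).
Notation B := (borelC R).
Implicit Types (x y z w : C) (f g h m : C -> C) (p q : {poly C}).
Variable mu : {finite_measure set (borelC R) -> \bar R}.
Variable G : set C.
Hypothesis mG : measurable (G : set B).
Variables (M delta : R).
Hypothesis (delta0 : 0 < delta).
Hypothesis GM : forall z, G z -> delta <= nm z <= M.
Local Notation sq := (sqG mu G).
Local Notation mult := (mult mu G).
Local Notation apx := (apx mu G).

Definition ind (A : set B) : C -> C := fun z => ofR (\1_A z).

Definition mult_sets : set (set B) := [set A | measurable A /\ mult (ind A)].

Lemma ofRX (s : R) k : ofR (s ^+ k) = ofR s ^+ k.
Proof. by elim: k => [|k IH]; rewrite ?expr0// !exprS ofRM IH. Qed.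

Lemma measC_ind (A : set B) : measurable A -> measC (ind A).
Proof. by move=> mA; apply: measC_ofR; exact: measurable_indic. Qed.

Lemma nm_ind (A : set B) z : nm (ind A z) <= 1.
Proof. by rewrite nm_ofR ger0_norm ?indicE ?ler0n// lern1 leq_b1. Qed.

Lemma mult_setsC (A : set B) : mult_sets A -> mult_sets (~` A).
Proof.
move=> [mA hA]; split; first exact: measurableC.
rewrite (_ : ind (~` A) = fun z => 1 - ind A z); first exact: multB (mult_cst _ _ _) hA.
apply/funext => z; rewrite /ind !indicE in_setC.
by case: (z \in A); rewrite /= ?ofR0 ?ofR1 ?subrr ?subr0.
Qed.

Lemma mult_setsI (A A' : set B) : mult_sets A -> mult_sets A' -> mult_sets (A `&` A').
Proof.
move=> [mA hA] [mA' hA']; split; first exact: measurableI.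
rewrite (_ : ind (A `&` A') = fun z => ind A z * ind A' z); first exact: multM.
apply/funext => z; rewrite /ind !indicE in_setI.
by case: (z \in A); case: (z \in A'); rewrite /= ?ofR0 ?ofR1 ?mulr0 ?mulr1.
Qed.

Lemma mult_setsU (A A' : set B) : mult_sets A -> mult_sets A' -> mult_sets (A `|` A').
Proof.
by move=> /mult_setsC hA /mult_setsC hA'; rewrite -[_ `|` _]setCK setCU; apply: mult_setsC; exact: mult_setsI.
Qed.

Lemma mult_sets0 : mult_sets set0.
Proof.
split; first exact: measurable0.
rewrite (_ : ind set0 = fun=> 0); first exact: mult_cst.
by apply/funext => z; rewrite /ind indicE in_set0.
Qed.

Lemma mult_sets_bigcup (F : nat -> set B) : (forall n, mult_sets (F n)) -> mult_sets (\bigcup_n F n).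
Proof.
move=> hF; have mU : measurable (\bigcup_n F n).
  by apply: bigcup_measurable => n _; case: (hF n).
split => //.
pose P n := \big[setU/set0]_(i < n) F i.
have hP n : mult_sets (P n).
  elim: n => [|n IH]; first by rewrite /P big_ord0; exact: mult_sets0.
  by rewrite /P big_ord_recr; apply: mult_setsU; [exact: IH|exact: hF].
apply: (@mult_seq _ _ _ mG _ _ GM (fun n => ind (P n)) _ 1).
- by move=> n; case: (hP n).
- exact: measC_ind.
- exact: ltr01.
- by move=> n z _; exact: nm_ind.
- by move=> z _; exact: nm_ind.
- move=> z _; have [[k _ Fk]|nz] := pselect ((\bigcup_n F n) z).
    apply/cvgrPdist_lt => e e0; exists k.+1 => // n /= kn.
    have Pn : P n z by rewrite /P -bigcup_mkord; exists k.
    rewrite /ind !indicE !mem_set//; last by exists k.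
    by rewrite subrr nm0 subrr normr0.
  rewrite (_ : (fun n => _) = fun=> 0); first exact: cvg_cst.
  apply/funext => n; rewrite /ind !indicE !memNset ?subrr ?nm0//.
  by rewrite /P -bigcup_mkord => -[k _ Fk]; apply: nz; exists k.
Qed.

(** An affine change t of u has values in [0, 1] on G and crosses 1/2 where u crosses c. *)
Lemma mult_sets_halfplane (u : B -> R) (K c : R) : measurable_fun setT u ->
  0 < K -> (forall z, G z -> `|u z| <= K) -> mult (fun z => ofR (u z)) ->
  mult_sets [set z | u z < c].
Proof.
move=> mu_ K0 uK hu.
have mA : measurable [set z : B | u z < c].
  have -> : [set z : B | u z < c] = u @^-1` `]-oo, c[.
    by apply/seteqP; split=> z; rewrite /= in_itv.
  by rewrite -[X in measurable X]setTI; apply: mu_ => //; exact: measurable_itv.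
split; first exact: mA.
(* (u - c) / N stays within 1/2 of 0 on G *)
pose N := 2 * (K + `|c| + 1); have N0 : 0 < N.
  by rewrite mulr_gt0// ltr_wpDl// addr_ge0// ltW.
pose t z := 2^-1 + (u z - c) / N.
have t01 z : G z -> 0 <= t z <= 1.
  move=> Gz; have h : `|(u z - c) / N| <= 2^-1.
    rewrite normrM normfV [`|N|]gtr0_norm// ler_pdivrMr// /N.
    have : `|u z - c| <= K + `|c| by rewrite (le_trans (ler_normB _ _))// lerD2r uK.
    by lra.
  by move: h; rewrite ler_norml /t => /andP[h1 h2]; apply/andP; split; lra.
have tlt z : (t z < 2^-1) = (u z < c).
  by rewrite /t -[X in _ < X]addr0 ltrD2l pmulr_llt0 ?invr_gt0// subr_lt0.
apply: (@mult_seq _ _ _ mG _ _ GM (fun n z => ofR (step_poly n (t z))) _ 1); last 4 first.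
- exact: ltr01.
- move=> n z Gz; have /andP[s0 s1] := step_poly_bound n (t01 _ Gz).
  by rewrite nm_ofR ger0_norm.
- by move=> z _; exact: nm_ind.
- move=> z Gz; have h := step_poly_cvg (t01 _ Gz).
  rewrite (_ : (fun n => _) = fun n => `|step_poly n (t z) - (t z < 2^-1)%R%:R|).
    rewrite -(normr0 R); apply: cvg_norm.
    rewrite -[X in _ --> X](subrr ((t z < 2^-1)%R%:R : R)).
    by apply: cvgB; [exact: h|exact: cvg_cst].
  apply/funext => n; rewrite /ind -ofRN -ofRD nm_ofR tlt indicE.
  by congr (`|_ - _%:R|); congr (nat_of_bool _); apply/idP/idP; rewrite inE.
- move=> n; rewrite (_ : (fun z => _) =
      fun z => (1 - (ofR (2^-1 - c / N) + ofR N^-1 * ofR (u z)) ^+ n) ^+ (n * 2 ^ n)).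
    apply: (multX mG); apply: (@multB _ mu G mG (fun=> 1) (fun z =>
      (ofR (2^-1 - c / N) + ofR N^-1 * ofR (u z)) ^+ n)); first exact: mult_cst.
    apply: (multX mG); apply: (@multD _ mu G mG (fun=> ofR (2^-1 - c / N))
      (fun z => ofR N^-1 * ofR (u z))); first exact: mult_cst.
    by apply: (@multM _ mu G (fun=> ofR N^-1)); [exact: mult_cst|exact: hu].
  apply/funext => z.
  have tE : ofR (t z) = ofR (2^-1 - c / N) + ofR N^-1 * ofR (u z).
    by rewrite -ofRM -ofRD; congr ofR; rewrite /t mulrBl; ring.
  by rewrite -tE /step_poly ofRX ofRD ofRN ofRX ofR1.
- exact: measC_ind.
Qed.

Hypothesis multRe : mult (fun z => ofR (Re z)).
Hypothesis multIm : mult (fun z => ofR (Im z)).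

Let K := `|M| + 1.
Let K0 : 0 < K. Proof. by rewrite ltr_wpDl. Qed.
Let ReK z : G z -> `|Re z| <= K.
Proof.
move=> /GM/andP[_ zM]; rewrite (le_trans (Re_le_nm _))// (le_trans zM)//.
by rewrite (le_trans (ler_norm _))// lerDl.
Qed.
Let ImK z : G z -> `|Im z| <= K.
Proof.
move=> /GM/andP[_ zM]; rewrite (le_trans (Im_le_nm _))// (le_trans zM)//.
by rewrite (le_trans (ler_norm _))// lerDl.
Qed.

Lemma mult_sets_box n : mult_sets (@box R n).
Proof.
rewrite /box; case: unpickle => [[[[a b] c] d]|]; last exact: mult_sets0.
pose L (s : rat) : set B := [set z | Re z < ratr s].
pose L' (s : rat) : set B := [set z | Im z < ratr s].
have hL s : mult_sets (L s) by exact: (mult_sets_halfplane _ measurable_Re K0 ReK multRe).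
have hL' s : mult_sets (L' s) by exact: (mult_sets_halfplane _ measurable_Im K0 ImK multIm).
rewrite (_ : [set z | _] = (~` L a `&` L b) `&` (~` L' c `&` L' d)).
  apply: mult_setsI.
    by apply: mult_setsI; [apply: mult_setsC; exact: hL|exact: hL].
  by apply: mult_setsI; [apply: mult_setsC; exact: hL'|exact: hL'].
apply/seteqP; split=> z; rewrite /L /L' /=.
  by move=> [/andP[h1 h2] /andP[h3 h4]]; do !split => //; apply/negP; rewrite -leNgt.
by move=> [[/negP h1 h2] [/negP h3 h4]]; rewrite !leNgt h1 h2 h3 h4.
Qed.

(** The multiplier sets form a sigma-algebra that contains the boxes. *)
Lemma mult_sets_measurable (A : set B) : measurable A -> mult_sets A.
Proof.
apply: smallest_sub; first split.
- exact: mult_sets0.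
- by move=> A' /mult_setsC; rewrite setTD.
- exact: mult_sets_bigcup.
move=> U oU; rewrite (open_bigcup_box oU) bigcup_mkcond; apply: mult_sets_bigcup => n.
by case: ifPn => _; [exact: mult_sets_box|exact: mult_sets0].
Qed.

(** A simple function is a multiplier, and 1 is a polynomial. *)
Lemma apx_simple (s : {nnsfun B >-> R}) : apx (fun z : B => ofR (s z)).
Proof.
pose v : seq R := finmap.enum_fset (fset_set (s @` setT)).
have hs : mult (fun z : B => ofR (s z)).
  rewrite (_ : (fun z : B => _) =
      fun z : B => \sum_(i < size v) (ofR v`_i * ind (s @^-1` [set v`_i]) z)).
    apply: (mult_sum mG (index_enum _)) => i.
    apply: (@multM _ mu G (fun=> ofR v`_i)); first exact: mult_cst.
    by apply: (mult_sets_measurable _).2.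
  apply/funext => z; rewrite (fimfunEord s) ofR_sum.
  by apply: eq_bigr => i _; rewrite ofRM.
have [_ _ /(_ _ (apx_poly mu G 1%:P))] := hs.
rewrite (_ : (fun z => _ * _) = fun z : B => ofR (s z))//.
by apply/funext => z; rewrite hornerC mulr1.
Qed.

Lemma apx_nonneg (u : B -> R) : measurable_fun setT u -> (forall z, 0 <= u z) ->
  (sq (fun z => ofR (u z)) < +oo)%E -> apx (fun z => ofR (u z)).
Proof.
move=> mu_ u0 uy.
have mu' : measC (fun z => ofR (u z)) by exact: measC_ofR.
have [s [sh sc]] := @approximation _ B R setT measurableT (EFin \o u)
  ((measurable_EFinP _ _).2 mu_) (fun z _ => u0 z).
have sc' z : (fun n => s n z) @ \oo --> u z.
  by have := sc z I; move/fine_cvgP => [_]; exact.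
have su n z : s n z <= u z.
  rewrite -(cvg_lim _ (sc' z))//; apply: nondecreasing_cvgn_le.
    by move=> a b ab; have /lefP := sh _ _ ab; exact.
  by apply/cvg_ex; exists (u z).
apply: apx_lim => // e e0.
(* u dominates its distance to the simple functions below it *)
have [n hn] : exists n, (sq (fun z : B => ofR (s n z) - ofR (u z))%R < e%:E)%E.
  apply: (@sqG_dct R mu G mG (fun n (z : B) => ofR (s n z)) (fun z : B => ofR (u z)) (fun z : B => ofR (u z))) => //.
  - by move=> n; exact: measC_ofR.
  - move=> n z _; rewrite -ofRN -ofRD !nm_ofR distrC !ger0_norm ?subr_ge0//.
    by rewrite lerBlDr lerDl.
  - move=> z _.
    rewrite (_ : (fun n => _) = fun n => `|s n z - u z|); last first.
      by apply/funext => n; rewrite -ofRN -ofRD nm_ofR.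
    rewrite -(normr0 R); apply: cvg_norm.
    rewrite -[X in _ --> X](subrr (u z)).
    by apply: cvgB => //; exact: cvg_cst.
exists (fun z : B => ofR (s n z)); first exact: apx_simple.
by move: hn; rewrite /sqG; under eq_integral do rewrite nm_sub.
Qed.

Lemma apx_L2 f : measC f -> (sq f < +oo)%E -> apx f.
Proof.
move=> mf fy; have [mr mi] := (measCP f).1 mf.
have key (u : B -> R) : measurable_fun setT u -> (forall z, `|u z| <= nm (f z)) ->
    apx (fun z : B => ofR (u z)).
  move=> mu_ uf.
  have part (v : B -> R) : measurable_fun setT v -> (forall z, `|v z| <= nm (f z)) ->
      apx (fun z : B => ofR (Num.max (v z) 0)).
    move=> mv vf.
    have mm : measurable_fun setT (fun z : B => Num.max (v z) 0).
      by apply: measurable_maxr => //; exact: measurable_cst.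
    apply: apx_nonneg => //.
      by move=> z; rewrite le_max lexx orbT.
    apply: le_lt_trans fy; apply: sqG_le1 => //; first exact: measC_ofR.
    move=> z _; rewrite nm_ofR; apply: le_trans (vf z).
    by case: (leP (v z) 0) => h; rewrite ?normr0.
  rewrite (_ : (fun z : B => _) = fun z : B =>
      ofR (Num.max (u z) 0) + -1 * ofR (Num.max (- u z) 0)).
    apply: apxD => //; first exact: part.
    have [_ _] := mult_cst mu mG (-1 : C); apply; apply: (part (fun z : B => - u z)).
      exact: measurable_funN.
    by move=> z; rewrite normrN.
  apply/funext => z; rewrite mulN1r -ofRN -ofRD; congr ofR.
  by case: (leP (u z) 0) => ?; case: (leP (- u z) 0) => ?; lra.
rewrite (_ : f = fun z => ofR (Re (f z)) + Complex 0 1 * ofR (Im (f z))).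
  apply: apxD => //; first by apply: key => // z; exact: Re_le_nm.
  have [_ _] := mult_cst mu mG (Complex 0 1 : C); apply.
  by apply: key => // z; exact: Im_le_nm.
by apply/funext => z; apply: CE; rewrite ?ReD ?ImD ?RecM ?ImcM /=; ring.
Qed.

End indicators.

(** * The moment form is a square integral *)

Section moments.
Context {R : realType}.
Notation C := (Cplx R).
Notation B := (borelC R).
Implicit Types (x y z w : C) (f g h m : C -> C) (p q : {poly C}).
Variable mu : {finite_measure set (borelC R) -> \bar R}.
Variable G : set C.
Hypothesis mG : measurable (G : set B).
Hypothesis muG : mu (~` G) = 0%E.
Local Notation sq := (sqG mu G).
Local Notation cint := (Cintegral mu).

(** The functions for which the complex integral is linear. *)
Definition bounded_measC f := measC f /\ exists2 K : R, 0 <= K & forall z, G z -> nm (f z) <= K.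

Lemma bounded_measC_integrable (u : B -> R) (K : R) : measurable_fun setT u -> 0 <= K ->
  (forall z, G z -> `|u z| <= K) -> mu.-integrable setT (EFin \o u).
Proof.
move=> mu_ K0 uK; apply/integrableP; split; first exact/measurable_EFinP.
have mn : measurable_fun setT (fun z : B => `|(EFin \o u) z|%E).
  by apply: measurableT_comp => //; exact/measurable_EFinP.
rewrite (@ge0_negligible_integral _ B _ mu setT (~` G : set B))//; last exact: measurableC.
rewrite setDE setCK setTI.
apply: (@le_lt_trans _ _ (\int[mu]_(z in G) (K%:E))%E).
  by apply: ge0_le_integral => //; exact: measurable_funTS.
rewrite integral_cst//.
have muf : mu G \is a fin_num by exact: fin_num_measure.
by rewrite lte_mul_pinfty// -ge0_fin_numE.
Qed.

Lemma bounded_measC_Re f : bounded_measC f -> mu.-integrable setT (EFin \o (fun z : B => Re (f z))).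
Proof.
move=> [mf [K K0 fK]]; apply: (bounded_measC_integrable _ K0); first by case: ((measCP f).1 mf).
by move=> z /fK; apply/le_trans/Re_le_nm.
Qed.

Lemma bounded_measC_Im f : bounded_measC f -> mu.-integrable setT (EFin \o (fun z : B => Im (f z))).
Proof.
move=> [mf [K K0 fK]]; apply: (bounded_measC_integrable _ K0); first by case: ((measCP f).1 mf).
by move=> z /fK; apply/le_trans/Im_le_nm.
Qed.

Lemma bounded_measCD f g : bounded_measC f -> bounded_measC g -> bounded_measC (fun z => f z + g z).
Proof.
move=> [mf [K K0 fK]] [mg [K' K0' gK]]; split; first exact: measCD.
exists (K + K'); first exact: addr_ge0.
by move=> z Gz; rewrite (le_trans (ler_nmD _ _))// lerD ?fK ?gK.
Qed.

Lemma bounded_measCZ c f : bounded_measC f -> bounded_measC (fun z => c * f z).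
Proof.
move=> [mf [K K0 fK]]; split; first by apply: measCM => //; exact: measC_cst.
exists (nm c * K); first by rewrite mulr_ge0 ?nm_ge0.
by move=> z Gz; rewrite nmM ler_wpM2l ?nm_ge0 ?fK.
Qed.

Lemma cintD f g : bounded_measC f -> bounded_measC g -> cint (fun z => f z + g z) = cint f + cint g.
Proof.
move=> hf hg; apply: CE; rewrite ?ReD ?ImD /=.
  rewrite -RintegralD//; [|exact: bounded_measC_Re|exact: bounded_measC_Re].
  by apply: eq_Rintegral => z _; rewrite ReD.
rewrite -RintegralD//; [|exact: bounded_measC_Im|exact: bounded_measC_Im].
by apply: eq_Rintegral => z _; rewrite ImD.
Qed.

Lemma integrable_scale (u : B -> R) (c : R) : mu.-integrable setT (EFin \o u) ->
  mu.-integrable setT (EFin \o (fun z => c * u z)).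
Proof.
move=> iu; rewrite (_ : EFin \o _ = (fun z => c%:E * (EFin \o u) z)%E).
  exact: integrableZl.
by apply/funext => z; rewrite /= EFinM.
Qed.

Lemma cintZ c f : bounded_measC f -> cint (fun z : B => c * f z) = c * cint f.
Proof.
move=> hf; have ir := bounded_measC_Re hf; have ii := bounded_measC_Im hf.
apply: CE; rewrite ?RecM ?ImcM /=.
  rewrite -!RintegralZl// -RintegralB//; [|exact: integrable_scale|exact: integrable_scale].
  by apply: eq_Rintegral => z _; rewrite RecM.
rewrite -!RintegralZl// -RintegralD//; [|exact: integrable_scale|exact: integrable_scale].
by apply: eq_Rintegral => z _; rewrite ImcM.
Qed.

Lemma bounded_measC0 : bounded_measC (fun=> 0).
Proof. by split; [exact: measC_cst|exists 0 => // z _; rewrite nm0]. Qed.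

Lemma cint_sum (I : Type) (s : seq I) (F : I -> C -> C) : (forall i, bounded_measC (F i)) ->
  bounded_measC (fun z => \sum_(i <- s) F i z) /\
  cint (fun z => \sum_(i <- s) F i z) = \sum_(i <- s) cint (F i).
Proof.
move=> hF; elim: s => [|i s [IH1 IH2]].
  rewrite (_ : (fun z => _) = fun=> 0); last by apply/funext => z; rewrite big_nil.
  split; first exact: bounded_measC0.
  rewrite big_nil -[RHS](mul0r (cint (fun=> 0))) -cintZ; last exact: bounded_measC0.
  by congr (Cintegral mu _); apply/funext => z; rewrite mul0r.
rewrite (_ : (fun z => _) = fun z => F i z + \sum_(j <- s) F j z); last first.
  by apply/funext => z; rewrite big_cons.
by split; [exact: bounded_measCD|rewrite cintD// IH2 big_cons].
Qed.

Variables (M : R).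
Hypothesis GM : forall z, G z -> nm z <= M.

Lemma bounded_measC_monomial i j : bounded_measC (fun z => z ^+ i * (z^*) ^+ j).
Proof.
split.
  by apply: measCM; apply: measCX; [exact: measC_id|apply: measC_conj; exact: measC_id].
exists (`|M| ^+ i * `|M| ^+ j); first by rewrite mulr_ge0 ?exprn_ge0.
move=> z /GM zM; have zM' : nm z <= `|M| by rewrite (le_trans zM) ?ler_norm.
rewrite nmM !nmX nm_conj; apply: ler_pM; rewrite ?exprn_ge0 ?nm_ge0//;
  by apply: lerXn2r; rewrite ?nnegrE ?nm_ge0.
Qed.

Lemma hform_finite (A : nat -> nat -> C) (w : nat -> C) N :
  (forall n, (N <= n)%N -> w n = 0) ->
  hform A w = \sum_(i < N) \sum_(j < N) w i * A i j * (w j)^*.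
Proof.
move=> wN; rewrite /hform.
have fs (F : nat -> C) : (forall n, (N <= n)%N -> F n = 0) ->
    \sum_(i \in [set: nat]) F i = \sum_(i < N) F i.
  move=> FN; rewrite fsbig_ord; apply/esym/fsbig_widen => // n [_ /=] /negP.
  by rewrite -leqNgt => /FN.
rewrite fs; last first.
  move=> n nN; rewrite fsbig1// => j _; by rewrite (wN _ nN) !mul0r.
apply: eq_bigr => i _; rewrite fs// => n nN.
by rewrite (wN _ nN) rmorph0 mulr0.
Qed.

(** The sum of w_i conj(w_j) z^i conj(z)^j is |P(z)|^2. *)
Lemma hform_moments (w : nat -> C) N : (forall n, (N <= n)%N -> w n = 0) ->
  ((Re (hform (moment_matrix mu) w))%:E = sq (horner (\poly_(i < N) w i)))%E.
Proof.
move=> wN; rewrite (hform_finite _ wN); set P := \poly_(i < N) w i.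
have hij i j : bounded_measC (fun z => w i * (w j)^* * (z ^+ i * (z^*) ^+ j)).
  by apply: bounded_measCZ; exact: bounded_measC_monomial.
have E1 : \sum_(i < N) \sum_(j < N) w i * moment_matrix mu i j * (w j)^* =
    cint (fun z => \sum_(i < N) \sum_(j < N) w i * (w j)^* * (z ^+ i * (z^*) ^+ j)).
  have [_ ->] := @cint_sum _ (index_enum 'I_N)
    (fun i z => \sum_(j < N) w i * (w j)^* * (z ^+ i * (z^*) ^+ j))
    (fun i => (@cint_sum _ (index_enum 'I_N) (fun j z => w i * (w j)^* * (z ^+ i * (z^*) ^+ j)) (fun j => hij i j)).1).
  apply: eq_bigr => i _.
  have [_ ->] := @cint_sum _ (index_enum 'I_N)
    (fun j z => w i * (w j)^* * (z ^+ i * (z^*) ^+ j)) (fun j => hij i j).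
  apply: eq_bigr => j _; rewrite cintZ; last exact: bounded_measC_monomial.
  by rewrite mulrAC.
have E2 z : \sum_(i < N) \sum_(j < N) w i * (w j)^* * (z ^+ i * (z^*) ^+ j) = ofR (nm P.[z] ^+ 2).
  rewrite -mul_conj /P horner_poly rmorph_sum mulr_suml.
  apply: eq_bigr => i _; rewrite mulr_sumr; apply: eq_bigr => j _.
  by rewrite rmorphM rmorphXn mulrACA.
rewrite E1 (_ : (fun z => _) = fun z => ofR (nm P.[z] ^+ 2)); last exact/funext.
rewrite (sqG_setT mG muG); last exact: measC_poly.
rewrite /= /Rintegral fineK// ge0_fin_numE; last first.
  by apply: integral_ge0 => z _; rewrite lee_fin sqr_ge0.
rewrite -(sqG_setT mG muG); last exact: measC_poly.
have [K hK] : exists K : R, forall z, G z -> nm P.[z] <= K.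
  by apply: (poly_bounded (M := M) (delta := 0)) => z Gz; rewrite nm_ge0 GM.
apply: (@sqG_bounded R mu G mG _ `|K|) => //; first exact: measC_poly.
by move=> z /hK/le_trans; apply; exact: ler_norm.
Qed.

End moments.

(** * The equivalence *)

Section equivalence.
Context {R : realType}.
Notation C := (Cplx R).
Notation B := (borelC R).
Implicit Types (x y z w : C) (f g h m : C -> C) (p q : {poly C}).
Variable mu : {finite_measure set (borelC R) -> \bar R}.
Variables (G : set C) (gam : R -> C) (M delta : R).
Hypothesis Ggam : jparam G gam.
Hypothesis muG : mu (~` G) = 0%E.
Hypothesis delta0 : 0 < delta.
Hypothesis GM : forall z, G z -> delta <= nm z <= M.
Local Notation sq := (sqG mu G).
Local Notation mult := (mult mu G).
Local Notation apx := (apx mu G).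

Lemma measurable_curve : measurable (G : set B).
Proof.
rewrite -[G]setCK; apply: (@measurableC _ B); apply: open_measC.
exact: closed_openC (closed_curve Ggam).
Qed.

Let mG := measurable_curve.

(** A continuous function on the plane that is 1/z on the curve: from
    1/z = conj z / |z|^2, with |z| cut off below at delta. *)
Definition cinv z : C := ofR ((Num.max (nm z) delta)^-1 ^+ 2) * z^*.

Lemma measC_cinv : measC cinv.
Proof.
apply: measCM; last by apply: measC_conj; exact: measC_id.
apply: measC_ofR; apply: (@measurable_continuous R) => z.
have cm : {for z, continuous (fun w => Num.max (nm w) delta)}.
  apply: (@continuous_max R C (@nm R) (fun=> delta) z); last exact: (@continuous_cstT C R^o delta z).
  exact: continuous_nm.
have m0 : Num.max (nm z) delta != 0 by rewrite gt_eqF// lt_max delta0 orbT.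
have cv : {for z, continuous (fun w => (Num.max (nm w) delta)^-1)} by exact: (@continuousV R).
exact: (@continuousM R _ _ _ z cv cv).
Qed.

Lemma cinvE z : G z -> cinv z = z^-1.
Proof.
move=> /GM/andP[zd _]; rewrite /cinv invCE; congr (ofR _ * _).
by rewrite max_l// exprVn.
Qed.

Lemma nm_cinv z : G z -> nm (cinv z) <= delta^-1.
Proof.
move=> Gz; have /GM/andP[zd _] := Gz.
by rewrite cinvE// nmV lef_pV2// posrE// (lt_le_trans delta0).
Qed.

Lemma apx_ext f g : measC f -> (forall z, G z -> f z = g z) -> apx g -> apx f.
Proof.
move=> mf fg [_ hg]; split => // e /hg[p hp]; exists p; move: hp; rewrite /sqG.
by congr (_ < _)%E; apply: eq_integral => z /set_mem Gz; rewrite fg.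
Qed.

(** p(z) / z = q(z) + c / z for p = q X + c. *)
Lemma mult_cinv : apx cinv -> mult cinv.
Proof.
move=> ac; have d0 : 0 < delta^-1 by rewrite invr_gt0.
apply: (mult_poly_crit mG measC_cinv d0 nm_cinv).
elim/poly_ind => [|p c _].
  apply: (apx_ext _ _ (apx_poly mu G 0)).
    by apply: measCM; [exact: measC_cinv|exact: measC_poly].
  by move=> z _; rewrite horner0 mulr0.
apply: (@apx_ext _ (fun z => p.[z] + c * cinv z)).
- by apply: measCM; [exact: measC_cinv|exact: measC_poly].
- move=> z Gz; rewrite hornerMXaddC mulrDr [cinv z * c]mulrC; congr (_ + _).
  rewrite cinvE// mulrC -mulrA mulfV ?mulr1//.
  exact: (annulus_neq0 delta0 GM Gz).
- apply: apxD => //; first exact: apx_poly.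
  by have [_ _] := mult_cst mu mG c; apply.
Qed.

Lemma L2E f : L2 mu f <-> measC f /\ (sq f < +oo)%E.
Proof.
by split=> [] [mf h]; split => //; move: h; rewrite (L2norm_lty mG muG).
Qed.

(** The strict inequality for the norm becomes one for its square; for radius e it is
    enough to take min(1, e), whose square is at most e. *)
Lemma P2E f : P2 mu f <-> apx f.
Proof.
split=> [[/L2E[mf fy] h]|af].
  split => // e e0; pose d := Num.min 1 e.
  have d0 : 0 < d by rewrite lt_min ltr01.
  have [p hp] := h _ d0; exists p.
  have mfp : measC (fun z => f z - p.[z]) by apply: measCB => //; exact: measC_poly.
  move: hp; rewrite (L2norm_lt mG muG)// => /lt_le_trans; apply.
  rewrite lee_fin expr2 (@le_trans _ _ d)//; last by rewrite ge_min lexx orbT.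
  by rewrite ler_piMr ?(ltW d0)// ge_min lexx.
have [mf h] := af; split=> [|e e0].
  by apply/L2E; split => //; exact: (apx_lty mG GM af).
have [p hp] := h _ (exprn_gt0 2 e0); exists p; apply/(L2norm_lt mG muG) => //.
by apply: measCB => //; exact: measC_poly.
Qed.

Lemma apx_cinv_L2 : jordan_int G 0 -> apx cinv -> P2 mu = L2 mu.
Proof.
move=> G0 ac; apply/seteqP; split=> [f [//]|f /L2E[mf fy]]; apply/P2E.
have mc := mult_cinv ac.
have mRe : mult (fun z => ofR (Re z)).
  apply: (mult_ratapp mG delta0 GM mc cinvE _ (Re_ratapp Ggam delta0 GM G0)).
  by apply: measC_ofR; exact: measurable_Re.
have mIm : mult (fun z => ofR (Im z)).
  apply: (mult_ratapp mG delta0 GM mc cinvE _ (Im_ratapp Ggam delta0 GM G0)).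
  by apply: measC_ofR; exact: measurable_Im.
exact: (apx_L2 mG GM mRe mIm mf fy).
Qed.

Lemma L2_apx_cinv : P2 mu = L2 mu -> apx cinv.
Proof.
move=> PL; apply/P2E; rewrite PL; apply/L2E; split; first exact: measC_cinv.
apply: (sqG_bounded mu mG measC_cinv _ nm_cinv).
by rewrite invr_ge0 ltW.
Qed.

Lemma c00_bound (v : nat -> C) : c00 v -> exists N, forall n, (N <= n)%N -> v n = 0.
Proof.
move=> /finite_fsetP[X vX]; exists (\max_(i <- finmap.enum_fset X) i).+1 => n nN.
apply/eqP/negP => /negP vn.
have : n \in finmap.enum_fset X by move/(congr1 (fun A : set nat => A n)): vX => /= <-.
by move=> /(@leq_bigmax_seq _ _ xpredT id)/(_ isT); rewrite leqNgt nN.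
Qed.

Lemma hform_one_cons (v : nat -> C) N : (forall n, (N <= n)%N -> v n = 0) ->
  ((Re (hform (moment_matrix mu) (one_cons v)))%:E =
   sq (fun z => 1 + z * (\poly_(i < N) v i).[z])%R)%E.
Proof.
move=> vN; rewrite (@hform_moments R mu G mG muG M _ (one_cons v) N.+1).
- congr (sqG mu G); apply/funext => z.
  rewrite !horner_poly big_ord_recl expr0 mulr1 mulr_sumr; congr (_ + _).
  by apply: eq_bigr => i _; rewrite /= exprS mulrCA.
- by move=> z /GM/andP[].
- by case=> // n /vN.
Qed.

Lemma gamma_ge0 : (0 <= gamma (moment_matrix mu))%E.
Proof.
apply: le_ereal_inf_tmp => _ [v /c00_bound[N vN] <-].
by rewrite (hform_one_cons vN); exact: sqG_ge0.
Qed.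

(** A polynomial with constant term 1 is 1 + z q, and 1/z + q = (1 + z q) / z; the
    factors 1/z and z cost at most 1/delta^2 and (|M| + 1)^2. *)
Lemma gamma_apx_cinv : gamma (moment_matrix mu) = 0%E <-> apx cinv.
Proof.
split=> [g0|[_ ac]].
  split; first exact: measC_cinv.
  move=> e e0.
  have d2 : 0 < e / delta^-1 ^+ 2 by rewrite divr_gt0// exprn_gt0// invr_gt0.
  have : (gamma (moment_matrix mu) < (e / delta^-1 ^+ 2)%:E)%E by rewrite g0 lte_fin.
  move=> /ereal_inf_lt[_ [v /c00_bound[N vN] <-]].
  rewrite (hform_one_cons vN); set q := \poly_(i < N) v i => hq.
  (* 1/z is compared with - q, where P = 1 + z q is nearly optimal *)
  exists (- q).
  have K0 : 0 < delta^-1 ^+ 2 by rewrite exprn_gt0// invr_gt0.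
  apply: le_lt_trans (lt_scale (sqG_ge0 _ _ _) K0 hq).
  apply: sqG_le => //.
  - by apply: measCB; [exact: measC_cinv|exact: measC_poly].
  - apply: measCD; first exact: measC_cst.
    by apply: measCM; [exact: measC_id|exact: measC_poly].
  - by rewrite invr_ge0 ltW.
  - move=> z Gz; have z0 := annulus_neq0 delta0 GM Gz.
    rewrite cinvE// hornerN opprK.
    have -> : z^-1 + q.[z] = z^-1 * (1 + z * q.[z]) by rewrite mulrDr mulr1 mulKf.
    by rewrite nmM ler_wpM2r ?nm_ge0// -cinvE// nm_cinv.
apply/eqP; rewrite eq_le gamma_ge0 andbT; apply/lee_addgt0Pr => e e0; rewrite add0e.
have M0 : 0 < `|M| + 1 by rewrite ltr_wpDl.
have d2 : 0 < e / (`|M| + 1) ^+ 2 by rewrite divr_gt0// exprn_gt0.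
have [p hp] := ac _ d2.
(* 1 - z p has the coefficients 1, - p_0, - p_1, ... *)
pose v n := - p`_n.
have vN n : (size p <= n)%N -> v n = 0 by move=> pn; rewrite /v nth_default ?oppr0.
have pE : \poly_(i < size p) v i = - p.
  by apply/polyP => i; rewrite coef_poly coefN; case: ltnP => // /vN.
apply: (@le_trans _ _ (Re (hform (moment_matrix mu) (one_cons v)))%:E).
  apply: ereal_inf_lbound; exists v => //.
  apply: (@sub_finite_set _ _ `I_(size p)); last exact: finite_II.
  by move=> n /=; apply: contraNT; rewrite -leqNgt => /vN ->.
rewrite (hform_one_cons vN) pE.
apply: ltW; apply: le_lt_trans (lt_scale (sqG_ge0 _ _ _) (exprn_gt0 2 M0) hp).
apply: sqG_le => //.
- apply: measCD; first exact: measC_cst.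
  by apply: measCM; [exact: measC_id|exact: measC_poly].
- by apply: measCB; [exact: measC_cinv|exact: measC_poly].
- move=> z Gz; have z0 := annulus_neq0 delta0 GM Gz; have /GM/andP[_ zM] := Gz.
  rewrite cinvE// hornerN mulrN.
  have -> : 1 - z * p.[z] = z * (z^-1 - p.[z]) by rewrite mulrBr divff.
  by rewrite nmM ler_wpM2r ?nm_ge0// (le_trans zM)// (le_trans (ler_norm _))// lerDl ler01.
Qed.

End equivalence.

Theorem theorem1 (R : realType) (G : set (Cplx R))
    (mu : {finite_measure set (borelC R) -> \bar R})
    (hG : jordan_curve G) (h0 : jordan_int G 0)
    (hinf : infinite_set (measure_support mu))
    (hsub : measure_support mu `<=` G) :
  gamma (moment_matrix mu) = 0%E <-> P2 mu = L2 mu.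
Proof.
have [gam Ggam] := jordan_jparam hG.
have [M M0 GM] := curve_bounded Ggam.
have [delta delta0 Gd] := curve_far Ggam h0.1.
have GdM z : G z -> delta <= nm z <= M.
  by move=> Gz; rewrite GM// andbT -[z]subr0 Gd.
have muG := support_compl_null (closed_curve Ggam) hsub.
rewrite (gamma_apx_cinv Ggam muG delta0 GdM); split.
  exact: (apx_cinv_L2 Ggam muG delta0 GdM h0).
exact: (L2_apx_cinv Ggam muG delta0 GdM).
Qed.
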